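(* For every finite graph $G$, the bigraded Frobenius series of its chromatic symmetric homology satisfies $$\mathrm{Frob}_G(1,1)=X_G .$$
   Context: Graphs are finite; loops and multiple edges are allowed. $V=V(G)=\{v_1,\dots,v_n\}$, $E=E(G)=\{e_1,\dots,e_m\}$ with a fixed enumeration of the edges. $\mathfrak S_V\cong\mathfrak S_n$ is the symmetric group on $V$; representations are finite-dimensional over $\mathbb C$; $\mathcal S^\lambda$ is the Specht module (irreducible $\mathfrak S_n$-module) indexed by the partition $\lambda\vdash n$. Chromatic symmetric function: $X_G=\sum_\kappa x_{\kappa(v_1)}\cdots x_{\kappa(v_n)}$, the sum over all proper colourings $\kappa:V\to\mathbb N$ (i.e. $\kappa(u)\ne\kappa(w)$ whenever some edge has endpoints $u,w$), in variables $x_1,x_2,\dots$. States and modules. A state of $G$ is a spanning subgraph, identified with its edge set $F\subseteq E$. For $a\ge1$ let $\mathcal L_a=\bigoplus_{i=0}^{a-1}\mathcal S^{(a-i,1^i)}$, graded with $\mathcal S^{(a-i,1^i)}$ in degree $i$; equivalently $\mathcal L_a\cong\bigwedge^*\mathcal S^{(a-1,1)}$ with the exterior grading (for $a=1$ put $\mathcal S^{(0,1)}=0$). If the connected components of $(V,F)$ have vertex sets $B_1,\dots,B_r$ of sizes $b_1,\dots,b_r$, let $\mathfrak S_F=\mathfrak S_{B_1}\times\cdots\times\mathfrak S_{B_r}$ and $\mathcal M_F=\mathrm{Ind}_{\mathfrak S_F}^{\mathfrak S_V}(\mathcal L_{b_1}\otimes\cdots\otimes\mathcal L_{b_r})$,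 a graded $\mathfrak S_V$-module. Concretely: realise $\mathcal S^{(b-1,1)}$ for a $b$-element set $B$ as $W_B=\{x\in\mathbb C^B:\sum_{v\in B}x_v=0\}$, put $W_F=\bigoplus_kW_{B_k}\subseteq\mathbb C^V$; then $\mathcal L_{b_1}\otimes\cdots\otimes\mathcal L_{b_r}=\bigwedge^*W_F$ and $\mathcal M_F=\mathbb C[\mathfrak S_V]\otimes_{\mathbb C[\mathfrak S_F]}\bigwedge^*W_F$. Chain modules: $C_{i,j}(G)=\bigoplus_{|F|=i}(\mathcal M_F)_j$, $C_i(G)=\bigoplus_jC_{i,j}(G)$. Per-edge maps: let $F'=F-e$ with $e\in F$; write $\varepsilon$ for the corresponding edge of the Boolean lattice of states. If $F$ and $F'$ have the same components, $d_\varepsilon:\mathcal M_F\to\mathcal M_{F'}$ is the identity. Otherwise a component of $F$ splits into two components $A,B$ of $F'$. In the case that $F$ has only one component, $\mathrm{Res}_{\mathfrak S_A\times\mathfrak S_B}W_V=\mathcal T\oplus\mathbf 1$ with $\mathcal T=W_A\oplus W_B$ and $\mathbf 1$ trivial, so $\mathrm{Res}\,\bigwedge^*W_V=\bigwedge^*\mathcal T\oplus(\bigwedge^*\mathcal T)[1]$, where $(\bigwedge^*\mathcal T)[1]=\bigwedge^*\mathcal T\wedge\mathbf 1$, and $d_\varepsilon$ is the map corresponding under Frobenius reciprocity to the $(\mathfrak S_A\times\mathfrak S_B)$-map that is the identity on $\bigwedge^*\mathcal T$ and zero on $(\bigwedge^*\mathcal T)[1]$. In general $d_\varepsilon$ is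 obtained by tensoring this map with the identity on the factors of the other components and inducing to $\mathfrak S_V$. Explicitly, $d_\varepsilon(g\otimes x)=\sum_{h\in\mathfrak S_F/\mathfrak S_{F'}}gh\otimes(\bigwedge^*\pi)(h^{-1}x)$, where $\pi:W_F\to W_{F'}$ is the orthogonal projection. Signs and differential: encode $F$ by the binary string $z_1\cdots z_m$ with $z_i=1$ if $e_i\in F$ and $z_i=0$ otherwise. If $e=e_k$, $\mathrm{sgn}(\varepsilon)=(-1)^{s}$, where $s$ is the number of ones in positions after the $k$th. Set $d_i=\sum_\varepsilon\mathrm{sgn}(\varepsilon)d_\varepsilon:C_i(G)\to C_{i-1}(G)$, the sum over all $\varepsilon$ from a state with $i$ edges to one with $i-1$ edges, and $d_{i,j}:C_{i,j}(G)\to C_{i-1,j}(G)$ its degree $j$ part. Homology: $H_{i,j}(G)=\ker d_{i,j}/\mathrm{im}\,d_{i+1,j}$. The Frobenius series is $\mathrm{Frob}_G(q,t)=\sum_{i,j\ge0}(-1)^{i+j}t^iq^j\,\mathrm{ch}(H_{i,j}(G))$, where $\mathrm{ch}$ is the Frobenius characteristic, the additive map from (classes of) representations to symmetric functions with $\mathrm{ch}[\mathcal S^\lambda]=s_\lambda$ (Schur function). *)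

(* Defs.v *)
From HB Require Import structures.
From mathcomp Require Import all_boot all_order all_algebra all_fingroup.
From mathcomp Require Import mxrepresentation spectral finmap.
Set Implicit Arguments.
Unset Strict Implicit.
Unset Printing Implicit Defensive.
Import Order.TTheory GRing.Theory Num.Theory.
Local Open Scope ring_scope.

(* Throughout, C is any numClosedFieldType; the complex numbers are an
   instance.  In MathComp [(s * t)%g] is "first s, then t", so with row vectors
   a [mx_representation] of 'S_n is exactly a left module over 'S_n equipped
   with the functional composition g h := g \o h: the product written gh on
   paper is [(h * g)%g] here, and "g acts on x" is [x *m rG g]. *)

(* A monomial in the variables x_0, x_1, ...: its exponents. *)
Definition mono := {fsfun nat -> nat with 0%N}.

(* A formal power series in x_0, x_1, ... over the integers is given by its
   coefficients. *)
Definition series := mono -> int.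

(* A partition of n, padded with zeros to n parts. *)
Definition is_part n (la : {ffun 'I_n -> 'I_n.+1}) : bool :=
  [forall i : 'I_n, forall j : 'I_n, (i <= j)%N ==> (la j <= la i)%N]
  && ((\sum_i la i)%N == n).

Definition part n := {la : {ffun 'I_n -> 'I_n.+1} | is_part la}.

Definition in_shape n (la : part n) (c : 'I_n * 'I_n) : bool :=
  (c.2 < val la c.1)%N.

Definition cell n (la : part n) := {c : 'I_n * 'I_n | in_shape la c}.

(* A filling or a colouring whose monomial is mu only takes values in the
   (finite) support of mu. *)
Definition has_content (I : finType) (mu : mono)
    (T : {ffun I -> finsupp mu}) : bool :=
  [forall k : finsupp mu, #|[set i | T i == k]| == mu (val k)].

Definition semistandard n (la : part n) (mu : mono)
    (T : {ffun cell la -> finsupp mu}) : bool :=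
  [forall c : cell la, forall c' : cell la,
    (((val c).1 == (val c').1) && ((val c).2 < (val c').2)%N
       ==> (val (T c) <= val (T c'))%N)
    && (((val c).2 == (val c').2) && ((val c).1 < (val c').1)%N
       ==> (val (T c) < val (T c'))%N)].

Definition schur n (la : part n) : series := fun mu =>
  #|[set T : {ffun cell la -> finsupp mu} |
      semistandard T && has_content T]|%:Z.

(* The vertices are 'I_nv, the edges 'I_ne.  The order of the two endpoints of
   an edge plays no role; loops and multiple edges are allowed. *)
Record mgraph := MGraph {
  nv : nat;
  ne : nat;
  ends : 'I_ne -> 'I_nv * 'I_nv
}.

Definition proper (G : mgraph) (T : eqType) (kappa : 'I_(nv G) -> T) : bool :=
  [forall e, kappa (ends (m := G) e).1 != kappa (ends e).2].

Definition chromsym (G : mgraph) : series := fun mu =>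
  #|[set kappa : {ffun 'I_(nv G) -> finsupp mu} |
      proper kappa && has_content kappa]|%:Z.

Definition adj (G : mgraph) (F : {set 'I_(ne G)}) : rel 'I_(nv G) :=
  fun u v => [exists e in F, (ends e == (u, v)) || (ends e == (v, u))].

Definition same_comp (G : mgraph) (F : {set 'I_(ne G)}) : rel 'I_(nv G) :=
  connect (adj F).

(* The Young subgroup S_F. *)
Definition young (G : mgraph) (F : {set 'I_(ne G)}) : {set 'S_(nv G)} :=
  [set h : 'S_(nv G) | [forall v, same_comp F v (h v)]].

Section ComplexModules.
Variable C : numClosedFieldType.

(* Functions I -> C are row vectors indexed by #|I|; [bvec i] is the basis
   vector at i and [linext f] the linear map with bvec i |-> f i. *)
Definition bvec (I : finType) (i : I) : 'rV[C]_#|I| := delta_mx 0 (enum_rank i).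

Definition linext (I : finType) p (f : I -> 'rV[C]_p) : 'M[C]_(#|I|, p) :=
  \matrix_(a < #|I|) f (enum_val a).

Lemma bvecK (I : finType) p (f : I -> 'rV[C]_p) i : bvec i *m linext f = f i.
Proof. by rewrite /bvec -rowE rowK enum_rankK. Qed.

Lemma eq_on_bvec (I : finType) p (A B : 'M[C]_(#|I|, p)) :
  (forall i, bvec i *m A = bvec i *m B) -> A = B.
Proof.
move=> eqAB; apply/row_matrixP=> a; rewrite !rowE.
by have := eqAB (enum_val a); rewrite /bvec enum_valK.
Qed.

Section PermRepr.
Variables (gT : finGroupType) (I : finType) (to : {action gT &-> I}).

Definition perm_repr_mx (g : gT) : 'M[C]_#|I| := linext (fun i => bvec (to i g)).

Lemma perm_mx_repr : mx_repr [set: gT] perm_repr_mx.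
Proof.
split=> [|g h _ _].
  by apply: eq_on_bvec => i; rewrite bvecK mulmx1 act1.
by apply: eq_on_bvec => i; rewrite mulmxA !bvecK actM.
Qed.

Definition perm_repr : mx_representation C [set: gT] #|I| :=
  MxRepresentation perm_mx_repr.

Lemma bvec_act i g : bvec i *m perm_repr g = bvec (to i g).
Proof. exact: bvecK. Qed.

End PermRepr.

Section Specht.
Variable n : nat.

(* Tabloids of all shapes, as functions giving the row of each entry. *)
Definition tabl_act (f : {ffun 'I_n -> 'I_n}) (g : 'S_n) :=
  [ffun v => f ((g^-1)%g v)].

Lemma tabl_act1 : tabl_act^~ 1%g =1 id.
Proof. by move=> f; apply/ffunP=> v; rewrite ffunE invg1 perm1. Qed.

Lemma tabl_actM : forall f, act_morph tabl_act f.
Proof. by move=> f g h; apply/ffunP=> v; rewrite !ffunE invMg permM. Qed.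

Canonical tabloid_action := TotalAction tabl_act1 tabl_actM.

Definition tabloid_repr := perm_repr tabloid_action.

(* t v is the position of the entry v. *)
Definition tableau (la : part n) (t : {ffun 'I_n -> 'I_n * 'I_n}) : bool :=
  injectiveb t && ([set t v | v : 'I_n] == [set c | in_shape la c]).

Definition tabloid (t : {ffun 'I_n -> 'I_n * 'I_n}) : {ffun 'I_n -> 'I_n} :=
  [ffun v => (t v).1].

Definition col_stab (t : {ffun 'I_n -> 'I_n * 'I_n}) : {set 'S_n} :=
  [set s : 'S_n | [forall v, (t (s v)).2 == (t v).2]].

Definition polytabloid (t : {ffun 'I_n -> 'I_n * 'I_n}) :=
  \sum_(s in col_stab t) (-1) ^+ odd_perm s *: bvec (tabl_act (tabloid t) s).

Definition specht_space (la : part n) : 'M[C]_#|{ffun 'I_n -> 'I_n}| :=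
  (\sum_(t | tableau la t) <<polytabloid t>>)%MS.

Lemma polytabloid_act t (g : 'S_n) :
  polytabloid t *m tabloid_repr g = polytabloid [ffun v => t ((g^-1)%g v)].
Proof.
rewrite /polytabloid mulmx_suml [RHS](reindex_inj (conjg_inj g)) /=.
apply: eq_big => [s|s _].
  rewrite !inE; apply/forallP/forallP=> H v.
    by rewrite !ffunE conjgE !permM permK; apply: H.
  by have := H (g v); rewrite !ffunE conjgE !permM !permK.
rewrite -scalemxAl bvec_act /= odd_permJ; congr (_ *: bvec _).
by apply/ffunP=> v; rewrite !ffunE conjgE !invMg invgK !permM permK.
Qed.

Lemma specht_module (la : part n) : mxmodule tabloid_repr (specht_space la).
Proof.
apply/mxmoduleP=> g _; rewrite sumsmxMr; apply/sumsmx_subP=> t tP.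
rewrite (eqmxMr _ (genmxE _)) polytabloid_act.
set t' := finfun _; apply: (sumsmx_sup t'); last by rewrite genmxE.
case/andP: tP => /injectiveP t_inj /eqP t_im; apply/andP; split.
  by apply/injectiveP=> u v; rewrite !ffunE => /t_inj/perm_inj.
rewrite -t_im; apply/eqP/setP=> c; apply/imsetP/imsetP=> [] [v _ ->].
  by exists (g^-1 v)%g; rewrite ?ffunE.
by exists (g v); rewrite ?ffunE ?permK.
Qed.

Definition specht (la : part n) :=
  submod_repr (specht_module la).

End Specht.

Definition hom_space (gT : finGroupType) (G : {group gT}) p1 p2
    (rG1 : mx_representation C G p1) (rG2 : mx_representation C G p2) :
    {vspace 'M[C]_(p1, p2)} :=
  (\bigcap_(g in G) lker (linfun (fun M : 'M[C]_(p1, p2) =>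
                                   (rG1 g *m M - M *m rG2 g)%R)))%VS.

(* dim Hom(S^la, V) is the multiplicity of S^la in V, so this is the additive
   map sending S^la to s_la. *)
Definition frob_char n p (V : mx_representation C [set: 'S_n] p) : series :=
  fun mu => \sum_(la : part n) (\dim (hom_space (specht la) V))%:Z * schur la mu.

Section Exterior.
Variable n : nat.

(* The exterior algebra of C^n, with basis bvec S = e_s1 /\ ... /\ e_sj for
   S = {s1 < ... < sj}. *)
Definition ext := 'rV[C]_#|{set 'I_n}|.

(* Left exterior multiplication by w. *)
Definition wedge (w : 'rV[C]_n) (x : ext) : ext :=
  \row_(a < #|{set 'I_n}|) let T : {set 'I_n} := enum_val a in
    \sum_(t in T) (-1) ^+ #|[set s in T | (s < t)%N]|
                  * w 0 t * x 0 (enum_rank (T :\ t)).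

Definition wedges (ws : seq 'rV[C]_n) : ext := foldr wedge (bvec set0) ws.

(* The algebra endomorphism induced by the linear map x |-> x *m A. *)
Definition ext_mx (A : 'M[C]_n) : 'M[C]_#|{set 'I_n}| :=
  linext (fun S : {set 'I_n} => wedges [seq row s A | s <- enum S]).

(* The j-th exterior power of the row space of A. *)
Definition ext_pow (A : 'M[C]_n) (j : nat) : 'M[C]_#|{set 'I_n}| :=
  (\sum_(t : j.-tuple 'I_n) <<wedges [seq row i A | i <- t]>>)%MS.

End Exterior.

Section Homology.
Variable G : mgraph.
Local Notation n := (nv G).
Local Notation m := (ne G).
Implicit Types (F : {set 'I_m}) (g h : 'S_n).

(* W_F: vectors whose entries sum to zero over each component of F. *)
Definition Wspace F : 'M[C]_n :=
  kermx (\matrix_(v, u) (same_comp F v u)%:R).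

(* The chain modules are subquotients of
     (+)_F C['S_n] (x) /\^* C^n,
   where the basis vector at (F, g, S) is g (x) e_S in the summand F. *)
Definition state_ext : finType := ({set 'I_m} * 'S_n * {set 'I_n})%type.

Definition state_act (b : state_ext) (g : 'S_n) : state_ext :=
  (b.1.1, (b.1.2 * g)%g, b.2).

Lemma state_act1 : state_act^~ 1%g =1 id.
Proof. by case=> [[F g] S]; rewrite /state_act mulg1. Qed.

Lemma state_actM b : act_morph state_act b.
Proof. by move=> g h; rewrite /state_act mulgA. Qed.

Canonical state_action := TotalAction state_act1 state_actM.

Definition state_repr := perm_repr state_action.

(* x |-> g (x) x in the summand F. *)
Definition tens F g : 'M[C]_(#|{set 'I_n}|, #|state_ext|) :=
  linext (fun S : {set 'I_n} => @bvec state_ext (F, g, S)).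

Lemma tens_act F g h : tens F g *m state_repr h = tens F (g * h)%g.
Proof. by apply: eq_on_bvec => S; rewrite mulmxA !bvecK. Qed.

(* M_F = C['S_n] (x)_{C[S_F]} /\^* W_F is the quotient of
   C['S_n] (x) /\^* W_F by the span of the gh (x) x - g (x) hx, h in S_F.
   [chains i j] and [relations i j] are the degree j parts of these two spaces,
   summed over |F| = i. *)
Definition chains (i j : nat) : 'M[C]_#|state_ext| :=
  (\sum_(F : {set 'I_m} | #|F| == i) \sum_(g : 'S_n)
     <<ext_pow (Wspace F) j *m tens F g>>)%MS.

Definition relations (i j : nat) : 'M[C]_#|state_ext| :=
  (\sum_(F : {set 'I_m} | #|F| == i) \sum_(g : 'S_n) \sum_(h in young F)
     <<ext_pow (Wspace F) j *m
         (tens F (h * g)%g - ext_mx (perm_mx h) *m tens F g)>>)%MS.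

(* x |-> d_eps (g (x) x), for eps the edge from F to F - e; h runs over
   representatives of the left cosets of S_(F - e) in S_F, which are right
   cosets for the product of MathComp.  If F and F - e have the same components
   this is x |-> g (x) x on /\^* W_F. *)
Definition diff_edge F (e : 'I_m) g : 'M[C]_(#|{set 'I_n}|, #|state_ext|) :=
  \sum_(c in rcosets (young (F :\ e)) (young F))
     (let h := repr c in
      ext_mx (perm_mx h^-1%g) *m ext_mx (proj_ortho (Wspace (F :\ e)))
        *m tens (F :\ e) (h * g)%g).

Definition sgn_edge F (e : 'I_m) : C := (-1) ^+ #|[set l in F | (e < l)%N]|.

Definition diff : 'M[C]_#|state_ext| :=
  linext (fun b : state_ext => let: (F, g, T) := b in
    \sum_(e in F) sgn_edge F e *: (bvec T *m diff_edge F e g)).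

(* Inverse images of ker d_(i,j) and im d_(i+1,j) under the quotient map
   chains i j -> C_(i,j). *)
Definition cycles (i j : nat) : 'M[C]_#|state_ext| :=
  (chains i j :&: kermx (diff *m cokermx (relations i.-1 j)))%MS.

Definition boundaries (i j : nat) : 'M[C]_#|state_ext| :=
  (chains i.+1 j *m diff + relations i j)%MS.

Lemma chains_module i j : mxmodule state_repr (chains i j).
Proof.
apply/mxmoduleP=> h _; rewrite sumsmxMr; apply/sumsmx_subP=> F Fi.
rewrite sumsmxMr; apply/sumsmx_subP=> g _.
rewrite (eqmxMr _ (genmxE _)) -mulmxA tens_act.
by apply: (sumsmx_sup F) => //; apply: (sumsmx_sup (g * h)%g); rewrite ?genmxE.
Qed.

Lemma relations_module i j : mxmodule state_repr (relations i j).
Proof.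
apply/mxmoduleP=> k _; rewrite sumsmxMr; apply/sumsmx_subP=> F Fi.
rewrite sumsmxMr; apply/sumsmx_subP=> g _.
rewrite sumsmxMr; apply/sumsmx_subP=> h Fh.
rewrite (eqmxMr _ (genmxE _)) -mulmxA mulmxBl -mulmxA !tens_act -mulgA.
apply: (sumsmx_sup F) => //; apply: (sumsmx_sup (g * k)%g) => //.
by apply: (sumsmx_sup h); rewrite ?genmxE.
Qed.

Lemma diff_act g : diff *m state_repr g = state_repr g *m diff.
Proof.
apply: eq_on_bvec => -[[F k] S]; rewrite !mulmxA (bvec_act state_action) !bvecK /=.
rewrite mulmx_suml; apply: eq_bigr => e _; rewrite -scalemxAl; congr (_ *: _).
rewrite -mulmxA; congr (_ *m _); rewrite mulmx_suml; apply: eq_bigr => c _.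
by rewrite -mulmxA tens_act /= mulgA.
Qed.

Lemma cycles_module i j : mxmodule state_repr (cycles i j).
Proof.
apply: capmx_module; first exact: chains_module.
apply/mxmoduleP=> g Gg; apply/sub_kermxP.
have /mxmoduleP/(_ g Gg) := relations_module i.-1 j.
set R := relations _ _ => Rg; set K := kermx _.
have KR : (K *m diff <= R)%MS by rewrite submxE -mulmxA; apply/eqP/mulmx_ker.
rewrite mulmxA -(mulmxA K) -diff_act; apply/eqP.
by rewrite -submxE mulmxA (submx_trans _ Rg) // submxMr.
Qed.

Lemma boundaries_module i j : mxmodule state_repr (boundaries i j).
Proof.
apply: addsmx_module; last exact: relations_module.
apply/mxmoduleP=> g Gg; rewrite -mulmxA diff_act mulmxA submxMr //.
by move/mxmoduleP: (chains_module i.+1 j) => ->.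
Qed.

(* The section cycles / boundaries, i.e. ker d_(i,j) / im d_(i+1,j). *)
Definition homology (i j : nat) :=
  section_repr (boundaries_module i j) (cycles_module i j).

Definition Frob (q t : int) : series := fun mu =>
  \sum_(i < m.+1) \sum_(j < n.+1)
     (-1) ^+ (i + j) * t ^+ i * q ^+ j * frob_char (homology i j) mu.

End Homology.

End ComplexModules.

(* Main.v *)
(** Taking characters turns the homology into an Euler characteristic: the
    alternating sum of the H_(i,j) has the character of
    sum_F (-1)^|F| Ind (sum_j (-1)^j /\^j W_F), the induction being from S_F.
    The supertrace of h on /\^* W_F is det(1 - h) on W_F, which vanishes unless h is
    transitive on each component of F, and has mean 1 over S_F.

    On the other side, the Specht characters are an orthonormal basis of the class
    functions and S^la occurs K_(la,mu) times in the permutation module on the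
    colourings with content mu (Young's rule).  Hence the coefficient at mu of the
    Frobenius characteristic of V is the inner product of the character of V with
    the number fix_mu of fixed colourings with content mu.  For h in S_F transitive
    on each component, the colourings fixed by h are those constant on the
    components of F, so the coefficient at mu is
      sum_F (-1)^|F| #{kappa constant on the components of F},
    which counts proper colourings by inclusion-exclusion over the set of
    monochromatic edges. *)

From HB Require Import structures.
Require Import Defs.
From mathcomp Require Import all_boot all_order all_algebra all_fingroup.
From mathcomp Require Import mxrepresentation spectral finmap zify ring.
Set Implicit Arguments.
Unset Strict Implicit.
Unset Printing Implicit Defensive.
Import GRing.Theory Num.Theory.
Local Open Scope ring_scope.

(** * Traces on invariant subspaces *)

(** The chain modules are coinvariants, hence quotients, while traces are easiest to compute for
    matrices on a fixed space. The averaging operator [avg_state] therefore replaces each chain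
    module by the image of an idempotent, whose trace is read off matrix entries; the relations
    enter only as its kernel, and their traces cancel in the homology. Transitivity of h on the
    components is never formulated. The determinants are summed for one colouring at a time, and the
    two cases are whether or not that colouring is constant on the components of F. For the Specht
    modules the dominance order is replaced by the number [wt], by which any two shapes are
    comparable. For distinct shapes the vanishing of homomorphisms is proved in the direction that
    [wt] permits, and the symmetry of the pairing [cdot] covers the other. That pairing uses g^-1 in
    place of complex conjugation, so the representations need not be unitary. *)

Lemma rank_idem (F : fieldType) n (P : 'M[F]_n) :
  P *m P = P -> (\rank P)%:R = \tr P.
Proof.
move=> PP; have e := mulmx_base P.
have cr : row_base P *m col_base P = 1%:M.
  apply: (row_free_inj (row_base_free P)); rewrite mul1mx.
  apply: (row_full_inj (col_base_full P)).
  by rewrite mulmxA (mulmxA (col_base P)) e -mulmxA e PP.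
by rewrite -[in RHS]e mxtrace_mulC cr mxtrace1.
Qed.

(** Each fibre of [a] is listed in enumeration order and matched by index with the fibre of [b].
    This serves for tableaux of one shape, for fillings and colourings of one content, and for
    permutations of one cycle type. *)
Lemma fiber_bij (I J K : finType) (a : I -> K) (b : J -> K) :
    (forall k, #|[set i | a i == k]| = #|[set j | b j == k]|) ->
  exists2 p : I -> J, bijective p & forall i, b (p i) = a i.
Proof.
move=> eqc.
pose A i := [set i' | a i' == a i]; pose B i := [set j | b j == a i].
have Ai i : i \in A i by rewrite inE.
have lt i : (index i (enum (A i)) < size (enum (B i)))%N.
  by rewrite -cardE -eqc cardE index_mem mem_enum.
(* The default of [nth] must be an element of [J]; if there is none, the fibre counts make [I] empty
   too. *)
have [j0 | no] := pickP (fun _ : J => true); last first.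
  have noI (i : I) : False.
    by have := lt i; case: (enum (B i)) => // j _ _; have := no j.
  exists (fun i => False_rect J (noI i)) => [|i]; last by case: (noI i).
  exists (fun j => False_rect I (notF (etrans (esym (no j)) erefl))) => [i|j].
    by case: (noI i).
  by have := no j.
pose p i := nth j0 (enum (B i)) (index i (enum (A i))).
have pB i : p i \in B i by rewrite -mem_enum mem_nth.
have bp i : b (p i) = a i by have := pB i; rewrite inE => /eqP.
exists p => //.
have p_inj : injective p.
  move=> {}i i' e; have ea : a i = a i' by rewrite -!bp e.
  have eA : A i = A i' by rewrite /A ea.
  have eB : B i = B i' by rewrite /B ea.
  move: e; rewrite /p -eA -eB => /eqP; rewrite nth_uniq ?enum_uniq //; last first.
    by rewrite eA eB.
  by move/eqP=> h; apply: (@index_inj _ i (enum (A i))) h; rewrite mem_enum // eA.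
have cIJ : #|I| = #|J|.
  rewrite -!sum1_card (partition_big a predT) // [RHS](partition_big b predT) //.
  by apply: eq_bigr => k _; rewrite !sum1dep_card; apply: eqc.
exact: inj_card_bij p_inj (eq_leq (esym cIJ)).
Qed.

(** Turns the dimension of a space of matrices into a rank, which [rank_idem] can then compute as a
    trace. *)
Lemma dim_mxvec (F : fieldType) p q r (U : {vspace 'M[F]_(p, q)})
    (Q : 'M[F]_(r, p * q)) :
  (forall M, (M \in U) = (mxvec M <= Q)%MS) -> \dim U = \rank Q.
Proof.
move=> UQ; apply/eqP; rewrite eqn_leq; apply/andP; split.
  pose X := vbasis U; pose B := \matrix_i mxvec (tnth X i).
  have fB : row_free B.
    apply: inj_row_free => v vB; apply/rowP=> i; rewrite mxE.
    have/freeP fX := basis_free (vbasisP U).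
    apply: (fX (fun i => v 0 i)); apply: (can_inj mxvecK).
    rewrite linear0 -vB mulmx_sum_row linear_sum; apply: eq_bigr => k _.
    by rewrite linearZ /= rowK (tnth_nth 0).
  rewrite -(eqP fB); apply: mxrankS; apply/row_subP=> i.
  by rewrite rowK -UQ vbasis_mem // mem_tnth.
pose Y := [tuple vec_mx (row i (row_base Q)) | i < \rank Q].
have fY : free Y.
  apply/freeP=> k e i; have := row_base_free Q.
  rewrite -kermx_eq0 => /eqP kQ.
  have /sub_kermxP : (\row_i k i) *m row_base Q = 0.
    apply: (can_inj vec_mxK); rewrite linear0 -e mulmx_sum_row linear_sum.
    apply: eq_bigr => j _; rewrite mxE linearZ /=; congr (_ *: _).
    by rewrite -(tnth_nth 0 Y) tnth_mktuple.
  by rewrite kQ submx0 => /eqP/rowP/(_ i); rewrite !mxE.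
move: (fY); rewrite /free size_tuple => /eqP <-; apply: dimvS.
apply/span_subvP=> M /tnthP[i ->]; rewrite tnth_mktuple UQ vec_mxK.
by rewrite (submx_trans (row_sub _ _)) // eq_row_base.
Qed.

Section Trs.
Variable F : fieldType.

(* The trace of the restriction of A to U; meaningful only if U is A-stable. *)
Definition trs m n (U : 'M[F]_(m, n)) (A : 'M[F]_n) : F :=
  \tr (row_base U *m A *m pinvmx (row_base U)).

(** A change of basis conjugates the matrix of the restriction, so any basis [B] of [U] may be
    used. *)
Lemma trs_basis p m n (U : 'M[F]_(m, n)) (A : 'M[F]_n) (B : 'M[F]_(p, n)) M :
  row_free B -> (B :=: U)%MS -> B *m A = M *m B -> trs U A = \tr M.
Proof.
move=> fB BU BA; rewrite /trs.
move: (row_base U) (eq_row_base U) (row_base_free U) => R RU fR.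
have /submxP[Q defR] : (R <= B)%MS by rewrite RU BU.
have /submxP[S defB] : (B <= R)%MS by rewrite RU BU.
have SQ : S *m Q = 1%:M.
  by apply: (row_free_inj fB); rewrite mul1mx -mulmxA -defR -defB.
have eRA : R *m A *m pinvmx R = Q *m M *m S.
  apply: (row_free_inj fR); rewrite mulmxKpV.
    by rewrite -mulmxA -defB -mulmxA -BA {1}defR mulmxA.
  by rewrite {1}defR -mulmxA BA {1}defB !mulmxA submxMl.
by rewrite eRA mxtrace_mulC mulmxA SQ mul1mx.
Qed.

Lemma trs_eq m1 m2 n (U : 'M[F]_(m1, n)) (V : 'M[F]_(m2, n)) (A : 'M[F]_n) :
  (U :=: V)%MS -> (U *m A <= U)%MS -> trs U A = trs V A.
Proof.
move=> UV UA; rewrite [RHS](trs_basis (row_base_free U) (eqmx_trans (eq_row_base U) UV)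
  (esym (mulmxKpV _))) //.
by rewrite eq_row_base (eqmxMr _ (eq_row_base U)).
Qed.

(** A basis [K] of the kernel together with lifts [X] of a basis of the image makes [A] block
    triangular, with [a] and [c] on the diagonal. *)
Lemma trs_ker_im m n n' (V : 'M[F]_(m, n)) (A : 'M[F]_n) (A' : 'M[F]_n')
    (f : 'M[F]_(n, n')) :
    (V *m A <= V)%MS -> V *m A *m f = V *m f *m A' ->
  trs V A = trs (V *m f) A' + trs (V :&: kermx f)%MS A.
Proof.
move=> VA comm.
move: (row_base (V *m f)) (eq_row_base (V *m f)) (row_base_free (V *m f))
  => Y YV fY.
set I := (V :&: kermx f)%MS.
move: (row_base I) (eq_row_base I) (row_base_free I) => K KV fK.
have [X Xf XV] : exists2 X, X *m f = Y & (X <= V)%MS.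
  exists (Y *m pinvmx (V *m f) *m V); first by rewrite -mulmxA mulmxKpV // YV.
  by rewrite mulmx_sub.
have KsV : (K <= V)%MS by rewrite KV capmxSl.
have Kf : K *m f = 0 by apply/sub_kermxP; rewrite KV capmxSr.
have commS k (W : 'M_(k, n)) : (W <= V)%MS -> W *m A *m f = W *m f *m A'.
  by case/submxP=> D ->; rewrite -!mulmxA; congr (D *m _); rewrite !mulmxA.
have stabS k (W : 'M_(k, n)) : (W <= V)%MS -> (W *m A <= V)%MS.
  by move=> WV; rewrite (submx_trans _ VA) ?submxMr.
have /submxP[a Ka] : (K *m A <= K)%MS.
  rewrite KV sub_capmx stabS //=; apply/sub_kermxP.
  by rewrite commS // Kf mul0mx.
have /submxP[c Yc] : (Y *m A' <= Y)%MS.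
  by rewrite -Xf -commS // Xf YV submxMr ?stabS.
have /submxP[b Xb] : (X *m A - c *m X <= K)%MS.
  rewrite KV sub_capmx addmx_sub ?stabS //=; last first.
    by rewrite eqmx_opp mulmx_sub.
  by apply/sub_kermxP; rewrite mulmxBl commS // Xf -(mulmxA c) Xf Yc subrr.
have fB : row_free (col_mx K X).
  apply: inj_row_free => v; rewrite -[v]hsubmxK mul_row_col => e.
  have/eqP := congr1 (mulmx^~ f) e.
  rewrite mulmxDl -!mulmxA Kf mulmx0 add0r Xf mul0mx.
  rewrite mulmx_free_eq0 // => /eqP r0.
  move/eqP: e; rewrite r0 mul0mx addr0 mulmx_free_eq0 //.
  by move=> /eqP->; rewrite row_mx0.
have BV : (col_mx K X :=: V)%MS.
  apply/eqmxP; rewrite -mxrank_leqif_eq ?col_mx_sub ?KsV //.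
  rewrite (eqP fB); have := mxrank_mul_ker V f.
  by rewrite addnC => ->.
rewrite (trs_basis (M := block_mx a 0 b c) fB BV); last first.
  rewrite mul_col_mx mul_block_col mul0mx addr0 -Ka -Xb.
  by rewrite subrK.
by rewrite mxtrace_block addrC (trs_basis fY YV Yc) (trs_basis fK KV Ka).
Qed.

End Trs.

Section TrsLinear.
Variables (F : fieldType) (n : nat).

Lemma trs_sum m (U : 'M[F]_(m, n)) I (r : seq I) (P : pred I) (A : I -> 'M[F]_n) :
  trs U (\sum_(i <- r | P i) A i) = \sum_(i <- r | P i) trs U (A i).
Proof. by rewrite /trs mulmx_sumr mulmx_suml raddf_sum. Qed.

Lemma trsZ m (U : 'M[F]_(m, n)) a (A : 'M[F]_n) : trs U (a *: A) = a * trs U A.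
Proof. by rewrite /trs -scalemxAr -scalemxAl mxtraceZ. Qed.

Lemma trs_id m (U : 'M[F]_(m, n)) (A : 'M[F]_n) :
  U *m A = U -> trs U A = (\rank U)%:R.
Proof.
move=> UA; rewrite (trs_basis (M := 1%:M) (row_base_free U) (eq_row_base U)).
  by rewrite mxtrace1.
have /submxP[D ->] : (row_base U <= U)%MS by rewrite eq_row_base.
by rewrite -mulmxA UA mul1mx.
Qed.

Lemma trs_ker m (U : 'M[F]_(m, n)) (A : 'M[F]_n) : U *m A = 0 -> trs U A = 0.
Proof.
move=> UA; have /submxP[D e] : (row_base U <= U)%MS by rewrite eq_row_base.
by rewrite /trs e -(mulmxA D) UA mulmx0 mul0mx mxtrace0.
Qed.

Lemma trs_idem m (U : 'M[F]_(m, n)) (A : 'M[F]_n) :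
  (U *m A <= U)%MS -> A *m A = A -> trs U A = (\rank (U *m A))%:R.
Proof.
move=> UA AA; rewrite (trs_ker_im (f := A) (A' := A) UA) //.
rewrite trs_id -?mulmxA ?AA // trs_ker ?addr0 //.
by apply/sub_kermxP; rewrite capmxSr.
Qed.

End TrsLinear.

Section GroupSums.
Variables (V : nmodType) (gT : finGroupType) (G : {group gT}) (f : gT -> V).

Lemma sum_groupMr h : h \in G -> \sum_(g in G) f (g * h)%g = \sum_(g in G) f g.
Proof.
move=> Gh; rewrite [RHS](reindex_inj (mulIg h)) /=.
by apply: eq_bigl => g; rewrite groupMr.
Qed.

Lemma sum_groupMl h : h \in G -> \sum_(g in G) f (h * g)%g = \sum_(g in G) f g.
Proof.
move=> Gh; rewrite [RHS](reindex_inj (mulgI h)) /=.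
by apply: eq_bigl => g; rewrite groupMl.
Qed.

Lemma sum_groupV : \sum_(g in G) f g^-1%g = \sum_(g in G) f g.
Proof.
rewrite [RHS](reindex_inj invg_inj) /=.
by apply: eq_bigl => g; rewrite groupV.
Qed.

End GroupSums.

(** * Characters of sections and dimensions of Hom spaces *)

Section Characters.
Variables (F : fieldType) (gT : finGroupType) (G : {group gT}).

Lemma mxtrace_submod n (rG : mx_representation F G n) (U : 'M_n)
    (modU : mxmodule rG U) g :
  g \in G -> \tr (submod_repr modU g) = trs U (rG g).
Proof.
move=> Gg; apply/esym; apply: (trs_basis (B := val_submod 1%:M)).
- by rewrite /val_submod /= mul1mx row_base_free.
- exact: val_submod1.
- by rewrite -[RHS]val_submodE -[X in _ = val_submod X]mul1mx (val_submodJ modU).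
Qed.

Lemma mxtrace_section n (rG : mx_representation F G n) (U V : 'M_n)
    (modU : mxmodule rG U) (modV : mxmodule rG V) g :
    (U <= V)%MS -> g \in G ->
  \tr (section_repr modU modV g) = trs V (rG g) - trs U (rG g).
Proof.
move=> UV Gg; rewrite mxtrace_submod //.
have VgV : (V *m rG g <= V)%MS by rewrite mxmodule_trans.
pose f := in_factmod U (1%:M : 'M_n).
have Vf : (<<in_factmod U V>> :=: V *m f)%MS by rewrite -in_factmodE; apply: genmxE.
rewrite (trs_ker_im (f := f) (A' := factmod_repr modU g) VgV); last first.
  rewrite -!in_factmodE in_factmodJ //.
rewrite (trs_eq Vf) ?mxmodule_trans ?section_module //.
suff e : (V :&: kermx f :=: U)%MS.
  rewrite (trs_eq e) ?addrK //.
  by rewrite (eqmxMr _ e) e mxmodule_trans.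
apply: eqmx_trans (capmx_idPr UV).
apply: cap_eqmx => //; apply/eqmxP/rV_eqP => u.
by rewrite (sameP sub_kermxP eqP) -in_factmodE in_factmod_eq0.
Qed.

(** The map is a tensor product: its diagonal entry at the matrix unit (i, j) is [A i i * B j j]. *)
Lemma mxtrace_lin_mul p q (A : 'M[F]_p) (B : 'M[F]_q) :
  \tr (lin_mx (fun M : 'M_(p, q) => A *m M *m B)) = \tr A * \tr B.
Proof.
rewrite /mxtrace (reindex _ (curry_mxvec_bij _ _)) /=.
transitivity (\sum_(ij : 'I_p * 'I_q) A ij.1 ij.1 * B ij.2 ij.2); last first.
  rewrite -(pair_bigA _ (fun i j => A i i * B j j)) mulr_suml.
  by apply: eq_bigr => i _; rewrite mulr_sumr.
apply: eq_bigr => [[i j]] _ /=.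
rewrite mxE /= vec_mx_delta mxvecE mxE (bigD1 j) //= big1 ?addr0 => [|k nk].
  rewrite mxE (bigD1 i) //= big1 ?addr0 => [|k nk]; rewrite !mxE ?eqxx ?mulr1 //.
  by rewrite (negPf nk) mulr0.
rewrite mxE big1 ?mul0r // => l _.
by rewrite !mxE (negPf nk) andbF mulr0.
Qed.

Lemma mem_hom_capP p q (rG1 : mx_representation F G p)
    (rG2 : mx_representation F G q) M :
  reflect (forall g, g \in G -> rG1 g *m M = M *m rG2 g)
    (M \in (\bigcap_(g in G) lker (linfun (fun M : 'M_(p, q) =>
                             (rG1 g *m M - M *m rG2 g)%R)))%VS).
Proof.
have lin g : linear (fun M : 'M_(p, q) => (rG1 g *m M - M *m rG2 g)%R).
  by move=> a A B; rewrite mulmxDr mulmxDl -scalemxAr -scalemxAl scalerBr opprD addrACA.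
have kerE g : (M \in lker (linfun (fun M : 'M_(p, q) => (rG1 g *m M - M *m rG2 g)%R)))
    = (rG1 g *m M == M *m rG2 g).
  pose L := GRing.isLinear.Build _ _ _ _ _ (lin g).
  pose f : {linear 'M_(p, q) -> 'M_(p, q)} :=
    HB.pack (fun M : 'M_(p, q) => (rG1 g *m M - M *m rG2 g)%R) L.
  by rewrite memv_ker (lfunE f) /= subr_eq0.
rewrite memvE; apply: (iffP subv_bigcapP) => UM g Gg.
  by have := UM g Gg; rewrite -memvE kerE => /eqP.
by rewrite -memvE kerE UM.
Qed.

(** The average [pr] is a projector onto the intertwiners; its rank is its trace, and each group
    element contributes a product of two traces. *)
Lemma dim_hom_space p q (rG1 : mx_representation F G p)
    (rG2 : mx_representation F G q) : #|G|%:R != 0 :> F ->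
  (\dim (\bigcap_(g in G) lker (linfun (fun M : 'M_(p, q) =>
                             (rG1 g *m M - M *m rG2 g)%R)))%VS)%:R
  = #|G|%:R^-1 * \sum_(g in G) \tr (rG1 g^-1%g) * \tr (rG2 g).
Proof.
move=> nzG; set U := (\bigcap_(g in G) _)%VS.
pose pr (M : 'M_(p, q)) := #|G|%:R^-1 *: \sum_(g in G) rG1 g^-1%g *m M *m rG2 g.
have lpr : linear pr.
  move=> a M N; rewrite /pr (scalerA a) (mulrC a) -scalerA -scalerDr; congr (_ *: _).
  rewrite scaler_sumr -big_split; apply: eq_bigr => g _ /=.
  by rewrite mulmxDr mulmxDl -scalemxAr -scalemxAl.
pose Lp := GRing.isLinear.Build _ _ _ _ _ lpr.
pose fp : {linear 'M_(p, q) -> 'M_(p, q)} := HB.pack pr Lp.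
have prU M : pr M \in U.
  apply/mem_hom_capP => h Gh; rewrite /pr -scalemxAr -scalemxAl; congr (_ *: _).
  rewrite mulmx_sumr mulmx_suml -(sum_groupMr _ Gh).
  apply: eq_bigr => g Gg.
  by rewrite invMg !repr_mxM ?groupV // !mulmxA -repr_mxM ?groupV // mulgV repr_mx1 mul1mx.
have prid : forall M, M \in U -> pr M = M.
  move=> M /mem_hom_capP UM; rewrite /pr (eq_bigr (fun=> M)) => [|g Gg].
    by rewrite sumr_const -scaler_nat scalerA mulVf // scale1r.
  by rewrite -mulmxA -UM // mulmxA -repr_mxM ?groupV // mulVg repr_mx1 mul1mx.
rewrite (@dim_mxvec _ _ _ _ U (lin_mx fp)) => [|M]; last first.
  apply/idP/idP => [/prid {1}<-|/submxP[D e]].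
    by rewrite -(mul_vec_lin fp) submxMl.
  by rewrite -[M]mxvecK e mx_rV_lin; apply: prU.
rewrite rank_idem; last first.
  by apply/row_matrixP=> i; rewrite !rowE mulmxA !mul_rV_lin mxvecK; congr mxvec; apply/prid/prU.
rewrite mulr_sumr (_ : lin_mx fp = \sum_(g in G) #|G|%:R^-1 *:
    lin_mx (fun M : 'M_(p, q) => rG1 g^-1%g *m M *m rG2 g)).
  rewrite raddf_sum; apply: eq_bigr => g _.
  by rewrite /= mxtraceZ mxtrace_lin_mul.
apply/row_matrixP=> i; rewrite linear_sum /=; apply/rowP=> j.
rewrite !mxE summxE /= -/(pr _) /pr linearZ /= mxE linear_sum summxE mulr_sumr.
by apply: eq_bigr => g _; rewrite !mxE.
Qed.

End Characters.

(** * Tableaux *)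

Section Tableaux.
Variable n : nat.
Local Notation tab := {ffun 'I_n -> 'I_n * 'I_n}.
Implicit Types (t : tab) (la nu : part n) (s g : 'S_n).

Definition tabg t g : tab := [ffun v => t ((g^-1)%g v)].

Lemma tabgE t g v : tabg t g (g v) = t v.
Proof. by rewrite ffunE permK. Qed.

Lemma tabg_tableau la t g : tableau la t -> tableau la (tabg t g).
Proof.
case/andP=> /injectiveP t_inj /eqP t_im; apply/andP; split.
  by apply/injectiveP=> u v; rewrite !ffunE => /t_inj/perm_inj.
rewrite -t_im; apply/eqP/setP=> c; apply/imsetP/imsetP=> [] [v _ ->].
  by exists (g^-1 v)%g; rewrite ?ffunE.
by exists (g v); rewrite ?ffunE ?permK.
Qed.

Lemma tab_inj la t : tableau la t -> injective t.
Proof. by case/andP=> /injectiveP. Qed.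

Lemma tab_shape la t v : tableau la t -> in_shape la (t v).
Proof.
by case/andP=> _ /eqP/setP/(_ (t v)); rewrite inE => <-; apply: imset_f.
Qed.

Lemma tab_surj la t c : tableau la t -> in_shape la c -> exists v, t v = c.
Proof.
case/andP=> _ /eqP/setP/(_ c); rewrite inE => e c_in.
by move: e; rewrite c_in => /imsetP[v _ ->]; exists v.
Qed.

Lemma part_le la (i j : 'I_n) : (i <= j)%N -> (val la j <= val la i)%N.
Proof.
by have /andP[/forallP h _] := valP la; have /forallP/(_ j)/implyP := h i.
Qed.

Lemma shape_up la (c d : 'I_n * 'I_n) :
  (c.1 <= d.1)%N -> (c.2 <= d.2)%N -> in_shape la d -> in_shape la c.
Proof.
move=> le1 le2; rewrite /in_shape => d_in.
exact: leq_ltn_trans le2 (leq_trans d_in (part_le la le1)).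
Qed.

Lemma card_ord_lt (a : 'I_n.+1) : #|[set j : 'I_n | (j < a)%N]| = a.
Proof.
have le : (a <= n)%N by rewrite -ltnS.
rewrite cardsE -sum1_card big_mkcond -(big_mkord xpredT (fun j => if (j < a)%N then 1 else 0)%N).
rewrite (big_cat_nat (n := a)) //= big_nat (eq_bigr (fun=> 1)%N) => [|i /andP[_ ->] //].
rewrite -big_nat sum_nat_const_nat subn0 muln1 big_nat big1 ?addn0 // => i /andP[h _].
by rewrite ltnNge h.
Qed.

Lemma card_tab_row la t i :
  tableau la t -> #|[set v | (t v).1 == i]| = val la i.
Proof.
move=> tT; rewrite -(card_ord_lt (val la i)).
rewrite -(card_imset _ (tab_inj tT)) -(card_imset _ (can_inj (fun j : 'I_n => erefl
  : (i, j).2 = j))).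
apply: eq_card => c; apply/imsetP/imsetP => [[v]|[j]]; rewrite inE.
  move=> /eqP ri ->; exists (t v).2; last by rewrite -ri -surjective_pairing.
  by rewrite inE -{1}ri; apply: tab_shape.
by move=> ji ->; have [v tv] := tab_surj (c := (i, j)) tT ji; exists v; rewrite ?inE ?tv.
Qed.

(** The statistic often written n(la), the total row index of any tableau of shape la; it stands in
    for the dominance order. *)
Definition wt la := (\sum_(i < n) i * val la i)%N.

Lemma sum_tab_row la t : tableau la t -> (\sum_v (t v).1)%N = wt la.
Proof.
move=> tT; rewrite (partition_big (fun v => (t v).1) predT) //.
apply: eq_bigr => i _; rewrite -(card_tab_row i tT) cardsE -sum1_card big_distrr /=.
by apply: eq_big => [//|v /eqP->]; rewrite muln1.
Qed.

Lemma card_cell la : #|{: cell la}| = n.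
Proof.
rewrite card_sig -sum1_card.
rewrite (eq_bigr (fun c => ((fun _ _ : 'I_n => 1%N) c.1 c.2)))
  // -(pair_big_dep xpredT (fun i j => in_shape la (i, j)) (fun _ _ => 1%N)) /=.
rewrite [RHS](_ : n = \sum_i val la i)%N; last by have /andP[_ /eqP] := valP la.
apply: eq_bigr => i _; rewrite -(card_ord_lt (val la i)) sum1_card cardsE.
by apply: eq_card.
Qed.

Lemma exists_tableau la : exists t, tableau la t.
Proof.
have e : #|'I_n| = #|{: cell la}| by rewrite card_cell card_ord.
pose p v : cell la := enum_val (cast_ord e (enum_rank v)).
have pK : cancel p (fun c => enum_val (cast_ord (esym e) (enum_rank c))).
  by move=> v; rewrite /p enum_valK cast_ordK enum_rankK.
have Kp : cancel (fun c => enum_val (cast_ord (esym e) (enum_rank c))) p.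
  by move=> c; rewrite /p enum_valK cast_ordKV enum_rankK.
exists [ffun v => val (p v)]; apply/andP; split.
  by apply/injectiveP=> u v; rewrite !ffunE => /val_inj/(can_inj pK).
apply/eqP/setP=> c; rewrite inE; apply/imsetP/idP => [[v _ ->]|c_in].
  by rewrite ffunE; apply: valP.
by exists (enum_val (cast_ord (esym e) (enum_rank (Sub c c_in : cell la)))); rewrite ?ffunE ?Kp.
Qed.

Lemma col_stabP t s :
  reflect (forall v, (t (s v)).2 = (t v).2) (s \in col_stab t).
Proof. by rewrite inE; apply: (iffP forallP) => h v; apply/eqP. Qed.

Lemma group_set_col_stab t : group_set (col_stab t).
Proof.
apply/group_setP; split=> [|a b /col_stabP ha /col_stabP hb]; apply/col_stabP=> v.
  by rewrite perm1.
by rewrite permM hb ha.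
Qed.
Canonical col_stab_group t := Group (group_set_col_stab t).

Lemma tperm_col_stab t u v : (t u).2 = (t v).2 -> tperm u v \in col_stab t.
Proof. by move=> uv; apply/col_stabP=> w; case: tpermP => // ->. Qed.

(** The swap changes the sum by (r v - r u) * (f (s u) - f (s v)), a product of two positive
    factors. *)
Lemma swap_gain (f r : 'I_n -> nat) s u v :
    (r u < r v)%N -> (f (s v) < f (s u))%N ->
  (\sum_w f (s w) * r w < \sum_w f ((tperm u v * s)%g w) * r w)%N.
Proof.
move=> ruv fuv; have nuv : v != u by apply: contraTneq ruv => ->; rewrite ltnn.
rewrite (bigD1 u) // (bigD1 v) //= [X in (_ < X)%N](bigD1 u) // (bigD1 v) //=.
rewrite !permM tpermL tpermR !addnA.
rewrite (eq_bigr (fun w => f ((tperm u v * s)%g w) * r w)%N) => [|w /andP[wu wv]].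
  rewrite ltn_add2r; move: (r u) (r v) (f (s u)) (f (s v)) ruv fuv => x y a b xy ba.
  rewrite -(subnK (ltnW xy)) -(subnK (ltnW ba)); nia.
by rewrite permM tpermD // eq_sym.
Qed.

(** A maximiser of the row-weighted sum over the column group is sorted, because an inverted pair in
    a column could be swapped for a gain. *)
Lemma col_sort t (f : 'I_n -> nat) :
  exists2 s, s \in col_stab t & forall u v, (t u).2 = (t v).2 ->
    ((t u).1 < (t v).1)%N -> (f (s u) <= f (s v))%N.
Proof.
case: (arg_maxnP (fun s : 'S_n => (\sum_w f (s w) * (t w).1)%N) (group1 (col_stab_group t)))
  => s Cs s_max; exists s => // u v c r.
rewrite leqNgt; apply/negP => lt; have := swap_gain (r := fun v => (t v).1) r lt.
by rewrite ltnNge => /negP; apply; apply: s_max; apply: groupM => //; apply: tperm_col_stab.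
Qed.

Definition col_strict t (f : 'I_n -> nat) :=
  forall u v, (t u).2 = (t v).2 -> ((t u).1 < (t v).1)%N -> (f u < f v)%N.

(* If a moves some entry, let v be a moved entry in the lowest possible row:
   then a^-1 v and v are in the wrong order, and swapping them increases the sum. *)
Lemma col_rearrangement la t (f : 'I_n -> nat) s :
    tableau la t -> col_strict t f -> s \in col_stab t -> s != 1%g ->
  (\sum_v f (s v) * (t v).1 < \sum_v f v * (t v).1)%N.
Proof.
move=> tT f_str.
pose S (a : 'S_n) := (\sum_v f (a v) * (t v).1)%N.
have improve a : a \in col_stab t -> a != 1%g ->
    exists2 b, b \in col_stab t & (S a < S b)%N.
  move=> Ca a1; have [v0 mv0] : exists v, a v != v.
    by apply/existsP; rewrite -negb_forall; apply: contra a1 => /forallP h;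
       apply/eqP/permP=> v; rewrite perm1; apply/eqP.
  case: (arg_maxnP (fun v => (t v).1 : nat) (mv0 : (fun v => a v != v) v0)) => v mv v_max.
  have row_lt w : (t w).2 = (t v).2 -> a w != w -> w != v -> ((t w).1 < (t v).1)%N.
    move=> cw mw nwv; rewrite ltn_neqAle; apply/andP; split; last exact: v_max.
    by apply: contra nwv => /eqP/val_inj rw; apply/eqP/(tab_inj tT);
       rewrite (surjective_pairing (t w)) rw cw -surjective_pairing.
  have /col_stabP Ca' := Ca.
  pose u := (a^-1)%g v; have au : a u = v by rewrite permKV.
  have nuv : u != v by apply: contra mv => /eqP uv; rewrite -{1}uv au.
  have ruv : ((t u).1 < (t v).1)%N by rewrite row_lt // ?au 1?eq_sym // -(Ca' u) au.
  have lt : (f (a v) < f (a u))%N.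
    rewrite au f_str // row_lt //; by rewrite (inj_eq perm_inj).
  exists (tperm u v * a)%g; last exact: (@swap_gain f (fun v => (t v).1) a u v ruv lt).
  by apply: groupM => //; apply: tperm_col_stab; rewrite -(Ca' u) au.
case: (arg_maxnP S (group1 (col_stab_group t))) => m Cm m_max Cs s1.
have m1 : m = 1%g.
  apply/eqP; apply/negP => /negP m1; have [b Cb] := improve m Cm m1.
  by rewrite ltnNge => /negP; apply; apply: m_max.
have [b Cb lt] := improve s Cs s1.
have <- : S 1%g = (\sum_v f v * (t v).1)%N.
  by apply: eq_bigr => v _; rewrite perm1.
rewrite -m1; exact: leq_trans lt (m_max b Cb).
Qed.

End Tableaux.

(** Multiplication by the odd [tau] permutes [D], preserves [phi] and reverses all signs, so the sum
    equals its own negative. *)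
Lemma sign_sum_eq0 (C : numFieldType) (V : lmodType C) n (D : {group 'S_n})
    (phi : 'S_n -> V) (tau : 'S_n) :
    tau \in D -> odd_perm tau -> (forall s, s \in D -> phi (tau * s)%g = phi s) ->
  \sum_(s in D) (-1) ^+ odd_perm s *: phi s = 0.
Proof.
move=> Dtau odd_tau inv; set S := \sum_(s in D) _.
have e : S = - S.
  rewrite {1}/S -(sum_groupMl _ Dtau) -sumrN; apply: eq_bigr => s Ds.
  by rewrite inv // odd_permM odd_tau signr_addb expr1 mulN1r scaleNr.
apply/eqP; have : (2%:R : C) *: S == 0 by rewrite scaler_nat mulr2n {1}e addNr.
by rewrite scaler_eq0 pnatr_eq0.
Qed.

(** * Polytabloids *)

Section Polytabloids.
Variables (C : numClosedFieldType) (n : nat).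
Local Notation tab := {ffun 'I_n -> 'I_n * 'I_n}.
Local Notation tbl := {ffun 'I_n -> 'I_n}.
Local Notation rho := (@tabloid_repr C n).
Local Notation e_ t := (@polytabloid C n t).
Implicit Types (t : tab) (la nu : part n) (s g : 'S_n) (f : tbl).

Lemma tabl_act_bvec f g : @bvec C _ f *m rho g = bvec C (tabl_act f g).
Proof. exact: bvec_act. Qed.

Lemma polytabloid_tabg t g : e_ t *m rho g = e_ (tabg t g).
Proof. exact: polytabloid_act. Qed.

Definition colsym t : 'M[C]_#|tbl| :=
  \sum_(s in col_stab t) (-1) ^+ odd_perm s *: rho s.

Lemma bvec_colsym f t :
  bvec C f *m colsym t = \sum_(s in col_stab t) (-1) ^+ odd_perm s *: bvec C (tabl_act f s).
Proof.
by rewrite mulmx_sumr; apply: eq_bigr => s _; rewrite -scalemxAr tabl_act_bvec.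
Qed.

Lemma polytabloidE t : e_ t = bvec C (tabloid t) *m colsym t.
Proof. by rewrite bvec_colsym. Qed.

Lemma colsymMl t g : g \in col_stab t -> rho g *m colsym t = (-1) ^+ odd_perm g *: colsym t.
Proof.
move=> Cg; rewrite {2}/colsym -(@sum_groupMl _ _ (col_stab_group t) _ g) //.
rewrite mulmx_sumr scaler_sumr; apply: eq_bigr => s Cs.
by rewrite -scalemxAr -repr_mxM ?inE // scalerA odd_permM signr_addb mulrA -expr2 sqrr_sign mul1r.
Qed.

Lemma colsymMr t g : g \in col_stab t -> colsym t *m rho g = (-1) ^+ odd_perm g *: colsym t.
Proof.
move=> Cg; rewrite {2}/colsym -(@sum_groupMr _ _ (col_stab_group t) _ g) //.
rewrite mulmx_suml scaler_sumr; apply: eq_bigr => s Cs.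
rewrite -scalemxAl -repr_mxM ?inE // scalerA odd_permM signr_addb mulrC -mulrA.
by rewrite -expr2 sqrr_sign mulr1.
Qed.

Lemma colsym_sqr t : colsym t *m colsym t = #|col_stab t|%:R *: colsym t.
Proof.
rewrite {1}/colsym mulmx_suml (eq_bigr (fun=> colsym t)) => [|s Cs].
  by rewrite sumr_const scaler_nat.
by rewrite -scalemxAl colsymMl // scalerA -expr2 sqrr_sign scale1r.
Qed.

Lemma polytabloid_col t s : s \in col_stab t -> e_ (tabg t s) = (-1) ^+ odd_perm s *: e_ t.
Proof.
by move=> Cs; rewrite -polytabloid_tabg polytabloidE -mulmxA colsymMr // scalemxAr.
Qed.

Lemma bvec_colsym0 t f u v :
  u != v -> (t u).2 = (t v).2 -> f u = f v -> bvec C f *m colsym t = 0.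
Proof.
move=> nuv cuv fuv; rewrite bvec_colsym.
apply: (@sign_sum_eq0 _ _ _ (col_stab_group t) _ (tperm u v)).
- exact: tperm_col_stab.
- by rewrite odd_tperm.
move=> s _; congr (bvec C _); apply/ffunP=> w; rewrite !ffunE invMg tpermV permM.
by case: tpermP => // ->; rewrite fuv.
Qed.

(** Down a column the values increase strictly from row 0, so they grow at least as fast as the row
    index. *)
Lemma col_strict_ge_row la t (f : 'I_n -> nat) v :
  tableau la t -> col_strict t f -> ((t v).1 <= f v)%N.
Proof.
move=> tT f_str; move: {2}(nat_of_ord (t v).1) (erefl (nat_of_ord (t v).1)) => i.
elim: i v => [|i IH] v rv; first by rewrite rv.
have lt_in : (i < n)%N by rewrite ltnW // -rv.
have [u tu] : exists u, t u = (Ordinal lt_in, (t v).2).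
  by apply: (tab_surj tT); apply: (shape_up _ _ (tab_shape v tT)); rewrite /= ?rv.
rewrite rv; apply: (@leq_ltn_trans (f u)); first by have := IH u; rewrite tu; apply.
by apply: f_str; rewrite tu //= rv.
Qed.

(** A tabloid with two entries of a column of [t] in one row is killed. Otherwise, once sorted, its
    row indices increase strictly down every column of [t], hence are at least the rows of [t], and
    the bound on the total forces equality. *)
Lemma bvec_colsym_cases la t f :
    tableau la t -> (\sum_v f v <= \sum_v (t v).1)%N ->
  bvec C f *m colsym t = 0 \/ exists2 s, s \in col_stab t & f = tabl_act (tabloid t) s.
Proof.
move=> tT le_f.
have [/existsP[u /existsP[v /and3P[nuv /eqP cuv /eqP fuv]]] | /existsPn no]
  := boolP [exists u, exists v, [&& u != v, (t u).2 == (t v).2 & f u == f v]].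
  by left; apply: (bvec_colsym0 nuv).
right; have [s Cs s_le] := col_sort t (fun v => f v); exists s => //.
have /col_stabP Cs' := Cs.
have str : col_strict t (fun v => f (s v)).
  move=> u v cuv ruv; rewrite ltn_neqAle s_le // andbT.
  apply/eqP=> /val_inj fuv; have /existsPn/(_ (s v)) := no (s u).
  rewrite !Cs' cuv fuv !eqxx !andbT (inj_eq perm_inj) negbK => /eqP uv.
  by move: ruv; rewrite uv ltnn.
have ge v := col_strict_ge_row v tT str.
have eq v : f (s v) = (t v).1.
  apply/val_inj/eqP; rewrite eq_sym eqn_leq ge /= leqNgt; apply/negP=> lt.
  have : (\sum_w (t w).1 < \sum_w f (s w))%N.
    rewrite (bigD1 v) //= [X in (_ < X)%N](bigD1 v) //= -addSn leq_add //.
    by apply: leq_sum => w _.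
  have <- : (\sum_w f w = \sum_w f (s w))%N by rewrite (reindex_inj (@perm_inj _ s)).
  by rewrite ltnNge le_f.
by apply/ffunP=> v; rewrite !ffunE -eq permKV.
Qed.

(* The union A of the bottom of column j and B of the top of column j' has one
   more element than column j, so every tabloid occurring in the polytabloid has
   two elements of A :|: B in the same row. *)
Lemma garnir la t (i j j' : 'I_n) :
    tableau la t -> (j < j')%N -> in_shape la (i, j') ->
  let A := [set v | ((t v).2 == j) && (i <= (t v).1)%N] in
  let B := [set v | ((t v).2 == j') && ((t v).1 <= i)%N] in
  \sum_(s in Sym (A :|: B)) (-1) ^+ odd_perm s *: e_ (tabg t s) = 0.
Proof.
move=> tT jj' sh A B; set Z := A :|: B.
rewrite (eq_bigr (fun s => \sum_(a in col_stab t)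
    (-1) ^+ odd_perm a *: ((-1) ^+ odd_perm s *: bvec C (tabl_act (tabl_act (tabloid t) a)
      s)))); last first.
  move=> s _; rewrite -polytabloid_tabg /polytabloid mulmx_suml scaler_sumr.
  by apply: eq_bigr => a _; rewrite -scalemxAl tabl_act_bvec !scalerA mulrC.
rewrite exchange_big big1 //= => a Ca; rewrite -scaler_sumr.
have /col_stabP Ca' := groupVr (Ca : a \in col_stab_group t).
pose R := [set r : 'I_n | in_shape la (r, j)].
pose h z := (t (a^-1 z)%g).1.
have hR z : z \in Z -> h z \in R.
  have sh_z := tab_shape (a^-1 z)%g tT.
  rewrite !inE => /orP[/andP[/eqP c _]|/andP[/eqP c _]];
    by apply: (shape_up _ _ sh_z); rewrite //= Ca' c // ltnW.
have ltRZ : (#|R| < #|Z|)%N.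
  have dAB : [disjoint A & B].
    apply/pred0P=> v /=; rewrite !inE; apply/negP=> /andP[/andP[/eqP-> _] /andP[/eqP e _]].
    by rewrite e ltnn in jj'.
  have /eqP-> : #|Z| == (#|A| + #|B|)%N by rewrite (leq_card_setU A B).2.
  pose U := [set r : 'I_n | (i <= r)%N].
  rewrite -(cardsID U R) -addnS leq_add //.
    apply: leq_trans (leq_imset_card (fun v => (t v).1) A); apply/subset_leq_card/subsetP=> r.
    rewrite !inE => /andP[rj ir]; have [v tv] := tab_surj tT rj.
    by apply/imsetP; exists v; rewrite ?inE tv ?eqxx.
  apply: leq_trans (leq_imset_card (fun v => (t v).1) B); apply: proper_card.
  apply/properP; split.
    apply/subsetP=> r; rewrite !inE -ltnNge => /andP[ri _].
    have [v tv] := tab_surj tT (shape_up (c := (r, j')) (d := (i, j')) (ltnW ri) (leqnn _) sh).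
    by apply/imsetP; exists v; rewrite ?inE tv //= eqxx ltnW.
  exists i; last by rewrite !inE leqnn.
  have [v tv] := tab_surj tT sh.
  by apply/imsetP; exists v; rewrite ?inE tv //= eqxx leqnn.
have [/existsP[z1 /existsP[z2 /and4P[Z1 Z2 n12 /eqP h12]]] | no] :=
  boolP [exists z1, exists z2, [&& z1 \in Z, z2 \in Z, z1 != z2 & h z1 == h z2]].
  have Zt : tperm z1 z2 \in Sym_group Z.
    by rewrite inE; apply/subsetP=> z; rewrite inE; case: tpermP => [->|->|] // _ _; rewrite eqxx.
  have e0 := @sign_sum_eq0 _ _ _ (Sym_group Z)
    (fun s => bvec C (tabl_act (tabl_act (tabloid t) a) s)) _ Zt.
  rewrite [X in _ *: X]e0 ?scaler0 ?odd_tperm // => s _.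
  congr (bvec C _); apply/ffunP=> w; rewrite !ffunE invMg tpermV permM.
  by case: tpermP => // ->; rewrite -/(h z1) -/(h z2).
suff : (#|Z| <= #|R|)%N by rewrite leqNgt ltRZ.
rewrite -(card_in_imset (f := h)) => [|z1 z2 Z1 Z2 h12]; last first.
  apply/eqP; apply: contraR no => n12.
  by apply/existsP; exists z1; apply/existsP; exists z2; rewrite Z1 Z2 n12 h12 /=.
by apply/subset_leq_card/subsetP=> r /imsetP[z Zz ->]; apply: hR.
Qed.


End Polytabloids.

(** * Homomorphisms between Specht modules and orthogonality of their characters *)

Section SpechtHom.
Variables (C : numClosedFieldType) (n : nat).
Local Notation tab := {ffun 'I_n -> 'I_n * 'I_n}.
Local Notation tbl := {ffun 'I_n -> 'I_n}.
Local Notation rho := (@tabloid_repr C n).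
Local Notation e_ t := (@polytabloid C n t).
Local Notation S_ la := (@specht_space C n la).
Implicit Types (t : tab) (la nu : part n) (s g : 'S_n) (f : tbl).

Lemma bvecE (I : finType) (i j : I) : bvec C i 0 (enum_rank j) = (i == j)%:R.
Proof. by rewrite mxE eqxx (inj_eq enum_rank_inj) eq_sym. Qed.

Lemma tabloid_tabg t s : tabl_act (tabloid t) s = tabloid (tabg t s).
Proof. by apply/ffunP=> v; rewrite !ffunE. Qed.

(** Every cell of the shape carries exactly one entry and every other position none, so two tableaux
    have fibres of equal size. *)
Lemma tableau_transitive la t t' :
  tableau la t -> tableau la t' -> exists g, t' = tabg t g.
Proof.
move=> tT tT'.
have card_fib t0 k : tableau la t0 -> #|[set v | t0 v == k]| = in_shape la k.
  move=> t0T; case: (boolP (in_shape la k)) => [/(tab_surj t0T)[v tv]|k_out].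
    apply: (etrans _ (cards1 v)); apply: eq_card => u; rewrite !inE -tv.
    exact: inj_eq (tab_inj t0T) _ _.
  apply: eq_card0 => v; rewrite inE; apply: contraNF k_out => /eqP <-.
  exact: tab_shape.
have [k|p bij_p tp] := @fiber_bij _ _ _ t' t; first by rewrite !card_fib.
exists (perm (bij_inj bij_p))^-1%g; apply/ffunP=> v.
by rewrite ffunE invgK permE tp.
Qed.

Lemma polytabloid_sub la t : tableau la t -> (e_ t <= S_ la)%MS.
Proof. by move=> tT; rewrite (sumsmx_sup t) // genmxE. Qed.

Lemma sub_spechtP la m (A : 'M[C]_(#|tbl|, m)) :
  (forall t, tableau la t -> e_ t *m A = 0) -> S_ la *m A = 0.
Proof.
move=> h; apply/eqP; rewrite -submx0 /specht_space sumsmxMr_gen; apply/sumsmx_subP=> t tT.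
by rewrite genmxE (eqmxMr _ (genmxE _)) h // sub0mx.
Qed.

Lemma polytabloid_neq0 la t : tableau la t -> e_ t != 0.
Proof.
move=> tT; apply/eqP=> /rowP/(_ (enum_rank (tabloid t))).
rewrite mxE summxE (bigD1 1%g) ?(group1 (col_stab_group t))
  //= big1 => [|s /andP[/col_stabP Cs s1]].
  rewrite addr0 odd_perm1 scale1r tabl_act1 bvecE eqxx => /eqP.
  by rewrite oner_eq0.
rewrite mxE bvecE; case: eqP => [/ffunP h|]; last by rewrite mulr0.
case/eqP: s1; apply/permP=> v; rewrite perm1; apply: (tab_inj tT).
have := h (s v); rewrite !ffunE permK => r.
by rewrite (surjective_pairing (t (s v))) Cs -r -surjective_pairing.
Qed.

(** The bound on [wt] brings every tabloid of [e_ t'] under [bvec_colsym_cases]: it is killed, or it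
    is a column rearrangement of the tabloid of [t], and then the two shapes have the same row
    lengths. *)
Lemma polytabloid_colsym la nu t t' :
    tableau la t -> tableau nu t' -> (wt nu <= wt la)%N ->
  (e_ t' *m colsym C t <= e_ t)%MS /\ (la != nu -> e_ t' *m colsym C t = 0).
Proof.
move=> tT tT' le_wt.
have H s : (bvec C (tabl_act (tabloid t') s) *m colsym C t <= e_ t)%MS /\
   (la != nu -> bvec C (tabl_act (tabloid t') s) *m colsym C t = 0).
  have sT' := tabg_tableau s tT'; rewrite tabloid_tabg.
  have le : (\sum_v tabloid (tabg t' s) v <= \sum_v (t v).1)%N.
    rewrite (sum_tab_row tT); apply: leq_trans le_wt; rewrite -(sum_tab_row sT').
    by apply: leq_sum => v _; rewrite [tabloid _ _]ffunE.
  have [->|[a Ca e]] := bvec_colsym_cases C tT le; first by rewrite sub0mx.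
  split.
    rewrite e -tabl_act_bvec -mulmxA colsymMl // -scalemxAr -polytabloidE.
    exact: scalemx_sub.
  rewrite tabloid_tabg in e.
  case/negP; apply/eqP/val_inj/ffunP=> i; apply/val_inj.
  rewrite /= -(card_tab_row i (tabg_tableau a tT)) -(card_tab_row i sT').
  apply: eq_card => v; rewrite !inE; move/ffunP/(_ v): e.
  by rewrite ![tabloid _ _]ffunE => ->.
split=> [|nl]; rewrite /polytabloid mulmx_suml.
  by apply: summx_sub => s _; rewrite -scalemxAl scalemx_sub //; have [] := H s.
by rewrite big1 // => s _; rewrite -scalemxAl; have [_ ->] := H s; rewrite ?scaler0.
Qed.

(* M on the coordinates of S_la, extended by zero on the complement of S_la given
   by [in_submod], as an operator on tabloids. *)
Definition ambient_hom la nu (M : 'M[C]_(\rank (S_ la), \rank (S_ nu))) : 'M_#|tbl| :=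
  in_submod (S_ la) 1%:M *m M *m val_submod 1%:M.

Section Intertwiner.
Variables (la nu : part n) (M : 'M[C]_(\rank (S_ la), \rank (S_ nu))).
Hypothesis homM : forall g, specht C la g *m M = M *m specht C nu g.
Hypothesis le_wt : (wt nu <= wt la)%N.

Local Notation theta := (ambient_hom M).

Lemma ambient_homE m (x : 'M_(m, _)) : x *m theta = val_submod (in_submod (S_ la) x *m M).
Proof. by rewrite /ambient_hom mulmxA (mulmxA x) -in_submodE -val_submodE. Qed.

Let theta_sub m (x : 'M_(m, _)) : (x *m theta <= S_ nu)%MS.
Proof. by rewrite ambient_homE val_submodP. Qed.

Lemma ambient_homP m (x : 'M_(m, _)) g :
  (x <= S_ la)%MS -> x *m rho g *m theta = x *m theta *m rho g.
Proof.
move=> xS; rewrite !ambient_homE (in_submodJ (specht_module C la)) // -mulmxA.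
rewrite -[submod_mx _ g]/(specht C la g) homM mulmxA.
by rewrite -(val_submodJ (specht_module C nu)) ?inE.
Qed.

Let theta_colsym t : tableau la t -> e_ t *m theta *m colsym C t = #|col_stab t|%:R *: (e_ t
  *m theta).
Proof.
move=> tT; transitivity (e_ t *m colsym C t *m theta); last first.
  by rewrite {1}polytabloidE -(mulmxA (bvec C _)) colsym_sqr -scalemxAr -polytabloidE -scalemxAl.
rewrite /colsym !mulmx_sumr mulmx_suml; apply: eq_bigr => s _.
by rewrite -!scalemxAr -scalemxAl ambient_homP // polytabloid_sub.
Qed.

Let card_col_stab t : #|col_stab t|%:R != 0 :> C.
Proof. by rewrite pnatr_eq0 -lt0n (cardG_gt0 (col_stab_group t)). Qed.

(** [e_ t] is an eigenvector of [colsym] with nonzero eigenvalue and [theta] is equivariant on S^la,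
    so [e_ t *m theta] is a multiple of its own column antisymmetrisation. As it lies in S^nu,
    [polytabloid_colsym] applies. *)
Lemma ambient_hom_polytabloid t : tableau la t ->
  (e_ t *m theta <= e_ t)%MS /\ (la != nu -> e_ t *m theta = 0).
Proof.
move=> tT; have -> : e_ t *m theta = #|col_stab t|%:R^-1 *: (e_ t *m theta *m colsym C t).
  by rewrite theta_colsym // scalerA mulVf // scale1r.
have /submxP[D ->] := theta_sub (e_ t).
have H t' : tableau nu t' -> _ := fun tT' => polytabloid_colsym tT tT' le_wt.
split=> [|nl].
  rewrite scalemx_sub // -mulmxA mulmx_sub // /specht_space sumsmxMr; apply/sumsmx_subP=> t' tT'.
  by rewrite (eqmxMr _ (genmxE _)); have [] := H t' tT'.
rewrite -mulmxA (sub_spechtP (la := nu)) ?mulmx0 ?scaler0 // => t' tT'.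
by have [_ ->] := H t' tT'.
Qed.

Let theta_inj : S_ la *m theta = 0 -> M = 0.
Proof.
move=> h; have : val_submod (1%:M : 'M_(\rank (S_ la))) *m theta = 0.
  by apply/eqP; rewrite -submx0 -h; apply/submxMr/val_submodP.
rewrite ambient_homE val_submodK mul1mx => /eqP.
by rewrite val_submod_eq0 => /eqP.
Qed.

Lemma specht_hom_eq0 : la != nu -> M = 0.
Proof.
move=> nl; apply: theta_inj; apply: sub_spechtP => t tT.
by have [_ ->] := ambient_hom_polytabloid tT.
Qed.

End Intertwiner.

(** The scalar is read off at one polytabloid; equivariance and transitivity on tableaux carry it to
    the others, which span. *)
Lemma specht_end_scalar la (M : 'M[C]_(\rank (S_ la))) :
  (forall g, specht C la g *m M = M *m specht C la g) -> exists a, M = a%:M.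
Proof.
move=> homM; have [t0 t0T] := exists_tableau la.
have [/sub_rVP[a ea] _] := ambient_hom_polytabloid homM (leqnn _) t0T.
exists a; apply: (@val_submod_inj _ _ (S_ la)).
have e : S_ la *m (ambient_hom M - a%:M) = 0.
  apply: sub_spechtP => t /(tableau_transitive t0T)[g ->].
  rewrite -polytabloid_tabg mulmxBr ambient_homP ?polytabloid_sub // ea.
  by rewrite mul_mx_scalar -scalemxAl subrr.
have : val_submod (1%:M : 'M_(\rank (S_ la))) *m (ambient_hom M - a%:M) = 0.
  by apply/eqP; rewrite -submx0 -e; apply/submxMr/val_submodP.
move/eqP; rewrite mulmxBr subr_eq0 => /eqP.
rewrite ambient_homE val_submodK mul1mx => ->.
by rewrite mul_mx_scalar -[in RHS]scalemx1 linearZ.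
Qed.

Lemma specht_rank_gt0 la : (0 < \rank (S_ la))%N.
Proof.
have [t tT] := exists_tableau la; rewrite lt0n mxrank_eq0.
apply: contraNneq (polytabloid_neq0 tT) => S0.
by rewrite -submx0 -S0 polytabloid_sub.
Qed.

Definition chi la g : C := \tr (specht C la g).

Definition cdot (a b : 'S_n -> C) : C := n`!%:R^-1 * \sum_g a g^-1%g * b g.

Lemma cdotC a b : cdot a b = cdot b a.
Proof.
rewrite /cdot (reindex_inj invg_inj) /=; congr (_ * _); apply: eq_bigr => g _.
by rewrite invgK mulrC.
Qed.

Lemma dim_hom_cdot p q (V : mx_representation C [set: 'S_n] p)
    (W : mx_representation C [set: 'S_n] q) :
  (\dim (hom_space V W))%:R = cdot (fun g => \tr (V g)) (fun g => \tr (W g)).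
Proof.
have cSn : #|[set: 'S_n]| = n`! by rewrite cardsT card_Sn.
rewrite dim_hom_space /cdot cSn; last by rewrite pnatr_eq0 -lt0n fact_gt0.
by congr (_ * _); apply: eq_bigl => g; rewrite inE.
Qed.

Lemma hom_spaceP p q (V : mx_representation C [set: 'S_n] p)
    (W : mx_representation C [set: 'S_n] q) M :
  reflect (forall g, V g *m M = M *m W g) (M \in hom_space V W).
Proof.
by apply: (iffP (mem_hom_capP _ _ _)) => h g; [apply: h; rewrite inE | move=> _; apply: h].
Qed.

Lemma chi_orth la nu : cdot (chi la) (chi nu) = (la == nu)%:R.
Proof.
have ne0 la' nu' : (wt nu' <= wt la')%N -> la' != nu' -> cdot (chi la') (chi nu') = 0.
  move=> le_wt nl; rewrite -dim_hom_cdot (_ : hom_space _ _ = 0%VS) ?dimv0 //.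
  apply/eqP; rewrite -subv0; apply/subvP=> M /hom_spaceP homM.
  by rewrite (specht_hom_eq0 homM) // mem0v.
case: eqP => [<-|/eqP nl]; last first.
  case: (leqP (wt nu) (wt la)) => [le|/ltnW le]; first exact: ne0.
  by rewrite cdotC ne0 // eq_sym.
rewrite -dim_hom_cdot (_ : hom_space _ _ = <[1%:M]>%VS).
  have nz : (1%:M : 'M[C]_(\rank (S_ la))) != 0.
    by rewrite -mxrank_eq0 mxrank1 -lt0n specht_rank_gt0.
  by rewrite dim_vline nz.
apply/eqP; rewrite eqEsubv; apply/andP; split; apply/subvP=> M.
  case/hom_spaceP/specht_end_scalar => a ->.
  by rewrite -(scalemx1 _ a) memvZ ?memv_line.
case/vlineP=> a ->; apply/hom_spaceP => g.
by rewrite scalemx1 mul_mx_scalar mul_scalar_mx.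
Qed.

End SpechtHom.

Lemma sum_exchange_lt (I : finType) (f : I -> nat) (A S : {set I}) a b :
    #|S| = #|A| -> S != A -> {in S :\: A, forall x, f x <= b}%N ->
    {in A :\: S, forall x, a <= f x}%N -> (b < a)%N ->
  (\sum_(x in S) f x < \sum_(x in A) f x)%N.
Proof.
move=> cSA nSA fb fa ba.
rewrite (big_setID A) [X in (_ < X)%N](big_setID S) /= setIC ltn_add2l.
have cD : #|S :\: A| = #|A :\: S|.
  by apply/eqP; rewrite -(eqn_add2l #|A :&: S|) {1}setIC !cardsID cSA.
have c0 : (0 < #|S :\: A|)%N.
  rewrite lt0n cards_eq0 setD_eq0; apply: contra nSA => sub.
  by rewrite eqEcard sub cSA /=.
apply: (@leq_trans (#|S :\: A| * a)%N).
  apply: (@leq_ltn_trans (#|S :\: A| * b)%N); last by rewrite ltn_pmul2l.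
  by rewrite -sum_nat_const; apply: leq_sum.
by rewrite cD -sum_nat_const; apply: leq_sum.
Qed.

(** * Semistandard tableaux and invariants *)

Section Invariants.
Variables (C : numClosedFieldType) (n : nat) (K : finType) (c : K -> nat).
Hypothesis c_inj : injective c.
Variable f0 : 'I_n -> K.
Local Notation tab := {ffun 'I_n -> 'I_n * 'I_n}.
Local Notation tbl := {ffun 'I_n -> 'I_n}.
Local Notation rho := (@tabloid_repr C n).
Local Notation e_ t := (@polytabloid C n t).
Implicit Types (t : tab) (la nu : part n) (s g : 'S_n) (f : tbl).

Definition colour_stab : {set 'S_n} := [set h : 'S_n | [forall v, f0 (h v) == f0 v]].

Lemma colour_stabP (h : 'S_n) : reflect (forall v, f0 (h v) = f0 v) (h \in colour_stab).
Proof. by rewrite inE; apply: (iffP forallP) => H v; apply/eqP. Qed.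

Lemma group_set_colour_stab : group_set colour_stab.
Proof.
apply/group_setP; split=> [|a b /colour_stabP ha /colour_stabP hb]; apply/colour_stabP=> v.
  by rewrite perm1.
by rewrite permM hb ha.
Qed.
Canonical colour_stab_group := Group group_set_colour_stab.

Definition average : 'M[C]_#|tbl| :=
  #|colour_stab|%:R^-1 *: \sum_(h in colour_stab) rho h.

Lemma card_colour_stab : #|colour_stab|%:R != 0 :> C.
Proof. by rewrite pnatr_eq0 -lt0n (cardG_gt0 colour_stab_group). Qed.

Lemma averageMl h : h \in colour_stab -> rho h *m average = average.
Proof.
move=> Hh; rewrite /average -scalemxAr; congr (_ *: _).
rewrite mulmx_sumr -[RHS](@sum_groupMl _ _ colour_stab_group _ h) //.
by apply: eq_bigr => g _; rewrite repr_mxM ?inE.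
Qed.

Lemma average_idem : average *m average = average.
Proof.
rewrite {1}/average -scalemxAl mulmx_suml (eq_bigr (fun=> average)).
  by rewrite sumr_const -scaler_nat scalerA mulVf ?card_colour_stab // scale1r.
exact: averageMl.
Qed.

Definition avg_polytabloid t := e_ t *m average.
Local Notation w_ := avg_polytabloid.

Lemma avg_polytabloid_stab t h : h \in colour_stab -> w_ (tabg t h) = w_ t.
Proof.
by move=> Hh; rewrite /avg_polytabloid -polytabloid_tabg -mulmxA averageMl.
Qed.

Let colr v := c (f0 v).

Definition row_weak t := forall u v,
  (t u).1 = (t v).1 -> ((t u).2 < (t v).2)%N -> (colr u <= colr v)%N.

(** The transposition of [u] and [v] fixes the average since it preserves colours, and negates the
    polytabloid since it preserves columns. *)
Lemma avg_polytabloid_eq0 t u v :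
  u != v -> (t u).2 = (t v).2 -> colr u = colr v -> w_ t = 0.
Proof.
move=> nuv cuv /c_inj fuv.
have Ht : tperm u v \in colour_stab.
  by apply/colour_stabP=> x; case: tpermP => // ->.
have /eqP := avg_polytabloid_stab t Ht.
rewrite {1}/avg_polytabloid polytabloid_col ?tperm_col_stab // odd_tperm nuv expr1.
rewrite scaleN1r mulNmx -/(w_ t) eq_sym -subr_eq0 opprK => /eqP e.
apply/eqP; have : (2%:R : C) *: w_ t == 0 by rewrite scaler_nat mulr2n e.
by rewrite scaler_eq0 pnatr_eq0.
Qed.

Let msr t := (\sum_v colr v * (n - (t v).2))%N.

Let msr_tabg t s : msr (tabg t s) = (\sum_v colr (s v) * (n - (t v).2))%N.
Proof.
rewrite /msr (reindex_inj (@perm_inj _ s)); apply: eq_bigr => v _.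
by rewrite tabgE.
Qed.

(** An [s] that breaks the columns replaces part of [A] by entries of [B]. By strictness the colours
    in [A] are at least that of [u] and those in [B] at most that of [v], so the left column, which
    weighs more, ends up with a smaller sum. *)
Let msr_lt la t u v s :
    tableau la t -> col_strict t colr ->
    (t u).1 = (t v).1 -> ((t u).2 < (t v).2)%N -> (colr v < colr u)%N ->
    let A := [set x | ((t x).2 == (t u).2) && ((t u).1 <= (t x).1)%N] in
    let B := [set x | ((t x).2 == (t v).2) && ((t x).1 <= (t u).1)%N] in
    s \in Sym (A :|: B) -> s \notin col_stab t ->
  (msr (tabg t s) < msr t)%N.
Proof.
move=> tT str ruv cuv lt A B; set Z := A :|: B; rewrite inE => sZ sC.
have dAB x : x \in A -> x \in B -> False.
  rewrite !inE => /andP[/eqP-> _] /andP[/eqP e _].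
  by rewrite e ltnn in cuv.
have sZE x : (s x \in Z) = (x \in Z) by apply: perm_closed.
have lowA x : x \in A -> (colr u <= colr x)%N.
  rewrite inE => /andP[/eqP cx]; rewrite leq_eqVlt => /orP[/eqP rx|rx]; last first.
    by rewrite ltnW // str.
  rewrite (_ : x = u) //; apply: (tab_inj tT).
  by rewrite (surjective_pairing (t x)) cx -(val_inj rx) -surjective_pairing.
have highB x : x \in B -> (colr x <= colr v)%N.
  rewrite inE ruv => /andP[/eqP cx]; rewrite leq_eqVlt => /orP[/eqP rx|rx]; last first.
    by rewrite ltnW // str.
  rewrite (_ : x = v) //; apply: (tab_inj tT).
  by rewrite (surjective_pairing (t x)) cx (val_inj rx) -surjective_pairing.
pose S := s @: A.
have cS : #|S| = #|A| by rewrite card_imset //; apply: perm_inj.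
have SZ : S \subset Z.
  by apply/subsetP=> y /imsetP[x Ax ->]; rewrite sZE inE Ax.
have nSA : S != A.
  apply: contra sC => /eqP SA; apply/col_stabP=> x.
  have SAE y : (s y \in A) = (y \in A) by rewrite -{1}SA mem_imset //; apply: perm_inj.
  case: (boolP (x \in Z)) => [xZ|xZ]; last by rewrite (out_perm sZ).
  case: (boolP (x \in A)) => [xA|xA].
    have := xA; rewrite -SAE; move: xA; rewrite !inE => /andP[/eqP-> _] /andP[/eqP-> _] //.
  have xB : x \in B by move: xZ; rewrite inE (negPf xA).
  have : s x \in B by move: xZ; rewrite -sZE inE SAE (negPf xA).
  by move: xB; rewrite !inE => /andP[/eqP-> _] /andP[/eqP-> _].
have lt_A : (\sum_(x in A) colr (s x) < \sum_(x in A) colr x)%N.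
  rewrite -(big_imset (h := s) colr) /=; last by move=> ? ? _ _; apply: perm_inj.
  apply: (sum_exchange_lt (a := colr u) (b := colr v)) => // x; rewrite inE => /andP[nx xin].
    by apply: highB; have := subsetP SZ _ xin; rewrite inE (negPf nx).
  exact: lowA.
(* Give all of [Z] the weight of the right column: this part of the measure is unchanged by [s], and
   only the sum over [A] remains to be compared. *)
pose base y := if y \in Z then (n - (t v).2)%N else (n - (t y).2)%N.
have baseE (f : 'I_n -> nat) : (\sum_y f y * (n - (t y).2) =
    \sum_y f y * base y + ((t v).2 - (t u).2) * \sum_(y in A) f y)%N.
  rewrite big_distrr /= [X in (_ + X)%N]big_mkcond -big_split /=; apply: eq_bigr => y _.
  case: (boolP (y \in A)) => yA.
    rewrite /base inE yA /=; move: yA; rewrite inE => /andP[/eqP-> _].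
    rewrite [X in (_ + X)%N]mulnC -mulnDr; congr (_ * _)%N.
    by have := ltn_ord (t v).2; move: cuv; lia.
  rewrite addn0 /base; case: ifP => // yZ; congr (_ * _)%N.
  by move: yZ; rewrite inE (negPf yA) /= inE => /andP[/eqP-> _].
rewrite msr_tabg baseE [msr t]baseE.
have -> : (\sum_y colr (s y) * base y = \sum_y colr y * base y)%N.
  rewrite [RHS](reindex_inj (@perm_inj _ s)); apply: eq_bigr => y _; congr (_ * _)%N.
  rewrite /base sZE; case: ifP => // /negbT yZ; by rewrite (out_perm sZ).
by rewrite ltn_add2l ltn_pmul2l // subn_gt0.
Qed.

(* Sorting the columns and applying a Garnir relation at a descent in a row
   expresses w_ t through w_ t' with t' of smaller measure
   [msr], in which larger colours weigh less when they are further right. *)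
Lemma straightening la m (U : 'M[C]_(m, #|tbl|)) :
    (forall t, tableau la t -> row_weak t -> col_strict t colr -> (w_ t <= U)%MS) ->
  forall t, tableau la t -> (w_ t <= U)%MS.
Proof.
move=> ssU t; have [k] := ubnP (msr t); elim: k t => // k IH t0 lt0 t0T.
have [s Cs s_le] := col_sort t0 colr; pose t := tabg t0 s.
have tT : tableau la t := tabg_tableau s t0T.
suff : (w_ t <= U)%MS.
  by rewrite /avg_polytabloid polytabloid_col // -scalemxAl eqmx_scale ?signr_eq0.
have lt : (msr t <= k)%N.
  have /col_stabP Cs' := groupVr (Cs : s \in col_stab_group t0).
  by rewrite -ltnS; apply: leq_ltn_trans lt0; apply: leq_sum => v _; rewrite ffunE Cs'.
have weak u v : (t u).2 = (t v).2 -> ((t u).1 < (t v).1)%N -> (colr u <= colr v)%N.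
  by rewrite !ffunE => cuv ruv; have := s_le _ _ cuv ruv; rewrite !permKV.
have [/existsP[u /existsP[v /and3P[nuv /eqP cuv /eqP fuv]]] | /existsPn no] :=
  boolP [exists u, exists v, [&& u != v, (t u).2 == (t v).2 & colr u == colr v]].
  by rewrite (avg_polytabloid_eq0 nuv) // sub0mx.
have str : col_strict t colr.
  move=> u v cuv ruv; rewrite ltn_neqAle weak // andbT.
  have /existsPn/(_ v) := no u; rewrite cuv eqxx /= negb_and negbK => /orP[/eqP uv|//].
  by rewrite uv ltnn in ruv.
have [/existsP[u /existsP[v /and3P[/eqP ruv cuv fuv]]] | /existsPn no2] :=
  boolP [exists u, exists v, [&& (t u).1 == (t v).1, (t u).2 < (t v).2 & colr v < colr u]%N];
  last first.
  apply: ssU => // u v ruv cuv; have /existsPn/(_ v) := no2 u.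
  by rewrite ruv eqxx cuv /= -leqNgt.
have sh : in_shape la ((t u).1, (t v).2) by rewrite ruv -surjective_pairing; apply: tab_shape.
have := @garnir C _ _ _ _ _ _ tT cuv sh.
set A := [set x | _]; set B := [set x | _] => /= /(congr1 (mulmx^~ average)).
(* The terms of the Garnir relation that come from the column group all equal [w_ t], their two
   signs cancelling. Their number [N] is nonzero because 1 is among them. *)
rewrite mul0mx mulmx_suml (bigID (mem (col_stab t))) /=.
rewrite (eq_bigr (fun=> w_ t)) => [|a /andP[_ Ca]]; last first.
  by rewrite polytabloid_col // scalerA -expr2 sqrr_sign scale1r.
rewrite sumr_const => /eqP; rewrite addr_eq0 => /eqP e.
set N := #|_| in e.
have N0 : N%:R != 0 :> C.
  rewrite pnatr_eq0 -lt0n; apply/card_gt0P; exists 1%g.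
  by rewrite unfold_in /= (group1 (Sym_group _)) (group1 (col_stab_group t)).
rewrite -(eqmx_scale _ N0) scaler_nat e eqmx_opp summx_sub // => a /andP[Za Ca].
rewrite -scalemxAl scalemx_sub // IH ?tabg_tableau //.
exact: leq_trans (msr_lt tT str ruv cuv fuv Za Ca) lt.
Qed.

End Invariants.

(** In a vanishing combination take k with nonzero coefficient and [M k] maximal: at the coordinate
    [p k] no other term that is present can contribute. *)
Lemma rank_triangular (F : fieldType) (I : finType) N (w : I -> 'rV[F]_N)
    (p : I -> 'I_N) (M : I -> nat) :
    (forall i, w i 0 (p i) != 0) ->
    (forall i i', i != i' -> w i 0 (p i') != 0 -> (M i' < M i)%N) ->
  \rank (\sum_i <<w i>>)%MS = #|I|.
Proof.
move=> diag tri; pose B := \matrix_(k < #|I|) w (enum_val k).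
have fB : row_free B.
  apply: inj_row_free => v vB.
  pose a i := v 0 (enum_rank i).
  have a_sum : \sum_i a i *: w i = 0.
    rewrite -[RHS]vB mulmx_sum_row (reindex enum_rank) /=; last first.
      by exists enum_val => i _; rewrite ?enum_rankK ?enum_valK.
    by apply: eq_bigr => i _; rewrite rowK enum_rankK.
  suff a0 i : a i = 0 by apply/rowP=> k; rewrite mxE -[k]enum_valK; apply: a0.
  apply/eqP; apply/negP=> /negP ai.
  have [k ak k_max] := arg_maxnP (P := fun i => a i != 0) M ai.
  have := congr1 (fun x : 'rV_N => x 0 (p k)) a_sum; rewrite summxE mxE (bigD1 k) //= big1.
    by rewrite addr0 mxE => /eqP; rewrite mulf_eq0 (negPf ak) (negPf (diag k)).
  move=> l lk; rewrite mxE; apply/eqP; apply: contraT; rewrite mulf_eq0 negb_or => /andP[al wl].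
  by have h : (M l <= M k)%N := k_max _ al; have := tri _ _ lk wl; rewrite ltnNge h.
rewrite -[RHS](eqP fB); apply/eqmx_rank/andP; split.
  apply/sumsmx_subP=> i _; rewrite genmxE.
  by rewrite -[w i](_ : row (enum_rank i) B = _) ?row_sub // rowK enum_rankK.
apply/row_subP=> k; rewrite rowK (sumsmx_sup (enum_val k)) //.
by rewrite genmxE.
Qed.

Section Semistandard.
Variables (C : numClosedFieldType) (n : nat) (K : finType) (c : K -> nat).
Hypothesis c_inj : injective c.
Variables (f0 : 'I_n -> K) (la : part n).
Local Notation tab := {ffun 'I_n -> 'I_n * 'I_n}.
Local Notation tbl := {ffun 'I_n -> 'I_n}.
Local Notation rho := (@tabloid_repr C n).
Local Notation e_ t := (@polytabloid C n t).
Local Notation w_ := (avg_polytabloid C f0).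
Local Notation H := (colour_stab f0).
Local Notation colr v := (c (f0 v)).
Implicit Types (t : tab) (s g h : 'S_n) (T : {ffun cell la -> K}).

Lemma avg_polytabloid_coef t (f : tbl) : w_ t 0 (enum_rank f) =
  #|H|%:R^-1 * \sum_(h in H) \sum_(s in col_stab t)
     (-1) ^+ odd_perm s * (tabloid (tabg t (s * h)%g) == f)%:R.
Proof.
rewrite /avg_polytabloid /average -scalemxAr mxE mulmx_sumr summxE; congr (_ * _).
apply: eq_bigr => h _; rewrite /polytabloid mulmx_suml summxE.
apply: eq_bigr => s _; rewrite -scalemxAl mxE tabl_act_bvec -tabl_actM bvecE.
by rewrite tabloid_tabg.
Qed.

Let moment t := (\sum_v colr v * (t v).1)%N.

(** [h] preserves colours, so it drops out and only the column permutation [s] affects the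
    moment. *)
Lemma moment_shift t t' s h : h \in H ->
    tabloid (tabg t (s * h)%g) = tabloid t' ->
  moment t' = (\sum_v colr (s v) * (t v).1)%N.
Proof.
move=> /colour_stabP Hh /ffunP e; rewrite /moment (reindex_inj (@perm_inj _ (s * h)%g)).
apply: eq_bigr => v _; have := e ((s * h)%g v); rewrite [tabloid _ _]ffunE tabgE.
by rewrite [tabloid _ _]ffunE permM Hh => <-.
Qed.

(** By [col_rearrangement] a column permutation other than 1 lowers the moment, so it cannot lead
    back to the tabloid of [t]. The terms with s = 1 are 0 or 1, and h = 1 gives 1. *)
Lemma avg_polytabloid_lead t :
  tableau la t -> col_strict t (fun v => colr v) -> w_ t 0 (enum_rank (tabloid t)) != 0.
Proof.
move=> tT str; rewrite avg_polytabloid_coef mulf_neq0 ?invr_eq0 ?card_colour_stab //.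
rewrite (eq_bigr (fun h => (tabloid (tabg t h) == tabloid t)%:R)) => [|h Hh].
  rewrite -natr_sum pnatr_eq0 -lt0n (bigD1 1%g) ?(group1 (colour_stab_group f0)) //=.
  rewrite (_ : tabloid (tabg t 1) = tabloid t) ?eqxx //.
  by apply/ffunP=> v; rewrite !ffunE invg1 perm1.
rewrite (bigD1 1%g) ?(group1 (col_stab_group t)) //= odd_perm1 mul1r mul1g.
rewrite big1 ?addr0 // => s /andP[Cs s1]; case: eqP => [e|]; last by rewrite mulr0.
have := col_rearrangement tT str Cs s1.
by rewrite -(moment_shift Hh e) ltnn.
Qed.

(* A weakly increasing row is determined by its content; h identifies the
   contents of the rows of t and t'. *)
Lemma row_weak_unique t t' h v v' :
    tableau la t -> tableau la t' -> row_weak c f0 t -> row_weak c f0 t' ->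
    h \in H -> (forall u, (t' (h u)).1 = (t u).1) -> t v = t' v' ->
  (colr v' <= colr v)%N.
Proof.
move=> tT tT' wt wt' /colour_stabP Hh th tv; rewrite leqNgt; apply/negP=> lt.
set j := (t v).2; set i := (t v).1.
pose X := [set u | ((t u).1 == i) && (colr u <= colr v)%N].
pose X' := [set u | ((t' u).1 == i) && (colr u <= colr v)%N].
have cX : #|X| = #|X'|.
  rewrite -(card_imset _ (@perm_inj _ h)); apply: eq_card => u; rewrite inE.
  apply/imsetP/idP => [[x]|ux]; first by rewrite inE => xX ->; rewrite Hh th.
  exists (h^-1 u)%g; last by rewrite permKV.
  by rewrite inE -th -(Hh (h^-1 u)%g) permKV.
have : (#|X| < #|X|)%N; last by rewrite ltnn.
rewrite {1}cX; apply: (@leq_ltn_trans #|[set k : 'I_n | (k < j)%N]|).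
  rewrite -(card_in_imset (f := fun u => (t' u).2)) => [|x y].
    apply/subset_leq_card/subsetP=> k /imsetP[u]; rewrite !inE => /andP[/eqP ru lu] ->.
    rewrite ltnNge leq_eqVlt negb_or; apply/andP; split; last first.
      apply: contraL (leq_ltn_trans lu lt) => ju; rewrite -leqNgt; apply: wt'.
        by rewrite -tv ru.
      by rewrite -tv.
    apply: contraL (leq_ltn_trans lu lt) => /eqP/val_inj ju; rewrite -leqNgt.
    rewrite (_ : u = v') //; apply: (tab_inj tT').
    by rewrite -tv (surjective_pairing (t' u)) ru -ju -surjective_pairing.
  rewrite !inE => /andP[/eqP rx _] /andP[/eqP ry _] e; apply: (tab_inj tT').
  by rewrite (surjective_pairing (t' x)) rx e -ry -surjective_pairing.
apply: (@leq_trans #|[set k : 'I_n | (k <= j)%N]|).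
  apply: proper_card; apply/properP; split.
    by apply/subsetP=> k; rewrite !inE; apply: ltnW.
  by exists j; rewrite !inE ?leqnn ?ltnn.
apply: leq_trans (leq_imset_card (fun u => (t u).2) X); apply/subset_leq_card/subsetP=> k.
rewrite inE => kj.
have [u tu] := tab_surj tT (shape_up (c := (i, k)) (d := t v) (leqnn _) kj (tab_shape v tT)).
apply/imsetP; exists u; last by rewrite tu.
rewrite inE tu eqxx /=; move: kj; rewrite leq_eqVlt => /orP[/eqP/val_inj kj|kj].
  by rewrite (_ : u = v) //; apply: (tab_inj tT); rewrite tu kj -surjective_pairing.
by apply: wt; rewrite tu.
Qed.

Definition semistd T : bool :=
  [forall x : cell la, forall y : cell la,
    (((val x).1 == (val y).1) && ((val x).2 < (val y).2)%N ==> (c (T x) <= c (T y))%N)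
    && (((val x).2 == (val y).2) && ((val x).1 < (val y).1)%N ==> (c (T x) < c (T y))%N)].

Definition same_content T : bool :=
  [forall k, #|[set x | T x == k]| == #|[set v | f0 v == k]|].

Definition fits T t : bool :=
  tableau la t && [forall x : cell la, forall v, (t v == val x) ==> (T x == f0 v)].

Lemma fitsP T t x v : fits T t -> t v = val x -> T x = f0 v.
Proof.
by case/andP=> _ /forallP/(_ x)/forallP/(_ v)/implyP h /eqP /h /eqP.
Qed.

Lemma fits_exists T : same_content T -> exists t, fits T t.
Proof.
move/forallP=> cT.
have [k|p bij_p Tp] := @fiber_bij _ _ _ f0 T; first by rewrite (eqP (cT k)).
exists [ffun v => val (p v)]; apply/andP; split; last first.
  apply/forallP=> x; apply/forallP=> v; apply/implyP; rewrite ffunE => /eqP/val_inj <-.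
  by rewrite Tp.
apply/andP; split.
  by apply/injectiveP=> u v; rewrite !ffunE => /val_inj/(bij_inj bij_p).
apply/eqP/setP=> k; rewrite inE; apply/imsetP/idP => [[v _ ->]|k_in].
  by rewrite ffunE; apply: valP.
have [q qK pK] := bij_p; exists (q (Sub k k_in)) => //.
by rewrite ffunE pK.
Qed.

Lemma tab_cell t v : tableau la t -> exists x : cell la, t v = val x.
Proof. by move=> tT; exists (Sub (t v) (tab_shape v tT)). Qed.

Lemma fits_semistd T t :
  semistd T -> fits T t -> row_weak c f0 t /\ col_strict t (fun v => colr v).
Proof.
move=> ssT fT; have tT : tableau la t by case/andP: fT.
split=> u v e lt; have [[x tx] [y ty]] := (tab_cell u tT, tab_cell v tT).
  have /forallP/(_ x)/forallP/(_ y)/andP[/implyP h _] := ssT.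
  by rewrite -(fitsP fT tx) -(fitsP fT ty) h // -tx -ty e eqxx.
have /forallP/(_ x)/forallP/(_ y)/andP[_ /implyP h] := ssT.
by rewrite -(fitsP fT tx) -(fitsP fT ty) h // -tx -ty e eqxx.
Qed.

(** Two numberings of one filling differ by a permutation that preserves colours, which the average
    absorbs; so each filling determines a vector. *)
Lemma fits_unique T t t' : fits T t -> fits T t' -> w_ t = w_ t'.
Proof.
move=> fT fT'; have [tT tT'] : tableau la t /\ tableau la t'.
  by case/andP: fT; case/andP: fT'.
have [g e] := tableau_transitive tT tT'; rewrite e avg_polytabloid_stab //.
apply/colour_stabP=> v; have [x tx] := tab_cell v tT.
by rewrite -(fitsP fT tx) -(fitsP fT' (v := g v) (x := x)) // e tabgE.
Qed.

Lemma semistd_exists t :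
    tableau la t -> row_weak c f0 t -> col_strict t (fun v => colr v) ->
  exists T, [/\ semistd T, same_content T & fits T t].
Proof.
move=> tT wt str.
have inv (x : cell la) : {v | t v == val x}.
  by apply: sigW; have [v tv] := tab_surj tT (valP x); exists v; apply/eqP.
pose q x := sval (inv x).
have tq x : t (q x) = val x by apply/eqP; apply: (svalP (inv x)).
have qE x v : t v = val x -> q x = v by move=> tv; apply: (tab_inj tT); rewrite tq.
exists [ffun x => f0 (q x)]; split.
- apply/forallP=> x; apply/forallP=> y; rewrite !ffunE.
  apply/andP; split; apply/implyP=> /andP[/eqP e lt].
    by apply: wt; rewrite !tq.
  by apply: str; rewrite !tq.
- apply/forallP=> k; apply/eqP.
  have q_inj : injective q by move=> x y e; apply: val_inj; rewrite -!tq e.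
  rewrite -(card_imset _ q_inj); apply: eq_card => v; rewrite inE.
  apply/imsetP/idP=> [[x]|fv]; first by rewrite inE ffunE => e ->.
  by have [x tx] := tab_cell v tT; exists x; rewrite ?inE ?ffunE (qE _ _ tx).
apply/andP; split=> //; apply/forallP=> x; apply/forallP=> v; apply/implyP=> /eqP tv.
by rewrite ffunE (qE _ _ tv).
Qed.

(* By Maschke the left-hand side is the multiplicity of S^la in the permutation
   module on the colourings with the content of f0, so this is Young's rule. *)
Lemma rank_specht_average :
  \rank (specht_space C la *m average C f0) = #|[set T | semistd T && same_content T]|.
Proof.
pose I := {T | semistd T && same_content T}.
have pick (T : I) : {t | fits (val T) t}.
  by apply: sigW; apply: fits_exists; case/andP: (valP T).
pose tb (T : I) := sval (pick T).
have fit (T : I) : fits (val T) (tb T) := svalP (pick T).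
have tbT (T : I) : tableau la (tb T) by case/andP: (fit T).
have wk (T : I) := fits_semistd (proj1 (andP (valP T))) (fit T).
transitivity #|{: I}|; last by rewrite card_sig cardsE; apply: eq_card => T.
rewrite -(@rank_triangular _ _ _ (fun T : I => w_ (tb T))
  (fun T : I => enum_rank (tabloid (tb T))) (fun T : I => moment (tb T))).
- apply/eqmx_rank/andP; split; last first.
    apply/sumsmx_subP=> T _; rewrite genmxE submxMr // polytabloid_sub //.
  rewrite /specht_space sumsmxMr; apply/sumsmx_subP=> t tT.
  rewrite (eqmxMr _ (genmxE _)); apply: (@straightening C n K c c_inj f0 la)
    => {t tT}// t tT wt str.
  have [T [ssT cT fT]] := semistd_exists tT wt str.
  have PT : semistd T && same_content T by rewrite ssT.
  rewrite (sumsmx_sup (Sub T PT : I)) // genmxE -/(w_ t).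
  by rewrite (fits_unique fT (fit (Sub T PT))).
- by move=> T; apply: avg_polytabloid_lead; have [] := wk T.
move=> T T' nTT'; rewrite avg_polytabloid_coef mulf_eq0 negb_or => /andP[_ nz].
have [h Hh] : exists2 h, h \in H & \sum_(s in col_stab (tb T)) (-1) ^+ odd_perm s *
    (tabloid (tabg (tb T) (s * h)%g) == tabloid (tb T'))%:R != 0 :> C.
  apply/exists_inP; rewrite -negb_forall_in; apply: contra nz => /forall_inP z.
  by rewrite big1 // => h /z/eqP.
move=> {}nz.
have [s Cs] : exists2 s, s \in col_stab (tb T) & (tabloid (tabg (tb T) (s * h)%g)
  == tabloid (tb T')).
  apply/exists_inP; rewrite -[X in is_true X]negbK negb_exists_in;
    apply: contra nz => /forall_inP z.
  by rewrite big1 // => s /z/negPf->; rewrite mulr0.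
move/eqP=> e; rewrite (moment_shift Hh e).
(* For s = 1 the permutation [h] carries rows to rows, and weakly increasing rows with the same
   contents agree, which would make the two fillings equal. *)
have [s1|s1] := eqVneq s 1%g; last by apply: (@col_rearrangement n la) => //; have [] := wk T.
case/eqP: nTT'; apply/val_inj/ffunP=> x; apply: c_inj.
have row_eq u : (tb T' (h u)).1 = (tb T u).1.
  by have /ffunP/(_ (h u)) := e; rewrite s1 mul1g ![tabloid _ _]ffunE tabgE => ->.
have [v tv] := tab_surj (tbT T) (valP x); have [v' tv'] := tab_surj (tbT T') (valP x).
rewrite (fitsP (fit T) tv) (fitsP (fit T') tv'); apply/eqP; rewrite eqn_leq.
have [wT _] := wk T; have [wT' _] := wk T'.
apply/andP; split; last first.
  by apply: (@row_weak_unique (tb T) (tb T') h) => //; rewrite tv tv'.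
apply: (@row_weak_unique (tb T') (tb T) h^-1%g) => //.
- exact: (groupVr (Hh : h \in colour_stab_group f0)).
- by move=> u; rewrite -row_eq permKV.
by rewrite tv tv'.
Qed.

End Semistandard.

(** * Conjugacy classes *)

Lemma expg_porbit_eq (T : finType) (s : {perm T}) x i j :
  ((s ^+ i)%g x == (s ^+ j)%g x) = (i == j %[mod #|porbit s x|]).
Proof.
set k := #|porbit s x|; have k0 : (0 < k)%N by rewrite lt0n card_porbit_neq0.
have sk : (s ^+ k)%g x = x by rewrite permX iter_porbit.
have red (a : nat) : (s ^+ a)%g x = nth x (traject s x k) (a %% k)%N.
  rewrite nth_traject ?ltn_mod // -permX {1}(divn_eq a k) mulnC expgD expgM permM.
  congr ((s ^+ _)%g _); elim: (a %/ k)%N => [|b IH]; first by rewrite expg0 perm1.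
  by rewrite expgSr permM IH.
by rewrite !red nth_uniq ?uniq_traject_porbit ?size_traject ?ltn_mod.
Qed.

(** Orbits of equal size are paired by [pi] and given base points; [phi] sends the i-th iterate of
    one base point to the i-th iterate of the other. Equal orbit lengths make exponents comparable
    on both sides. *)
Lemma conj_of_porbits n (s s' : 'S_n) :
    (forall k : 'I_n.+1, #|[set B in porbits s | #|B| == k]| = #|[set B in porbits s' | #|B|
      == k]|) ->
  exists p, s' = (s ^ p)%g.
Proof.
move=> eqk.
pose O r := {B | B \in porbits (r : 'S_n)}.
pose sz r (B : O r) : 'I_n.+1 := inord #|val B|.
have szE r (B : O r) : sz r B = #|val B| :> nat.
  by rewrite inordK // ltnS (leq_trans (max_card _)) ?card_ord.
have card_fib r k : #|[set B | sz r B == k]| = #|[set B in porbits r | #|B| == k]|.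
  rewrite -(card_imset _ val_inj); apply: eq_card => B; rewrite !inE.
  apply/imsetP/andP => [[B']|[Bin Bk]].
    by rewrite inE => /eqP <- ->; rewrite szE; split; [apply: (valP B') | ].
  by exists (Sub B Bin) => //; rewrite inE -val_eqE /= szE.
have [k|pi bij_pi szpi] := @fiber_bij _ _ _ (sz s) (sz s'); first by rewrite !card_fib eqk.
have base r (B : O r) : {x | porbit r x == val B}.
  by apply: sigW; have /imsetP[x _ e] := valP B; exists x; rewrite -e.
pose x_ r B := sval (base r B).
have xP r B : porbit r (x_ r B) = val B by apply/eqP; apply: (svalP (base r B)).
pose orb (v : 'I_n) : O s := Sub (porbit s v) (imset_f _ isT).
have pos v : {i | (s ^+ i)%g (x_ s (orb v)) == v}.
  apply: sigW; have : v \in porbit s (x_ s (orb v)) by rewrite xP porbit_id.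
  by case/porbitP=> i e; exists i; rewrite -e.
pose i_ v := sval (pos v).
have iP v : (s ^+ i_ v)%g (x_ s (orb v)) = v by apply/eqP; apply: (svalP (pos v)).
have szx B : #|porbit s' (x_ s' (pi B))| = #|porbit s (x_ s B)|.
  by rewrite !xP -!szE szpi.
pose phi v := (s' ^+ i_ v)%g (x_ s' (pi (orb v))).
have phi_inj : injective phi.
  move=> v w e.
  have eo : orb v = orb w.
    apply: (bij_inj bij_pi); apply: val_inj; rewrite -!xP.
    by rewrite -(porbit_perm s' (i_ v)) -[RHS](porbit_perm s' (i_ w)) -/(phi v) e.
  move/eqP: e; rewrite /phi -eo expg_porbit_eq szx -expg_porbit_eq iP.
  by rewrite eo iP => /eqP.
exists (perm phi_inj); apply/permP=> u; rewrite -[u](permKV (perm phi_inj)).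
set v := _ u; rewrite conjgE !permM permK !permE /phi.
have eo : orb (s v) = orb v.
  by apply: val_inj; rewrite /= -{1}[s v]/((s ^+ 1)%g v) porbit_perm.
rewrite eo -permM -expgSr; apply/eqP; rewrite expg_porbit_eq szx -expg_porbit_eq.
by rewrite expgSr permM iP -eo iP.
Qed.

(** Recovers the number of orbits of each exact size from the numbers of larger orbits, which are
    the parts of the conjugate partition. *)
Lemma card_porbits_gt n (s : 'S_n) k :
  (#|[set B in porbits s | (k < #|B|)%N]| =
   #|[set B in porbits s | #|B| == k.+1]| + #|[set B in porbits s | (k.+1 < #|B|)%N]|)%N.
Proof.
rewrite -(cardsID [set B : {set 'I_n} | #|B| == k.+1]); congr (_ + _)%N; apply: eq_card => B;
  rewrite !inE.
  by case: eqP => [->|]; rewrite ?andbF // ltnSn !andbT.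
by case: (B \in _); rewrite ?andbF //= [RHS]ltn_neqAle eq_sym.
Qed.

(* [len s] is the conjugate of the cycle type of s, which avoids sorting cycle
   lengths. *)
Lemma card_classes_le n : (#|classes [set: 'S_n]| <= #|{: part n}|)%N.
Proof.
pose len (s : 'S_n) : {ffun 'I_n -> 'I_n.+1} :=
  [ffun i : 'I_n => inord #|[set B in porbits s | (i < #|B|)%N]|].
have sizeB (s : 'S_n) : (\sum_(B in porbits s) #|B|)%N = n.
  have acts : [acts <[s]>, on [set: 'I_n] | 'P]%g.
    by apply/subsetP=> g _; rewrite !inE /=; apply/subsetP=> x _; rewrite !inE.
  rewrite -[RHS]card_ord -cardsT -(acts_sum_card_orbit acts); apply: eq_bigl => B.
  rewrite /porbits; apply/imsetP/imsetP => [] [x _ ->]; exists x; rewrite ?inE ?porbitE //.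
have lenE s i : len s i = #|[set B in porbits s | (i < #|B|)%N]| :> nat.
  rewrite ffunE inordK // ltnS -[X in (_ <= X)%N](sizeB s)
    -sum1_card big_mkcond [X in (_ <= X)%N]big_mkcond /=.
  apply: leq_sum => B _; rewrite inE; case: (B \in _) => //=; case: ltnP => //.
  exact: leq_trans.
have lenP s : is_part (len s).
  apply/andP; split.
    apply/forallP=> i; apply/forallP=> j; apply/implyP=> ij; rewrite !lenE.
    apply/subset_leq_card/subsetP=> B; rewrite !inE => /andP[-> jB] /=.
    exact: leq_ltn_trans jB.
  rewrite -[X in _ == X](sizeB s); apply/eqP.
  transitivity (\sum_(i < n) \sum_(B in porbits s) (i < #|B|))%N.
    apply: eq_bigr => i _; rewrite lenE -sum1_card big_mkcond [RHS]big_mkcond /=.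
    by apply: eq_bigr => B _; rewrite inE; case: (B \in _) => //; case: ltnP.
  rewrite exchange_big; apply: eq_bigr => B _ /=.
  have Bn : (#|B| < n.+1)%N by rewrite ltnS (leq_trans (max_card _)) ?card_ord.
  rewrite -[RHS](card_ord_lt (Ordinal Bn)) -sum1_card [RHS]big_mkcond.
  by apply: eq_bigr => i _; rewrite inE /=; case: ltnP.
pose ty (cl : {set 'S_n}) : part n := Sub (len (repr cl)) (lenP _).
rewrite -(card_in_imset (f := ty)) ?max_card // => cl cl' /repr_classesP[_ ecl]
  /repr_classesP[_ ecl'].
pose s := repr cl; pose s' := repr cl'.
move/(congr1 val)=> /ffunP le_eq.
have nE i : #|[set B in porbits s | (i < #|B|)%N]| = #|[set B in porbits s' | (i < #|B|)%N]|.
  case: (ltnP i n) => [lt|ge]; first by have := congr1 val (le_eq (Ordinal lt)); rewrite /= !lenE.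
  have z (r : 'S_n) : #|[set B in porbits r | (i < #|B|)%N]| = 0%N.
    apply: eq_card0 => B; rewrite !inE ltnNge (leq_trans _ ge) ?andbF //.
    by rewrite (leq_trans (max_card _)) ?card_ord.
  by rewrite !z.
have [k|p sp] := @conj_of_porbits n s s'.
  case: k => [[|k] lt] /=.
    have z (r : 'S_n) : #|[set B in porbits r | #|B| == 0]%N| = 0%N.
      apply: eq_card0 => B; rewrite !inE; apply/negP=> /andP[/imsetP[x _ ->]].
      by rewrite (negPf (card_porbit_neq0 _ _)).
    by rewrite !z.
  apply/eqP; rewrite -(eqn_add2r #|[set B in porbits s | (k.+1 < #|B|)%N]|) {2}nE.
  by rewrite -!card_porbits_gt nE.
by rewrite ecl ecl' -/s -/s' sp classGidl ?inE.
Qed.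

(** * The Frobenius characteristic *)

(** Comparing ranks gives the opposite inequality of dimensions, so the matrices are square. *)
Lemma mulmx1_rev (F : fieldType) p c (X : 'M[F]_(p, c)) (Y : 'M[F]_(c, p)) :
  X *m Y = 1%:M -> (c <= p)%N -> Y *m X = 1%:M.
Proof.
move=> XY cp; have pc : (p <= c)%N.
  by rewrite -(mxrank1 F p) -XY (leq_trans (mxrankM_maxr _ _)) // rank_leq_row.
have e : p = c by apply/eqP; rewrite eqn_leq pc cp.
by case: c / e X Y XY {cp pc} => X Y; apply: mulmx1C.
Qed.

Lemma sum_classes (V : nmodType) (gT : finGroupType) (f : gT -> V) :
    (forall g h, f (g ^ h)%g = f g) ->
  \sum_g f g = \sum_(cl in classes [set: gT]) f (repr cl) *+ #|cl|.
Proof.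
move=> f_cl; rewrite (eq_bigl (fun g => g \in [set: gT])); last by move=> g; rewrite inE.
rewrite (set_partition_big _ (classes_partition [set: gT])) /=;
  apply: eq_bigr => cl /repr_classesP[_ e].
rewrite (eq_bigr (fun=> f (repr cl))) ?sumr_const // => g; rewrite {1}e => /imsetP[h _ ->].
exact: f_cl.
Qed.

Section FrobeniusCharacteristic.
Variables (C : numClosedFieldType) (n : nat).
Local Notation chi := (@chi C n).
Local Notation cdot := (@cdot C n).
Implicit Types (la : part n) (g h : 'S_n).

Lemma chiJ la g h : chi la (g ^ h)%g = chi la g.
Proof.
rewrite /chi conjgE repr_mxM ?groupM ?inE // repr_mxM ?groupV ?inE //.
rewrite mxtrace_mulC -mulmxA -repr_mxM ?groupV ?inE //.
by rewrite mulgV repr_mx1 mulmx1.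
Qed.

(* The characters chi la are orthonormal, and there are at least as many of them
   as conjugacy classes. *)
Lemma class_fun_expand (psi : 'S_n -> C) g :
    (forall g h, psi (g ^ h)%g = psi g) ->
  psi g = \sum_la cdot (chi la) psi * chi la g.
Proof.
move=> psiJ; pose cls := classes [set: 'S_n]; pose cl (c : 'I_#|cls|) : {set 'S_n} := enum_val c.
pose r c := repr (cl c).
have sum_r (f : 'S_n -> C) : (forall g h, f (g ^ h)%g = f g) ->
    \sum_x f x = \sum_(c < #|cls|) #|cl c|%:R * f (r c).
  move=> fJ; rewrite sum_classes // big_enum_val.
  by apply: eq_bigr => c _; rewrite mulr_natl.
(* [X] is the character table; [Y] is its transpose at inverse elements, weighted by class size over
   n!. Orthogonality reads X Y = 1, and reversing it to Y X = 1 gives completeness. *)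
pose X := \matrix_(a < #|{: part n}|, c < #|cls|) chi (enum_val a) (r c).
pose Y := \matrix_(c < #|cls|, a < #|{: part n}|)
  (n`!%:R^-1 * (#|cl c|%:R * chi (enum_val a) (r c)^-1%g)).
have XY : X *m Y = 1%:M.
  apply/matrixP=> a b; rewrite mxE [RHS]mxE -(inj_eq enum_val_inj) -(chi_orth C).
  rewrite cdotC /cdot sum_r => [|x y]; last by rewrite -conjVg !chiJ.
  by rewrite mulr_sumr; apply: eq_bigr => c _; rewrite !mxE; ring.
have /matrixP YX := mulmx1_rev XY (card_classes_le n).
have gcl : (g ^: [set: 'S_n])%g \in cls by apply: imset_f; rewrite inE.
pose c0 := enum_rank_in gcl (g ^: [set: 'S_n])%g.
have psi_c0 (f : 'S_n -> C) : (forall g h, f (g ^ h)%g = f g) -> f g = f (r c0).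
  move=> fJ; rewrite /r /cl /c0 enum_rankK_in //.
  have := mem_repr g (class_refl [set: 'S_n] g); case/imsetP=> h _ ->.
  by rewrite fJ.
rewrite psi_c0 //; transitivity (\sum_c psi (r c) * (1%:M : 'M_#|cls|) c c0).
  rewrite (bigD1 c0) //= mxE eqxx mulr1 big1 ?addr0 // => c nc.
  by rewrite mxE (negPf nc) mulr0.
rewrite [RHS](reindex (@enum_val (part n) predT)) /=; last exact: onW_bij (enum_val_bij _).
transitivity (\sum_c \sum_a psi (r c) * (Y c a * X a c0)).
  by apply: eq_bigr => c _; rewrite -YX mxE mulr_sumr.
rewrite exchange_big; apply: eq_bigr => a _ /=.
rewrite /cdot sum_r => [|x y]; last by rewrite -conjVg psiJ chiJ.
rewrite (psi_c0 (chi (enum_val a))); last by move=> x y; apply: chiJ.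
have -> : X a c0 = chi (enum_val a) (r c0) by rewrite mxE.
move: (chi _ (r c0)) => x; rewrite mulr_sumr mulr_suml.
by apply: eq_bigr => c _; rewrite mxE; ring.
Qed.

Lemma cdot_sumr (I : Type) (s : seq I) (P : pred I) a (b : I -> 'S_n -> C) (x : I -> C) :
  cdot a (fun g => \sum_(i <- s | P i) x i * b i g) = \sum_(i <- s | P i) x i * cdot a (b i).
Proof.
rewrite /cdot (eq_bigr (fun g => \sum_(i <- s | P i) a g^-1%g * (x i * b i g))); last first.
  by move=> g _; rewrite mulr_sumr.
rewrite exchange_big mulr_sumr; apply: eq_bigr => i _ /=.
by rewrite !mulr_sumr; apply: eq_bigr => g _; ring.
Qed.

Section Content.
Variable mu : mono.
Local Notation col := {ffun 'I_n -> finsupp mu}.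

Definition fix_colour g : C :=
  #|[set kappa : col | has_content kappa && (g \in colour_stab kappa)]|%:R.

Lemma has_contentP (I J : finType) (T : {ffun I -> finsupp mu}) (T' : {ffun J -> finsupp mu}) :
  has_content T ->
  has_content T' = [forall k, #|[set x | T' x == k]| == #|[set x | T x == k]|].
Proof.
move/forallP=> cT; apply: eq_forallb => k.
by rewrite (eqP (cT k)).
Qed.

Lemma schur_semistd la (kappa : col) : has_content kappa ->
  schur la mu = #|[set T : {ffun cell la -> finsupp mu} | semistd val T && same_content kappa
    T]|%:Z.
Proof.
move=> ck; rewrite /schur; congr (Posz _); apply: eq_card => T; rewrite !inE.
by rewrite (has_contentP T ck).
Qed.

Lemma has_content_shift (kappa : col) g :
  has_content ([ffun v => kappa (g v)] : col) = has_content kappa.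
Proof.
apply: eq_forallb => k; congr (_ == _).
rewrite -(card_imset _ (@perm_inj _ g)); apply: eq_card => v; rewrite [RHS]inE.
apply/imsetP/idP => [[u]|e]; first by rewrite inE ffunE => e ->.
by exists (g^-1 v)%g; rewrite ?permKV // inE ffunE permKV.
Qed.

(** The colourings with this content form one orbit, and the permutations carrying [kappa0] to
    [kappa] form a translate of the stabiliser of [kappa]. *)
Lemma sum_card_colour_stab (kappa0 : col) : has_content kappa0 ->
  (\sum_(kappa : col | has_content kappa) #|colour_stab kappa|)%N = n`!.
Proof.
move=> c0; rewrite -[RHS]card_Sn -sum1_card.
pose shift g : col := [ffun v => kappa0 (g v)].
have c_shift g : has_content (shift g) by rewrite has_content_shift.
rewrite (partition_big shift (fun kappa => has_content kappa)) /=; last by move=> g _.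
apply: eq_bigr => kappa ck.
have [k|p bij_p kp] := @fiber_bij _ _ _ kappa kappa0.
  by have := ck; rewrite (has_contentP _ c0) => /forallP/(_ k)/eqP.
rewrite sum1dep_card -(card_imset _ (@mulIg _ (perm (bij_inj bij_p)))).
apply: eq_card => g; rewrite inE; apply/imsetP/eqP => [[h /colour_stabP Hh ->]|/ffunP e].
  by apply/ffunP=> v; rewrite ffunE permM permE kp Hh.
exists (g * (perm (bij_inj bij_p))^-1)%g; last by rewrite mulgKV.
apply/colour_stabP=> v; rewrite -kp -(permE (bij_inj bij_p)) permM permKV.
by rewrite -e ffunE.
Qed.

Lemma fix_colourE g :
  fix_colour g = \sum_(kappa : col | has_content kappa) (g \in colour_stab kappa)%:R.
Proof.
rewrite /fix_colour -sum1_card natr_sum big_mkcond [RHS]big_mkcond /=; apply: eq_bigr => kappa _.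
by rewrite inE; case: has_content => //=; case: (g \in _).
Qed.

(** The pairing is a sum over colourings of character sums over their stabilisers. Each is the order
    of the stabiliser times the dimension of the invariants in S^la, which [rank_specht_average]
    counts, and the orders add up to n!. *)
Lemma cdot_chi_fix la : cdot (chi la) fix_colour = (schur la mu)%:~R.
Proof.
rewrite /cdot; under eq_bigr do rewrite fix_colourE mulr_sumr.
rewrite exchange_big /=.
rewrite (eq_bigr (fun kappa : col => (schur la mu)%:~R * #|colour_stab kappa|%:R)) => [|kappa ck].
  rewrite -mulr_sumr -natr_sum.
  have [kappa0 c0 | no] := pickP (fun kappa : col => has_content kappa).
    by rewrite (sum_card_colour_stab c0) mulrCA mulVf ?mulr1 // pnatr_eq0 -lt0n fact_gt0.
  (* If no colouring has content mu, no filling has it either: a tableau would transport the filling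
     to a colouring. *)
  rewrite big_pred0 // !mulr0 /schur eq_card0 // => T; rewrite !inE.
  apply/negP=> /andP[_ cT].
  have [t tT] := exists_tableau la.
  pose p v : cell la := Sub (t v) (tab_shape v tT).
  have p_inj : injective p by move=> u v /(congr1 val) /= /(tab_inj tT).
  have bij_p : bijective p by apply: inj_card_bij => //; rewrite card_cell card_ord.
  have := no [ffun v => T (p v)]; rewrite (has_contentP _ cT) => /forallP[].
  move=> k; apply/eqP; rewrite -(card_imset _ p_inj); apply: eq_card => x; rewrite inE.
  apply/imsetP/idP => [[v]|e]; first by rewrite inE ffunE => e ->.
  by have [q qK pK] := bij_p; exists (q x); rewrite ?pK // inE ffunE pK.
have key : \sum_(h in colour_stab kappa) chi la h = #|colour_stab kappa|%:R * (schur la mu)%:~R.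
  rewrite (schur_semistd la ck) -[X in _ * X]/(#|_|%:R : C).
  rewrite -(@rank_specht_average C n _ val val_inj kappa la) -trs_idem ?average_idem //; last first.
    rewrite /average -scalemxAr scalemx_sub // mulmx_sumr summx_sub // => h _.
    by rewrite (mxmodule_trans (specht_module C la)) ?inE.
  rewrite /average trsZ trs_sum mulrA mulfV ?card_colour_stab // mul1r.
  by apply: eq_bigr => h _; rewrite -(mxtrace_submod (specht_module C la)) ?inE.
rewrite mulrC -key -(@sum_groupV _ _ (colour_stab_group kappa)) [RHS]big_mkcond /=.
by apply: eq_bigr => g _; case: (g \in _); rewrite ?mulr1 ?mulr0.
Qed.

Lemma fix_colourJ g h : fix_colour (g ^ h)%g = fix_colour g.
Proof.
congr _%:R; pose phi (kappa : col) : col := [ffun v => kappa (h v)].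
have phi_inj : injective phi.
  move=> a b /ffunP e; apply/ffunP=> v; have := e (h^-1 v)%g.
  by rewrite !ffunE permKV.
rewrite -(card_imset _ phi_inj); apply: eq_card => kappa; rewrite [RHS]inE.
have stabE (k : col) : ((g ^ h)%g \in colour_stab k) = (g \in colour_stab (phi k)).
  apply/colour_stabP/colour_stabP => H v; last first.
    by have := H (h^-1 v)%g; rewrite !ffunE conjgE !permM permKV.
  by have := H (h v); rewrite !ffunE conjgE !permM permK.
apply/imsetP/idP => [[k]|/andP[ck gk]]; first by rewrite inE stabE => /andP[ck gk] ->;
  rewrite has_content_shift ck.
exists [ffun v => kappa ((h^-1)%g v)]; last by apply/ffunP=> v; rewrite !ffunE permK.
rewrite inE has_content_shift ck stabE (_ : phi _ = kappa) //.
by apply/ffunP=> v; rewrite !ffunE permK.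
Qed.

Lemma frob_char_cdot p (V : mx_representation C [set: 'S_n] p) :
  (frob_char V mu)%:~R = cdot (fun g => \tr (V g)) fix_colour.
Proof.
rewrite /frob_char rmorph_sum /=.
under eq_bigr do rewrite rmorphM /= -cdot_chi_fix.
transitivity (cdot (fun g => \tr (V g)) (fun g => \sum_la cdot (chi la)
  fix_colour * chi la g)); last first.
  by congr (_ * _); apply: eq_bigr => g _; rewrite -(class_fun_expand _ fix_colourJ).
rewrite cdot_sumr; apply: eq_bigr => la _.
rewrite mulrC; congr (_ * _); rewrite cdotC.
exact: (dim_hom_cdot (specht C la) V).
Qed.

End Content.
End FrobeniusCharacteristic.

(** * The exterior algebra *)

Section ExteriorAlgebra.
Variables (C : numClosedFieldType) (n : nat).
Local Notation ext := (ext C n).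
Local Notation bvec := (@bvec C {set 'I_n}).
Implicit Types (S T : {set 'I_n}) (t u : 'I_n) (v w : 'rV[C]_n) (x y : ext).

Definition coef x T : C := x 0 (enum_rank T).

Lemma ext_eqP x y : (forall T, coef x T = coef y T) -> x = y.
Proof.
move=> e; apply/rowP=> k; have := e (enum_val k).
by rewrite /coef enum_valK.
Qed.

Definition pos t T : nat := #|[set s in T | (s < t)%N]|.

Lemma coef_wedge w x T :
  coef (wedge w x) T = \sum_(t in T) (-1) ^+ pos t T * w 0 t * coef x (T :\ t).
Proof. by rewrite /coef mxE enum_rankK. Qed.

Lemma coef_bvec S T : coef (bvec S) T = (S == T)%:R.
Proof. exact: bvecE. Qed.

Lemma coefZ a x T : coef (a *: x) T = a * coef x T.
Proof. by rewrite /coef mxE. Qed.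

Lemma coefN x T : coef (- x) T = - coef x T.
Proof. by rewrite /coef mxE. Qed.

Lemma coef_sum (I : Type) (r : seq I) (P : pred I) (F : I -> ext) T :
  coef (\sum_(i <- r | P i) F i) T = \sum_(i <- r | P i) coef (F i) T.
Proof. by rewrite /coef summxE. Qed.

Lemma wedgeZr a w x : wedge w (a *: x) = a *: wedge w x.
Proof.
apply: ext_eqP => T; rewrite coefZ !coef_wedge mulr_sumr.
by apply: eq_bigr => t _; rewrite coefZ; ring.
Qed.

Lemma wedge_sumr (I : Type) (r : seq I) (P : pred I) w (F : I -> ext) :
  wedge w (\sum_(i <- r | P i) F i) = \sum_(i <- r | P i) wedge w (F i).
Proof.
apply: ext_eqP => T; rewrite coef_sum coef_wedge.
under [RHS]eq_bigr do rewrite coef_wedge.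
rewrite exchange_big; apply: eq_bigr => t _.
by rewrite coef_sum mulr_sumr.
Qed.

Lemma wedge_suml (I : Type) (r : seq I) (P : pred I) (a : I -> C) (F : I -> 'rV[C]_n) x :
  wedge (\sum_(i <- r | P i) a i *: F i) x = \sum_(i <- r | P i) a i *: wedge (F i) x.
Proof.
apply: ext_eqP => T; rewrite coef_sum coef_wedge.
under [RHS]eq_bigr do rewrite coefZ coef_wedge mulr_sumr.
rewrite exchange_big; apply: eq_bigr => t _.
rewrite summxE mulr_sumr mulr_suml; apply: eq_bigr => i _.
by rewrite mxE; ring.
Qed.

Lemma pos_setD1 t u T : t \in T -> pos u T = ((t < u) + pos u (T :\ t))%N.
Proof.
move=> tT; rewrite /pos (cardsD1 t) !inE tT /=; congr (_ + _)%N.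
by apply: eq_card => s; rewrite !inE -?andbA.
Qed.

(** The same two elements leave T in opposite orders; exactly one of t < u and u < t holds, so the
    signs are opposite. *)
Lemma wedge_anti v w x : wedge v (wedge w x) = - wedge w (wedge v x).
Proof.
apply: ext_eqP => T; rewrite coefN !coef_wedge.
under eq_bigr do rewrite coef_wedge mulr_sumr.
under [in RHS]eq_bigr do rewrite coef_wedge mulr_sumr.
rewrite (exchange_big_dep (mem T)) /=; last by move=> t u _; rewrite inE => /andP[].
rewrite -sumrN; apply: eq_bigr => u uT; rewrite -sumrN; apply: eq_big => [t|t].
  by rewrite !inE uT andbT eq_sym andbC.
case/andP=> tT; rewrite inE uT andbT => /= ut; rewrite inE in ut.
rewrite setDDl (setUC [set t]) -setDDl.
have sgn : (-1) ^+ pos t T * (-1) ^+ pos u (T :\ t) = - ((-1) ^+ pos u T * (-1) ^+ pos t (T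
  :\ u)) :> C.
  rewrite (pos_setD1 t uT) (pos_setD1 u tT) -!exprD -[RHS]mulN1r -exprS.
  have -> : (t < u)%N = ~~ (u < t)%N by rewrite -leqNgt [RHS]leq_eqVlt val_eqE eq_sym (negPf ut).
  by case: (u < t)%N; rewrite /= !(add0n, add1n, addSn) ?exprS ?(addnC (pos t _)) //; ring.
transitivity ((-1) ^+ pos t T * (-1) ^+ pos u (T :\ t) * (v 0 t * w 0 u * coef x (T :\ u :\ t))).
  by ring.
by rewrite sgn; ring.
Qed.

End ExteriorAlgebra.

(** * Functoriality and grading of the exterior algebra *)

Section ExteriorMaps.
Variables (C : numClosedFieldType) (n : nat).
Local Notation ext := (ext C n).
Local Notation bvec := (@bvec C {set 'I_n}).
Local Notation ext_mx := (@ext_mx C n).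
Implicit Types (S T : {set 'I_n}) (t u : 'I_n) (v w : 'rV[C]_n) (x y : ext).

Lemma wedge_sq v x : wedge v (wedge v x) = 0.
Proof.
apply/eqP; have /eqP := wedge_anti v v x.
rewrite -subr_eq0 opprK -mulr2n -scaler_nat scaler_eq0 pnatr_eq0 //.
Qed.

Lemma wedge_foldr v x (ws : seq 'rV[C]_n) :
  wedge v (foldr (@wedge C n) x ws) = (-1) ^+ size ws *: foldr (@wedge C n) (wedge v x) ws.
Proof.
elim: ws => [|w ws IH] /=; first by rewrite scale1r.
by rewrite wedge_anti IH wedgeZr exprS mulN1r scaleNr.
Qed.

Lemma enum_setD1 t T : enum (T :\ t) = filter (predC1 t) (enum T).
Proof.
rewrite /enum_mem -filter_predI; apply: eq_filter => u.
by rewrite /= !inE.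
Qed.

Lemma enum_sorted T : sorted (relpre val ltn) (enum T).
Proof.
rewrite /enum_mem; apply: sorted_filter; first by move=> a b c; apply: ltn_trans.
by rewrite -enumT -sorted_map val_enum_ord; apply: iota_ltn_sorted.
Qed.

Definition wedge_rows (r : 'I_n -> 'rV[C]_n) T : ext := wedges [seq r s | s <- enum T].

(** Bringing [r t] to the front passes the factors of smaller index, of which there are
    [pos t T]. *)
Lemma wedge_rows_expand r t T :
  t \in T -> wedge_rows r T = (-1) ^+ pos t T *: wedge (r t) (wedge_rows r (T :\ t)).
Proof.
move=> tT; rewrite /wedge_rows enum_setD1.
have : uniq (enum T) := enum_uniq _.
have := enum_sorted T.
have -> : pos t T = count (fun s : 'I_n => s < t)%N (enum T).
  rewrite /pos cardE -size_filter /enum_mem -filter_predI; congr size.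
  by apply: eq_filter => s; rewrite /= !inE andbC.
have : t \in enum T by rewrite mem_enum.
case/splitPr: {T tT} (enum T) / => p1 p2.
rewrite sorted_pairwise; last by move=> a b c; apply: ltn_trans.
rewrite pairwise_cat pairwise_cons /= => /and3P[/allrelP lt1 _ /andP[/allP lt2 _]].
rewrite cat_uniq /= => /and3P[_ /norP[tp1 _] /andP[tp2 _]].
rewrite filter_cat /= eqxx /= !map_cat /wedges !foldr_cat /=.
have f1 : [seq x <- p1 | predC1 t x] = p1.
  by apply/all_filterP/allP=> s sp /=; apply: contraNneq tp1 => <-.
have f2 : [seq x <- p2 | predC1 t x] = p2.
  by apply/all_filterP/allP=> s sp /=; apply: contraNneq tp2 => <-.
rewrite f1 f2 [in RHS]wedge_foldr size_map scalerA -exprD count_cat /= ltnn.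
have -> : count (fun s : 'I_n => s < t)%N p1 = size p1.
  by apply/eqP; rewrite -all_count; apply/allP=> s sp; apply: lt1; rewrite ?inE ?eqxx.
have -> : count (fun s : 'I_n => s < t)%N p2 = 0%N.
  apply/eqP; rewrite -leqn0 leqNgt -has_count; apply/hasPn=> s sp.
  by rewrite -leqNgt ltnW //; apply: lt2.
by rewrite addn0 addn0 addnn -signr_odd odd_double scale1r.
Qed.

Lemma wedge_rows_mem r t T : t \in T -> wedge (r t) (wedge_rows r T) = 0.
Proof. by move=> tT; rewrite (wedge_rows_expand r tT) wedgeZr wedge_sq scaler0. Qed.

Lemma wedge_rows_notin r t T : t \notin T ->
  wedge (r t) (wedge_rows r T) = (-1) ^+ pos t (t |: T) *: wedge_rows r (t |: T).
Proof.
move=> tT; rewrite (wedge_rows_expand r (setU11 t T)) scalerA -expr2 sqrr_sign scale1r.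
by rewrite setU1K.
Qed.

Lemma bvec_wedge_rows S : bvec S = wedge_rows (fun s => delta_mx 0 s) S.
Proof.
have [k] := ubnP #|S|; elim: k S => // k IH S ltS.
have [-> | [t tS]] := set_0Vmem S; first by rewrite /wedge_rows enum_set0.
rewrite (wedge_rows_expand _ tS) -IH; last first.
  by move: ltS; rewrite (cardsD1 t) tS.
apply: ext_eqP => T; rewrite coefZ coef_wedge coef_bvec.
have [tT | tT] := boolP (t \in T); last first.
  rewrite big1 ?mulr0 => [|u uT]; last first.
    by rewrite mxE eqxx (negPf (_ : u != t)) ?mulr0 ?mul0r //; apply: contraNneq tT => <-.
  by case: eqP tS => // ->; rewrite (negPf tT).
rewrite (bigD1 t) //= big1 ?addr0 => [|u /andP[_ ut]]; last first.
  by rewrite mxE (negPf ut) andbF mulr0 mul0r.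
rewrite mxE !eqxx mulr1 coef_bvec.
have -> : (S :\ t == T :\ t) = (S == T).
  by apply/eqP/eqP => [e|->//]; rewrite -(setD1K tS) e setD1K.
by case: eqP => [->|]; rewrite ?mulr0 // mulr1 -expr2 sqrr_sign.
Qed.

Lemma ext_mxE A S : bvec S *m ext_mx A = wedge_rows (fun s => row s A) S.
Proof. exact: bvecK. Qed.

Lemma ext_mx1 : ext_mx 1%:M = 1%:M.
Proof.
apply: eq_on_bvec => S; rewrite ext_mxE mulmx1 bvec_wedge_rows /wedge_rows.
by congr wedges; apply: eq_map => s; rewrite row1.
Qed.

Definition wedge_mx w : 'M[C]_#|{set 'I_n}| := linext (fun S => wedge w (bvec S)).

Lemma ext_sum_bvec x : x = \sum_S coef x S *: bvec S.
Proof.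
apply: ext_eqP => T; rewrite coef_sum (bigD1 T) //= big1 ?addr0 => [|S ST].
  by rewrite coefZ coef_bvec eqxx mulr1.
by rewrite coefZ coef_bvec (negPf ST) mulr0.
Qed.

Lemma wedge_mxE w x : x *m wedge_mx w = wedge w x.
Proof.
rewrite [x]ext_sum_bvec mulmx_suml wedge_sumr; apply: eq_bigr => S _.
by rewrite -scalemxAl bvecK wedgeZr.
Qed.

(** By linearity [w] may be a standard vector and [x] a basis vector: a repeated index gives 0 on
    both sides, and a new one costs the same reordering sign on both. *)
Lemma wedge_ext_mx w x A : wedge w x *m ext_mx A = wedge (w *m A) (x *m ext_mx A).
Proof.
rewrite -!wedge_mxE -!mulmxA; congr (x *m _); apply: eq_on_bvec => S.
rewrite !mulmxA !wedge_mxE ext_mxE [w]row_sum_delta mulmx_suml.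
under [in RHS]eq_bigr do rewrite -scalemxAl.
rewrite !wedge_suml mulmx_suml; apply: eq_bigr => t _.
rewrite -scalemxAl; congr (_ *: _); rewrite -rowE.
have [tS | tS] := boolP (t \in S).
  by rewrite bvec_wedge_rows !wedge_rows_mem // ?mul0mx // (wedge_rows_mem (fun s => row s A)).
by rewrite bvec_wedge_rows !wedge_rows_notin // -bvec_wedge_rows -scalemxAl ext_mxE.
Qed.

Lemma wedges_ext_mx ws A : wedges ws *m ext_mx A = wedges [seq w *m A | w <- ws].
Proof.
elim: ws => [|w ws IH] /=; last by rewrite wedge_ext_mx IH.
by rewrite ext_mxE /wedge_rows enum_set0.
Qed.

Lemma ext_mxM A B : ext_mx (A *m B) = ext_mx A *m ext_mx B.
Proof.
apply: eq_on_bvec => S; rewrite mulmxA !ext_mxE /wedge_rows wedges_ext_mx -map_comp.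
by congr wedges; apply: eq_map => s; rewrite /= row_mul.
Qed.

Definition deg_mx j : 'M[C]_#|{set 'I_n}| :=
  linext (fun S => (#|S| == j)%:R *: bvec S).

Lemma coef_deg x j T : coef (x *m deg_mx j) T = (#|T| == j)%:R * coef x T.
Proof.
rewrite {1}[x]ext_sum_bvec mulmx_suml coef_sum (bigD1 T) //= big1 ?addr0 => [|S ST].
  by rewrite -scalemxAl bvecK !coefZ coef_bvec eqxx mulr1 mulrC.
by rewrite -scalemxAl bvecK !coefZ coef_bvec (negPf ST) !mulr0.
Qed.

Lemma wedge_deg w x j : wedge w x *m deg_mx j.+1 = wedge w (x *m deg_mx j).
Proof.
apply: ext_eqP => T; rewrite coef_deg !coef_wedge mulr_sumr; apply: eq_bigr => t tT.
by rewrite coef_deg (cardsD1 t) tT add1n eqSS; ring.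
Qed.

Lemma wedge_deg0 w x : wedge w x *m deg_mx 0 = 0.
Proof.
apply: ext_eqP => T; rewrite coef_deg [RHS]mxE coef_wedge.
case: eqP => [/eqP|]; last by rewrite mul0r.
by rewrite cards_eq0 => /eqP->; rewrite big_set0 mulr0.
Qed.

Lemma wedges_deg ws j : wedges ws *m deg_mx j = (size ws == j)%:R *: wedges ws.
Proof.
elim: ws j => [|w ws IH] [|j] /=.
- by rewrite bvecK cards0.
- by rewrite bvecK cards0.
- by rewrite wedge_deg0 scale0r.
by rewrite wedge_deg IH wedgeZr eqSS.
Qed.

Lemma ext_deg A j : ext_mx A *m deg_mx j = deg_mx j *m ext_mx A.
Proof.
apply: eq_on_bvec => S; rewrite !mulmxA ext_mxE bvecK -scalemxAl ext_mxE.
by rewrite /wedge_rows wedges_deg size_map -cardE.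
Qed.

Lemma ext_pow_wedge A w j : (w <= A)%MS -> (ext_pow A j *m wedge_mx w <= ext_pow A j.+1)%MS.
Proof.
case/submxP=> D ->; rewrite sumsmxMr; apply/sumsmx_subP=> t _.
rewrite (eqmxMr _ (genmxE _)) wedge_mxE mulmx_sum_row wedge_suml summx_sub // => i _.
by rewrite scalemx_sub // (sumsmx_sup [tuple of i :: t]) // genmxE.
Qed.

Lemma wedges_ext_pow A ws :
  all (fun w => (w <= A)%MS) ws -> (wedges ws <= ext_pow A (size ws))%MS.
Proof.
elim: ws => [_|w ws IH /= /andP[wA /IH wsA]].
  by rewrite (sumsmx_sup [tuple]) // genmxE.
by rewrite -wedge_mxE; apply: submx_trans (ext_pow_wedge _ wA); apply: submxMr.
Qed.

Lemma deg_ext_pow A P j : (P <= A)%MS -> (deg_mx j *m ext_mx P <= ext_pow A j)%MS.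
Proof.
move=> PA; apply/row_subP=> k; rewrite rowE mulmxA.
have -> : delta_mx 0 k = bvec (enum_val k) by rewrite /bvec enum_valK.
rewrite bvecK -scalemxAl ext_mxE; case: eqP => [<-|]; last by rewrite scale0r sub0mx.
rewrite scalemx_sub // cardE -(size_map (fun s => row s P)); apply: wedges_ext_pow.
by apply/allP=> w /mapP[s _ ->]; apply: submx_trans PA; apply: row_sub.
Qed.

Lemma ext_pow_mul_eq0 A j p (M : 'M_(_, p)) :
    (forall ws : seq 'rV_n, size ws = j -> all (fun w => (w <= A)%MS) ws -> wedges ws *m M = 0) ->
  ext_pow A j *m M = 0.
Proof.
move=> h; apply/eqP; rewrite -submx0 /ext_pow sumsmxMr_gen; apply/sumsmx_subP=> t _.
rewrite genmxE (eqmxMr _ (genmxE _)) h ?sub0mx ?size_map ?size_tuple //.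
by apply/allP=> w /mapP[i _ ->]; apply: row_sub.
Qed.

Lemma ext_pow_id A P j : A *m P = A -> ext_pow A j *m ext_mx P = ext_pow A j.
Proof.
move=> AP; apply/eqP; rewrite -subr_eq0 -{2}[ext_pow A j]mulmx1 -mulmxBr.
apply/eqP/ext_pow_mul_eq0 => ws _ wsA; rewrite mulmxBr mulmx1 wedges_ext_mx.
rewrite (eq_in_map _ id _).1 ?map_id ?subrr // => w /(allP wsA)/submxP[D ->].
by rewrite -mulmxA AP.
Qed.

Lemma ext_pow_deg A j : ext_pow A j *m deg_mx j = ext_pow A j.
Proof.
apply/eqP; rewrite -subr_eq0 -{2}[ext_pow A j]mulmx1 -mulmxBr.
apply/eqP/ext_pow_mul_eq0 => ws sz _; rewrite mulmxBr mulmx1 wedges_deg sz eqxx.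
by rewrite scale1r subrr.
Qed.

(** This coefficient is a principal minor. The row of the least index in S vanishes at all larger
    indices, so each expansion step keeps only the diagonal entry. *)
Lemma coef_wedge_rows_trig A S : is_trig_mx A ->
  coef (wedge_rows (fun s => row s A) S) S = \prod_(s in S) A s s.
Proof.
move/is_trig_mxP=> trA; have [k] := ubnP #|S|; elim: k S => // k IH S ltS.
have [-> | [t0 t0S]] := set_0Vmem S.
  by rewrite /wedge_rows enum_set0 big_set0 coef_bvec eqxx.
case: (arg_minnP (fun s : 'I_n => s : nat) t0S) => t tS0 t_min; have tS : t \in S := tS0.
rewrite (wedge_rows_expand _ tS) (_ : pos t S = 0)%N; last first.
  by apply: eq_card0 => s; rewrite !inE; apply/negP=> /andP[/t_min]; rewrite leqNgt => /negP.
rewrite scale1r coef_wedge (bigD1 t) //= big1 ?addr0 => [|u /andP[uS ut]].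
  rewrite (_ : pos t S = 0)%N; last first.
    by apply: eq_card0 => s; rewrite !inE; apply/negP=> /andP[/t_min]; rewrite leqNgt => /negP.
  rewrite mul1r mxE IH; last by move: ltS; rewrite (cardsD1 t) tS.
  by rewrite [RHS](big_setD1 t).
rewrite mxE trA ?mulr0 ?mul0r // ltn_neqAle (t_min u uS) andbT.
by rewrite eq_sym in ut.
Qed.

Lemma mxtrace_bvec (I : finType) (X : 'M[C]_#|I|) :
  \tr X = \sum_i (Defs.bvec C i *m X) 0 (enum_rank i).
Proof.
rewrite /mxtrace (reindex (@enum_rank I)) /=; last first.
  by exists enum_val => i _; rewrite ?enum_rankK ?enum_valK.
by apply: eq_bigr => i _; rewrite /Defs.bvec -rowE mxE.
Qed.

Lemma mxtrace_coef (X : 'M[C]_#|{set 'I_n}|) : \tr X = \sum_S coef (bvec S *m X) S.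
Proof. exact: mxtrace_bvec. Qed.

(* Both sides are invariant under conjugation, so A may be taken triangular. *)
Lemma supertrace_ext A :
  \sum_(j < n.+1) (-1) ^+ j * \tr (deg_mx j *m ext_mx A) = \det (1%:M - A).
Proof.
have [P Pu trig] : exists2 P, P \in unitmx & is_trig_mx (P *m A *m invmx P).
  case: (posnP n) => [n0|n_gt0].
    exists 1%:M; first exact: unitmx1.
    by apply/is_trig_mxP=> i; have := ltn_ord i; rewrite [X in (_ < X)%N]n0.
  have [P /unitarymx_unit Pu] := Schur A n_gt0.
  by rewrite -[similar_to _ _ _]/(is_trig_mx (conjmx P A)) conjumx // => tr; exists P.
set B := P *m A *m invmx P in trig.
have trB j : \tr (deg_mx j *m ext_mx A) = \tr (deg_mx j *m ext_mx B).
  rewrite /B !ext_mxM mulmxA [RHS]mxtrace_mulC !mulmxA ext_deg.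
  by rewrite -(mulmxA (deg_mx j)) -ext_mxM mulVmx // ext_mx1 mulmx1.
have -> : \det (1%:M - A) = \det (1%:M - B).
  rewrite -[1%:M in RHS](mulmxV Pu) -{1}[P in RHS]mulmx1 -mulmxBl -mulmxBr !det_mulmx mulrC mulrA.
  by rewrite -det_mulmx mulVmx // det1 mul1r.
clearbody B; rewrite det_trig; last first.
  apply/is_trig_mxP=> i j ij; rewrite !mxE (is_trig_mxP trig) // subr0.
  by rewrite -val_eqE ltn_eqF.
under eq_bigr do rewrite trB mxtrace_coef mulr_sumr.
rewrite exchange_big /=.
(* The product of the 1 - B i i expands over subsets S, and the basis vector at S supplies the
   matching term in degree |S|. *)
rewrite [RHS](eq_bigr (fun i => - B i i + 1)) => [|i _]; last by rewrite !mxE eqxx addrC.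
rewrite bigA_distr /=; apply: eq_bigr => S _.
have lt : (#|S| < n.+1)%N by rewrite ltnS (leq_trans (max_card _)) ?card_ord.
rewrite (bigD1 (Ordinal lt)) //= big1 ?addr0 => [|j nj]; last first.
  rewrite mulmxA bvecK -scalemxAl coefZ; case: eqP => [e|]; last by rewrite mul0r mulr0.
  by case/eqP: nj; apply/val_inj.
rewrite mulmxA bvecK eqxx scale1r ext_mxE coef_wedge_rows_trig //.
by rewrite -big_mkcond /= prodrN.
Qed.

End ExteriorMaps.

(** * Projections attached to an equivalence relation *)

Section ClassProjection.
Variables (C : numClosedFieldType) (n : nat) (e : rel 'I_n).
Hypotheses (e_refl : reflexive e) (e_sym : symmetric e) (e_trans : transitive e).
Implicit Types (u v w : 'I_n) (h : 'S_n).

Definition class_size v : nat := #|[set u | e v u]|.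

Definition class_avg : 'M[C]_n := \matrix_(v, u) ((e v u)%:R / (class_size v)%:R).

Definition class_proj : 'M[C]_n := 1%:M - class_avg.

Definition class_perms : {set 'S_n} := [set h : 'S_n | [forall v, e v (h v)]].

Lemma class_eq v w : e v w -> e v =1 e w.
Proof.
move=> vw u; apply/idP/idP; apply: e_trans => //.
by rewrite e_sym.
Qed.

Lemma class_size_eq v w : e v w -> class_size v = class_size w.
Proof. by move=> vw; apply: eq_card => u; rewrite !inE (class_eq vw). Qed.

Lemma class_size_neq0 v : (class_size v)%:R != 0 :> C.
Proof. by rewrite pnatr_eq0 -lt0n; apply/card_gt0P; exists v; rewrite inE. Qed.

Lemma class_avg_sym v w : class_avg v w = class_avg w v.
Proof.
rewrite !mxE e_sym; case: (boolP (e w v)) => [wv|]; last by rewrite !mul0r.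
by rewrite (class_size_eq wv).
Qed.

Lemma sum_class_avg v : \sum_w class_avg v w = 1.
Proof.
under eq_bigr do rewrite mxE.
rewrite -mulr_suml -natr_sum -[X in X%:R](_ : class_size v = _) ?mulfV ?class_size_neq0 //.
by rewrite /class_size -sum1_card big_mkcond /=; apply: eq_bigr => w _; rewrite inE; case: (e v w).
Qed.

Lemma class_avg_row v w : e v w -> row v class_avg = row w class_avg.
Proof.
move=> vw; apply/rowP=> u; rewrite !mxE (class_eq vw).
by rewrite (class_size_eq vw).
Qed.

Lemma class_avg_mull m (A : 'M[C]_(n, m)) :
  (forall v w, e v w -> row v A = row w A) -> class_avg *m A = A.
Proof.
move=> Ae; apply/matrixP=> v u; rewrite mxE.
rewrite (eq_bigr (fun w => class_avg v w * A v u)) => [|w _].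
  by rewrite -mulr_suml sum_class_avg mul1r.
rewrite !mxE; case: (boolP (e v w)) => [vw|]; last by rewrite !mul0r.
by congr (_ * _); have /rowP/(_ u) := Ae _ _ vw; rewrite !mxE.
Qed.

Lemma class_avg_idem : class_avg *m class_avg = class_avg.
Proof. exact/class_avg_mull/class_avg_row. Qed.

Lemma class_proj_idem : class_proj *m class_proj = class_proj.
Proof.
rewrite /class_proj mulmxBl mul1mx mulmxBr mulmx1 class_avg_idem subrr.
by rewrite subr0.
Qed.

Lemma class_permsP h : reflect (forall v, e v (h v)) (h \in class_perms).
Proof. by rewrite inE; apply: forallP. Qed.

Lemma group_set_class_perms : group_set class_perms.
Proof.
apply/group_setP; split=> [|a b /class_permsP ha /class_permsP hb]; apply/class_permsP=> v.
  by rewrite perm1.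
by rewrite permM; apply: e_trans (hb _).
Qed.

Lemma mul_perm_mx_row h m (A : 'M[C]_(n, m)) v : row v (perm_mx h *m A) = row (h v) A.
Proof. by rewrite -row_permE; apply/rowP=> u; rewrite !mxE. Qed.

Lemma perm_class_avgl h : h \in class_perms -> perm_mx h *m class_avg = class_avg.
Proof.
move=> /class_permsP he; apply/row_matrixP=> v; rewrite mul_perm_mx_row.
by apply/class_avg_row; rewrite e_sym.
Qed.

Lemma class_avg_tr : class_avg^T = class_avg.
Proof. by apply/matrixP=> v w; rewrite mxE class_avg_sym. Qed.

Lemma perm_class_avgr h : h \in class_perms -> class_avg *m perm_mx h = class_avg.
Proof.
move=> he; rewrite -class_avg_tr -{2}(perm_class_avgl (h := h^-1%g)).
  by rewrite trmx_mul tr_perm_mx invgK.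
by apply: (@groupVr _ (Group group_set_class_perms)).
Qed.

Lemma perm_class_proj h : h \in class_perms -> perm_mx h *m class_proj = class_proj *m perm_mx h.
Proof.
by move=> he; rewrite mulmxBr mulmxBl mulmx1 mul1mx perm_class_avgl // perm_class_avgr.
Qed.

Definition class_mx : 'M[C]_n := \matrix_(v, u) (e v u)%:R.

Lemma class_proj_ker : class_proj *m class_mx = 0.
Proof.
rewrite mulmxBl mul1mx class_avg_mull ?subrr // => v w vw.
by apply/rowP=> u; rewrite !mxE (class_eq vw).
Qed.

Lemma ker_class_avg m (A : 'M[C]_(m, n)) : A *m class_mx = 0 -> A *m class_avg = 0.
Proof.
move=> A0; have -> : class_avg = class_mx *m diag_mx (\row_v (class_size v)%:R^-1).
  apply/matrixP=> v u; rewrite class_avg_sym mul_mx_diag !mxE e_sym.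
  by [].
by rewrite mulmxA A0 mul0mx.
Qed.

(** [class_avg] is real and symmetric and kills the zero-sum vectors, so its rows are orthogonal to
    them, while the rows of [class_proj] have zero sums. *)
Lemma proj_ortho_class : proj_ortho (kermx class_mx) = class_proj.
Proof.
have W : (class_proj <= kermx class_mx)%MS by apply/sub_kermxP/class_proj_ker.
rewrite -[LHS]mul1mx -[1%:M](subrK class_avg) mulmxDl proj_ortho_id //.
rewrite proj_ortho_0 ?addr0 //.
rewrite orthomx_sym; apply/orthomx1P.
rewrite class_avg_tr (_ : map_mx _ class_avg = class_avg).
  exact/ker_class_avg/mulmx_ker.
apply/matrixP=> v w; rewrite !mxE rmorphM fmorphV /=.
by rewrite !conjC_nat.
Qed.

(** The indicator [y] of the colour of [u] is fixed by [h] and not constant on the class of [u] and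
    [v], so its projection is a nonzero fixed vector. *)
Lemma det_class_proj_eq0 (K : eqType) (kappa : 'I_n -> K) h u v :
    h \in class_perms -> (forall w, kappa (h w) = kappa w) ->
    e u v -> kappa u != kappa v ->
  \det (1%:M - perm_mx h *m class_proj) = 0.
Proof.
move=> he hk uv nk; apply/eqP/det0P.
pose y : 'rV[C]_n := \row_s (kappa s == kappa u)%:R.
have yh : y *m perm_mx h = y.
  apply/rowP=> s; rewrite -[in LHS](invgK h) -col_permE !mxE.
  by rewrite -{2}[s](permKV h) hk.
exists (y *m class_proj); last first.
  rewrite mulmxBr mulmx1 !mulmxA -(mulmxA y) -perm_class_proj // mulmxA yh.
  by rewrite -mulmxA class_proj_idem subrr.
apply/eqP; rewrite mulmxBr mulmx1 => /eqP; rewrite subr_eq0 => /eqP yJ.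
have : y 0 u = y 0 v.
  rewrite yJ !mxE; apply: eq_bigr => w _; congr (_ * _).
  rewrite [LHS]class_avg_sym [RHS]class_avg_sym.
  by have /rowP/(_ w) := class_avg_row uv; rewrite !mxE.
rewrite !mxE eqxx eq_sym (negPf nk) => /eqP.
by rewrite oner_eq0.
Qed.

End ClassProjection.

(** * The mean of det(1 - h P) over the permutations preserving classes *)

Section ClassDeterminants.
Variables (C : numClosedFieldType) (n : nat) (e : rel 'I_n).
Hypotheses (e_refl : reflexive e) (e_sym : symmetric e) (e_trans : transitive e).
Implicit Types (u v w i : 'I_n) (h s : 'S_n).
Local Notation P := (class_proj C e).
Local Notation Y := (class_perms e).

Lemma class_proj_sub (e' : rel 'I_n) :
    reflexive e' -> symmetric e' -> transitive e' -> subrel e' e ->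
  P *m class_proj C e' = class_proj C e'.
Proof.
move=> r' s' t' sub; rewrite /class_proj mulmxBl mul1mx mulmxBr mulmx1.
suff -> : class_avg C e *m class_avg C e' = class_avg C e by rewrite subrr subr0.
rewrite -[LHS]trmxK trmx_mul !class_avg_tr // class_avg_mull // ?class_avg_tr //.
by move=> v w /sub; apply: class_avg_row.
Qed.

Lemma class_proj_supp u v : ~~ e u v -> P u v = 0.
Proof.
move=> nuv; rewrite !mxE (negPf nuv) mul0r subr0.
by case: eqP nuv => // ->; rewrite e_refl.
Qed.

Lemma class_proj_col_sum u : \sum_(w | e u w) P w u = 0.
Proof.
transitivity (\sum_w P w u).
  rewrite [LHS]big_mkcond; apply: eq_bigr => w _; case: ifP => // /negbT nuw.
  by rewrite class_proj_supp // e_sym.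
under eq_bigr do rewrite mxE mxE.
rewrite big_split /= (bigD1 u) //= eqxx big1 ?addr0 => [|w /negPf->//].
under [X in _ + X]eq_bigr do rewrite mxE class_avg_sym //.
by rewrite sumrN sum_class_avg // subrr.
Qed.

Let term (S : {set 'I_n}) h s : C :=
  \prod_i (if i \in S then - P (h i) (s i) else (i == s i)%:R).

Let tperm_class u w : e u w -> tperm u w \in Y.
Proof.
move=> uw; apply/class_permsP=> v.
by case: tpermP => [->|->|_ _]; rewrite // e_sym.
Qed.

Let Y_group := Group (group_set_class_perms e_refl e_trans).

(** Multiplying both h and s on the left by the transposition of [u] and [v] only permutes the
    factors of [term], but reverses the sign of s. *)
Let sum_term_repeat (S : {set 'I_n}) u v : u \in S -> v \in S -> u != v -> e u v ->
  \sum_(h in Y) \sum_s (-1) ^+ odd_perm s * term S h s = 0.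
Proof.
move=> uS vS nuv uv; set X := \sum_(h in _) _.
have tY := tperm_class uv; set t := tperm u v in tY.
have tS i : (t i \in S) = (i \in S) by rewrite /t; case: tpermP => [->|->|]; rewrite ?uS ?vS.
have tt i : t (t i) = i by rewrite /t tpermK.
have termE h s : term S (t * h)%g (t * s)%g = term S h s.
  rewrite /term (reindex_inj (@perm_inj _ t)); apply: eq_bigr => i _.
  rewrite tS !permM tt; case: ifP => // iS; congr (_%:R); congr nat_of_bool.
  rewrite /t tpermD //; by apply: contraFneq iS => <-.
have e2 : X = - X.
  rewrite {1}/X -(@sum_groupMl _ _ Y_group _ t) // -sumrN; apply: eq_bigr => h _.
  rewrite (reindex_inj (mulgI t)) -sumrN; apply: eq_bigr => s _.
  by rewrite termE odd_permM odd_tperm nuv signr_addb expr1 mulN1r mulNr.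
apply/eqP; have : (2%:R : C) * X == 0 by rewrite mulr_natl mulr2n {1}e2 addNr.
by rewrite mulf_eq0 pnatr_eq0.
Qed.

(** Only s = 1 contributes: it fixes the points outside S, and on S the support of P keeps s i in
    the class of i, which meets S once. Splitting by w = h u, the other factors give a sum that does
    not depend on w, so the column sum of P factors out. *)
Let sum_term_transversal (S : {set 'I_n}) u : u \in S ->
    {in S &, forall v w, e v w -> v = w} ->
  \sum_(h in Y) \sum_s (-1) ^+ odd_perm s * term S h s = 0.
Proof.
move=> uS trS.
have term0 h s : h \in Y -> s != 1%g -> term S h s = 0.
  move=> /class_permsP hY; apply: contraNeq => /prodf_neq0 nz; apply/eqP/permP=> i.
  rewrite perm1; apply/eqP; have [iS|iS] := boolP (i \in S); last first.
    by have := nz i isT; rewrite (negPf iS) pnatr_eq0 eqb0 negbK eq_sym.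
  have eis : e i (s i).
    apply: e_trans (hY i) _; apply: contraT => /class_proj_supp e0.
    by have := nz i isT; rewrite iS e0 oppr0 eqxx.
  have [siS|siS] := boolP (s i \in S); first by rewrite eq_sym; apply/eqP/trS.
  have := nz (s i) isT; rewrite (negPf siS) pnatr_eq0 eqb0 negbK.
  by rewrite eq_sym (inj_eq perm_inj).
pose R h := \prod_(i in S :\ u) - P (h i) i.
rewrite (eq_bigr (fun h => - P (h u) u * R h)) => [|h hY]; last first.
  rewrite (bigD1 1%g) //= big1 ?addr0 => [|s s1]; last by rewrite term0 ?mulr0.
  rewrite odd_perm1 mul1r /term; under eq_bigr do rewrite perm1 eqxx.
  by rewrite -big_mkcond /= (big_setD1 u).
rewrite (partition_big (fun h => h u) (e u)) /=; last by move=> h /class_permsP.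
pose Z w := \sum_(h in Y | h u == w) R h.
rewrite (eq_bigr (fun w => - (P w u * Z u))) => [|w uw]; last first.
  rewrite (eq_bigr (fun h => - P w u * R h)); last by move=> h /andP[_ /eqP->].
  rewrite -mulr_sumr mulNr; congr (- (_ * _)).
  rewrite (reindex_inj (mulIg (tperm u w))) /Z; apply: eq_big => [h|h /andP[hY hu]].
    rewrite (@groupMr _ Y_group) ?tperm_class //; congr (_ && _).
    by rewrite permM -{2}(tpermL u w) (inj_eq perm_inj).
  apply: eq_bigr => i; rewrite !inE => /andP[iu iS]; congr (- P _ _); rewrite permM tpermD //.
  - apply: contraNneq iu => uhi; apply/eqP/trS => //.
    rewrite (@groupMr _ Y_group) ?tperm_class // in hY.
    by rewrite uhi; move/class_permsP: hY.
  apply: contraNneq iu => whi; apply/eqP/trS => //.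
  rewrite (@groupMr _ Y_group) ?tperm_class // in hY.
  by apply: (@e_trans w); [rewrite whi; move/class_permsP: hY | rewrite e_sym].
by rewrite sumrN -mulr_suml class_proj_col_sum mul0r oppr0.
Qed.

(* Expanding each row as (identity) - (h P), the choices of a nonempty set S of
   rows of the second kind contribute zero: if S meets a class twice, by the
   transposition of the two elements; otherwise because P has zero column sums. *)
Lemma sum_det_class_proj :
  \sum_(h in Y) \det (1%:M - perm_mx h *m P) = #|Y|%:R.
Proof.
transitivity (\sum_(S : {set 'I_n}) \sum_(h in Y) \sum_s (-1) ^+ odd_perm s * term S h s).
  rewrite [RHS]exchange_big; apply: eq_bigr => h _.
  rewrite [RHS]exchange_big; apply: eq_bigr => s _ /=.
  rewrite -mulr_sumr; congr (_ * _); rewrite /term -bigA_distr /=; apply: eq_bigr => i _.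
  by rewrite -row_permE; move: P => A; rewrite !mxE addrC.
rewrite (bigD1 set0) //= [X in _ + X]big1 ?addr0 => [|S /set0Pn[u uS]].
  rewrite -sum1_card natr_sum; apply: eq_bigr => h _.
  rewrite (bigD1 1%g) //= big1 ?addr0 => [|s s1].
    rewrite odd_perm1 mul1r /term big1 // => i _; by rewrite inE perm1 eqxx.
  have [i si] : exists i, i != s i.
    apply/existsP; rewrite -negb_forall; apply: contra s1 => /forallP s1.
    by apply/eqP/permP=> i; rewrite perm1 -(eqP (s1 i)).
  by rewrite /term (bigD1 i) //= inE (negPf si) mul0r mulr0.
have [/existsP[v /existsP[w /and4P[vS wS nvw vw]]]|no] :=
  boolP [exists v, exists w, [&& v \in S, w \in S, v != w & e v w]].
  exact: (sum_term_repeat vS wS).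
apply: (sum_term_transversal uS) => v w vS wS vw; apply/eqP.
apply: contraR no => nvw; apply/existsP; exists v; apply/existsP; exists w.
by rewrite vS wS nvw.
Qed.

End ClassDeterminants.

(** * The chain complex *)

Section Complex.
Variables (C : numClosedFieldType) (G : mgraph).
Local Notation n := (nv G).
Local Notation m := (ne G).
Local Notation sc F := (same_comp (G := G) F).
Local Notation P F := (class_proj C (same_comp (G := G) F)).
Local Notation W F := (Wspace C (G := G) F).
Local Notation ten := (@tens C G).
Local Notation exm := (@ext_mx C n).
Local Notation N := #|state_ext G|.
Local Notation d := (@diff C G).
Local Notation ch := (@chains C G).
Local Notation rl := (@relations C G).
Implicit Types (F : {set 'I_m}) (g h k : 'S_n) (e : 'I_m) (S : {set 'I_n}).

Lemma same_comp_refl F : reflexive (sc F).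
Proof. by move=> v; apply: connect0. Qed.

Lemma same_comp_sym F : symmetric (sc F).
Proof.
apply: sym_connect_sym => u v; rewrite /adj; apply: eq_existsb => e.
by rewrite orbC.
Qed.

Lemma same_comp_trans F : transitive (sc F).
Proof. exact: connect_trans. Qed.

Hint Resolve same_comp_refl same_comp_sym same_comp_trans : core.

Lemma same_comp_sub F F' : F' \subset F -> subrel (sc F') (sc F).
Proof.
move=> /subsetP sub; apply: connect_sub => u v /exists_inP[e eF h].
by apply: connect1; apply/exists_inP; exists e; rewrite // sub.
Qed.

Definition young_group F := Group (group_set_class_perms (same_comp_refl F) (@same_comp_trans F)).

Lemma card_young_neq0 F : #|young F|%:R != 0 :> C.
Proof. by rewrite pnatr_eq0 -lt0n (cardG_gt0 (young_group F)). Qed.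

Lemma proj_ortho_Wspace F : proj_ortho (W F) = P F.
Proof. exact: proj_ortho_class. Qed.

Lemma sub_Wspace F : (P F <= W F)%MS.
Proof. exact/sub_kermxP/class_proj_ker. Qed.

Lemma Wspace_proj F : W F *m P F = W F.
Proof. by rewrite -proj_ortho_Wspace proj_ortho_id. Qed.

Lemma young_proj F h : h \in young F -> perm_mx h *m P F = P F *m perm_mx h.
Proof. exact: perm_class_proj. Qed.

Lemma proj_sub F F' : F' \subset F -> P F *m P F' = P F'.
Proof. by move=> sub; apply: class_proj_sub => //; apply: same_comp_sub. Qed.

Lemma bvec_tens F g S : bvec C S *m ten F g = @bvec C (state_ext G) (F, g, S).
Proof. exact: bvecK. Qed.

Lemma eq_on_tens p (A B : 'M[C]_(N, p)) :
  (forall F g, ten F g *m A = ten F g *m B) -> A = B.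
Proof.
move=> AB; apply: eq_on_bvec => -[[F g] S].
by rewrite -bvec_tens -!mulmxA AB.
Qed.

(* |S_F1| times the image of x |-> g (x) x under the differential F0 -> F1
   followed by the averaging operator [avg_state] below. *)
Definition tens_avg F0 F1 g : 'M[C]_(_, N) :=
  \sum_(h in young F0) exm (perm_mx h^-1%g *m P F1) *m ten F1 (h * g)%g.

(* On the chains this is a projector with kernel the relations, so its image is a
   copy of the chain modules. *)
Definition avg_state : 'M[C]_N :=
  linext (fun b : state_ext G => let: (F, g, T) := b in
    #|young F|%:R^-1 *: (bvec C T *m tens_avg F F g)).
Local Notation E := avg_state.

Lemma tens_avg_state F g : ten F g *m E = #|young F|%:R^-1 *: tens_avg F F g.
Proof.
by apply: eq_on_bvec => S; rewrite mulmxA bvec_tens bvecK scalemxAr.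
Qed.

Lemma tens_avgMl F F' g h : h \in young F ->
  tens_avg F F' (h * g)%g = exm (perm_mx h) *m tens_avg F F' g.
Proof.
move=> Yh; rewrite /tens_avg mulmx_sumr -(@sum_groupMr _ _ (young_group F) _ (h^-1)%g); last first.
  exact: (groupVr (Yh : h \in young_group F)).
apply: eq_bigr => k _; rewrite invMg invgK perm_mxM mulmxA -ext_mxM mulmxA.
by rewrite -mulgA mulKg.
Qed.

Lemma young_sub F F' : F' \subset F -> young F' \subset young F.
Proof.
move=> sub; apply/subsetP=> h; rewrite !inE => /forallP h'.
by apply/forallP=> v; apply: same_comp_sub (h' v).
Qed.

(** Each k of the inner average lies in S_F and commutes with the projection to W_F', so the outer
    average absorbs it. With F'' = F' this yields idempotence, with F'' = F' - e the behaviour under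
    the differential. *)
Lemma tens_avg_comp F F' F'' g : F' \subset F -> F'' \subset F' ->
  \sum_(h in young F) exm (perm_mx h^-1%g *m P F') *m tens_avg F' F'' (h * g)%g =
    #|young F'|%:R *: tens_avg F F'' g.
Proof.
move=> sub sub'; under eq_bigr do rewrite /tens_avg mulmx_sumr.
rewrite exchange_big /= (eq_bigr (fun=> tens_avg F F'' g)) => [|k Yk].
  by rewrite sumr_const scaler_nat.
have Yk' := subsetP (young_sub sub) _ Yk.
rewrite -(@sum_groupMl _ _ (young_group F) _ k^-1%g); last first.
  exact: (groupVr (Yk' : k \in young_group F)).
rewrite /tens_avg; apply: eq_bigr => h _; rewrite mulmxA -ext_mxM.
rewrite (mulgA k) (mulgA k) mulgV mul1g.
congr (exm _ *m _); rewrite invMg invgK perm_mxM -!mulmxA.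
rewrite (mulmxA (P F')) -young_proj; last first.
  exact: (groupVr (Yk : k \in young_group F')).
by rewrite -mulmxA proj_sub // (mulmxA (perm_mx k)) -perm_mxM mulgV perm_mx1 mul1mx.
Qed.

Lemma tens_avg_state_id F F' g : F' \subset F -> tens_avg F F' g *m E = tens_avg F F' g.
Proof.
move=> sub; rewrite /tens_avg mulmx_suml.
under eq_bigr do rewrite -mulmxA tens_avg_state -scalemxAr.
by rewrite -scaler_sumr tens_avg_comp // scalerA mulVf ?card_young_neq0 // scale1r.
Qed.

Lemma avg_state_idem : E *m E = E.
Proof.
apply: eq_on_tens => F g; rewrite mulmxA tens_avg_state -scalemxAl.
by rewrite tens_avg_state_id.
Qed.

Lemma avg_state_act g : E *m state_repr C G g = state_repr C G g *m E.
Proof.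
apply: eq_on_tens => F h; rewrite !mulmxA tens_act !tens_avg_state -scalemxAl.
congr (_ *: _); rewrite /tens_avg mulmx_suml; apply: eq_bigr => k _.
by rewrite -mulmxA tens_act mulgA.
Qed.

Lemma tens_diff F g : ten F g *m d = \sum_(e in F) sgn_edge C F e *: diff_edge C F e g.
Proof.
apply: eq_on_bvec => S; rewrite mulmxA bvec_tens bvecK mulmx_sumr.
by apply: eq_bigr => e _; rewrite -scalemxAr.
Qed.

(** Averaging over S_(F - e) fills out each coset from its representative, so the choice made by
    [repr] disappears. *)
Lemma diff_edge_state F e g :
  diff_edge C F e g *m E = #|young (F :\ e)|%:R^-1 *: tens_avg F (F :\ e) g.
Proof.
have sub : F :\ e \subset F by apply: subsetDl.
set F' := F :\ e in sub *; rewrite /diff_edge -/F' mulmx_suml.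
rewrite (eq_bigr (fun c : {set 'S_n} => #|young F'|%:R^-1 *:
    \sum_(h in c) exm (perm_mx h^-1%g *m P F') *m ten F' (h * g)%g)) => [|c Yc].
  rewrite -scaler_sumr; congr (_ *: _); rewrite /tens_avg.
  have part := rcosets_partition (young_sub sub : young_group F' \subset young_group F).
  exact: esym (set_partition_big _ part).
rewrite proj_ortho_Wspace -!mulmxA tens_avg_state -!scalemxAr; congr (_ *: _).
rewrite mulmxA -ext_mxM /tens_avg mulmx_sumr.
have [x _ ec] := rcosetsP Yc.
have cE : c = (young_group F' :* repr c)%g.
  by rewrite ec; apply/esym/(rcoset_repr (young_group F')).
set y := repr c in cE *; rewrite [RHS](eq_bigl (fun h => h \in young_group F' :* y)%g);
  last by rewrite -cE.
rewrite [RHS](reindex_inj (mulIg y)); apply: eq_big => [k|k Yk] /=.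
  by rewrite mem_rcoset mulgK.
rewrite mulmxA -ext_mxM mulgA; congr (exm _ *m _).
rewrite invMg perm_mxM -!mulmxA (mulmxA (P F')) -young_proj; last first.
  exact: (groupVr (Yk : k \in young_group F')).
by rewrite -mulmxA proj_sub.
Qed.

Lemma tens_diff_state F g : ten F g *m (d *m E) =
  \sum_(e in F) (sgn_edge C F e / #|young (F :\ e)|%:R) *: tens_avg F (F :\ e) g.
Proof.
rewrite mulmxA tens_diff mulmx_suml; apply: eq_bigr => e _.
by rewrite -scalemxAl diff_edge_state scalerA.
Qed.

Lemma tens_avg_diff_state F F' g : F' \subset F ->
  tens_avg F F' g *m (d *m E) = \sum_(e in F')
    (sgn_edge C F' e * #|young F'|%:R / #|young (F' :\ e)|%:R) *: tens_avg F (F' :\ e) g.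
Proof.
move=> sub; rewrite /tens_avg mulmx_suml.
under eq_bigr do rewrite -mulmxA tens_diff_state mulmx_sumr.
rewrite exchange_big; apply: eq_bigr => e _ /=.
under eq_bigr do rewrite -scalemxAr.
by rewrite -scaler_sumr tens_avg_comp ?subsetDl // scalerA mulrAC.
Qed.

(** Of the two edges, only the one of smaller index has its sign changed by the earlier removal of
    the other. *)
Lemma sgn_edge_anti F e e' : e \in F -> e' \in F -> e != e' ->
  sgn_edge C F e * sgn_edge C (F :\ e) e' = - (sgn_edge C F e' * sgn_edge C (F :\ e') e).
Proof.
have split a b : a \in F -> #|[set l in F | (b < l)%N]| = ((b < a) + #|[set l in F
  :\ a | (b < l)%N]|)%N.
  move=> aF; rewrite (cardsD1 a) !inE aF /=; congr (_ + _)%N.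
  by apply: eq_card => s; rewrite !inE -?andbA.
move=> eF e'F ee'; rewrite /sgn_edge (split _ _ e'F) (split _ e' eF).
rewrite -!exprD -[RHS]mulN1r -exprS.
have -> : (e < e')%N = ~~ (e' < e)%N by rewrite -leqNgt [RHS]leq_eqVlt val_eqE (negPf ee').
rewrite -addnA -addnS -addnA (addnC #|[set l in F :\ e' | (e < l)%N]|) !exprD.
by case: (e' < e)%N; rewrite /= ?expr0 ?expr1 ?exprS; ring.
Qed.

(** Two edges can be removed in either order with the same averaged result and opposite signs. *)
Lemma tens_diff_diff_state F g : ten F g *m (d *m E *m (d *m E)) = 0.
Proof.
rewrite mulmxA tens_diff_state mulmx_suml.
pose c e e' : C := sgn_edge C F e * sgn_edge C (F :\ e) e' / #|young (F :\ e :\ e')|%:R.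
pose S := \sum_(e in F) \sum_(e' in F :\ e) c e e' *: tens_avg F (F :\ e :\ e') g.
rewrite (_ : \sum_(_ in _) _ = S); last first.
  apply: eq_bigr => e eF; rewrite -scalemxAl tens_avg_diff_state ?subsetDl // scaler_sumr.
  apply: eq_bigr => e' _; rewrite scalerA /c; congr (_ *: _).
  by rewrite -!mulrA; congr (_ * _); rewrite mulrCA mulKf // card_young_neq0.
have eS : S = - S.
  rewrite {1}/S (exchange_big_dep (mem F)) /=; last by move=> t u _; rewrite inE => /andP[].
  rewrite -sumrN; apply: eq_bigr => u uF; rewrite -sumrN; apply: eq_big => [t|t].
    by rewrite !inE uF andbT eq_sym andbC.
  case/andP=> tF; rewrite inE uF andbT inE => ut.
  rewrite /c sgn_edge_anti // 1?eq_sym // setDDl (setUC [set t]) -setDDl.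
  by rewrite mulNr scaleNr.
apply/eqP; have : (2%:R : C) *: S == 0 by rewrite scaler_nat mulr2n {1}eS addNr.
by rewrite scaler_eq0 pnatr_eq0.
Qed.

End Complex.

(** * The Euler characteristic *)

Section HomologyTrace.
Variables (C : numClosedFieldType) (G : mgraph).
Local Notation n := (nv G).
Local Notation m := (ne G).
Local Notation P F := (class_proj C (same_comp (G := G) F)).
Local Notation W F := (Wspace C (G := G) F).
Local Notation ten := (@tens C G).
Local Notation exm := (@ext_mx C n).
Local Notation N := #|state_ext G|.
Local Notation d := (@diff C G).
Local Notation ch := (@chains C G).
Local Notation rl := (@relations C G).
Local Notation E := (@avg_state C G).
Local Notation R := (state_repr C G).
Implicit Types (F : {set 'I_m}) (g h k : 'S_n) (e : 'I_m) (S : {set 'I_n}) (i j : nat).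

Lemma sub_chains F g i j : #|F| = i -> (ext_pow (W F) j *m ten F g <= ch i j)%MS.
Proof.
by move=> Fi; rewrite (sumsmx_sup F) ?Fi // (sumsmx_sup g) // genmxE.
Qed.

Lemma chains_mul_sub i j p q (A : 'M[C]_(N, p)) (U : 'M[C]_(q, p)) :
  (forall F g, #|F| = i -> (ext_pow (W F) j *m ten F g *m A <= U)%MS) ->
  (ch i j *m A <= U)%MS.
Proof.
move=> h; rewrite /chains sumsmxMr_gen; apply/sumsmx_subP=> F /eqP Fi; rewrite genmxE.
rewrite sumsmxMr_gen; apply/sumsmx_subP=> g _; rewrite genmxE.
by rewrite (eqmxMr _ (genmxE _)) h.
Qed.

Lemma relations_mul_sub i j p q (A : 'M[C]_(N, p)) (U : 'M[C]_(q, p)) :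
  (forall F g h, #|F| = i -> h \in young F ->
     (ext_pow (W F) j *m (ten F (h * g)%g - exm (perm_mx h) *m ten F g) *m A <= U)%MS) ->
  (rl i j *m A <= U)%MS.
Proof.
move=> H; rewrite /relations sumsmxMr_gen; apply/sumsmx_subP=> F /eqP Fi; rewrite genmxE.
rewrite sumsmxMr_gen; apply/sumsmx_subP=> g _; rewrite genmxE.
rewrite sumsmxMr_gen; apply/sumsmx_subP=> h Yh; rewrite genmxE.
by rewrite (eqmxMr _ (genmxE _)) H.
Qed.

Lemma ext_pow_ext F j (A : 'M[C]_n) : (A <= W F)%MS ->
  forall F', (ext_pow (W F') j *m exm A <= ext_pow (W F) j)%MS.
Proof.
move=> AW F'; rewrite -ext_pow_deg -mulmxA.
by apply: mulmx_sub; apply: deg_ext_pow.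
Qed.

Lemma sub_relations F g h i j : #|F| = i -> h \in young F ->
  (ext_pow (W F) j *m (ten F (h * g)%g - exm (perm_mx h) *m ten F g) <= rl i j)%MS.
Proof.
move=> Fi Yh; rewrite (sumsmx_sup F) ?Fi // (sumsmx_sup g) // (sumsmx_sup h) //.
by rewrite genmxE.
Qed.

Lemma ext_pow_proj F j (A : 'M[C]_n) :
  ext_pow (W F) j *m exm A = ext_pow (W F) j *m exm (P F *m A).
Proof. by rewrite ext_mxM mulmxA (ext_pow_id j (Wspace_proj C F)). Qed.

Lemma relations_sub_chains i j : (rl i j <= ch i j)%MS.
Proof.
rewrite -[rl i j]mulmx1; apply: relations_mul_sub => F g h Fi Yh.
rewrite mulmx1 mulmxBr addmx_sub ?sub_chains // eqmx_opp mulmxA.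
apply: submx_trans (sub_chains g j Fi); apply: submxMr.
rewrite ext_pow_proj -young_proj //; apply: ext_pow_ext.
by rewrite mulmx_sub // sub_Wspace.
Qed.

Lemma relations_avg i j : rl i j *m E = 0.
Proof.
apply/eqP; rewrite -submx0; apply: relations_mul_sub => F g h Fi Yh.
rewrite -mulmxA mulmxBl -mulmxA !tens_avg_state tens_avgMl // -scalemxAr subrr.
by rewrite mulmx0 sub0mx.
Qed.

(** This says that the differential descends to the chain modules. *)
Lemma relations_diff_avg i j : rl i j *m (d *m E) = 0.
Proof.
apply/eqP; rewrite -submx0; apply: relations_mul_sub => F g h Fi Yh.
rewrite -mulmxA mulmxBl -mulmxA !tens_diff_state mulmx_sumr -sumrB big1 ?mulmx0 ?sub0mx //.
by move=> e _; rewrite tens_avgMl // -scalemxAr subrr.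
Qed.

(** On paper, gh (x) h^-1 x and g (x) x are the same element of the chain module, so averaging
    changes a chain by relations only. *)
Lemma chains_sub_avg i j : (ch i j *m (1%:M - E) <= rl i j)%MS.
Proof.
apply: chains_mul_sub => F g Fi; rewrite -mulmxA.
have -> : ten F g *m (1%:M - E) = - (#|young F|%:R^-1 *:
    \sum_(h in young F) (exm (perm_mx h^-1%g *m P F) *m ten F (h * g)%g - ten F g)).
  rewrite mulmxBr mulmx1 tens_avg_state sumrB sumr_const -scaler_nat scalerBr scalerA.
  by rewrite mulVf ?card_young_neq0 // scale1r opprB.
rewrite mulmxN eqmx_opp -scalemxAr scalemx_sub // mulmx_sumr summx_sub // => h Yh.
have Yh' : h^-1%g \in young F := groupVr (Yh : h \in young_group F).
(* [D] expresses the action of h^-1 on the j-th exterior power of W_F, which S_F preserves. *)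
have [D eD] : exists D, ext_pow (W F) j *m exm (perm_mx h^-1%g *m P F) = D *m ext_pow (W F) j.
  by apply/submxP; apply: ext_pow_ext; rewrite mulmx_sub // sub_Wspace.
have e : ext_pow (W F) j = D *m ext_pow (W F) j *m exm (perm_mx h).
  rewrite -eD -mulmxA -ext_mxM young_proj // -mulmxA -perm_mxM mulVg perm_mx1 mulmx1.
  by rewrite ext_pow_id ?Wspace_proj.
rewrite mulmxBr mulmxA eD [X in _ - X *m _]e -!mulmxA -mulmxBr mulmx_sub // -mulmxBr.
exact: sub_relations.
Qed.

Definition state_deg i j : 'M[C]_N := linext (fun b : state_ext G =>
  let: (F, g, T) := b in ((#|F| == i) && (#|T| == j))%:R *: bvec C b).
Local Notation Deg := state_deg.

Lemma tens_deg F g i j : ten F g *m Deg i j = (#|F| == i)%:R *: (deg_mx C n j *m ten F g).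
Proof.
apply: eq_on_bvec => T; rewrite mulmxA bvec_tens bvecK -scalemxAr mulmxA bvecK.
by rewrite -scalemxAl bvec_tens scalerA -natrM mulnb.
Qed.

Lemma sub_on_tens p q (A : 'M[C]_(N, p)) (U : 'M[C]_(q, p)) :
  (forall F g, (ten F g *m A <= U)%MS) -> (A <= U)%MS.
Proof.
move=> AU; apply/row_subP=> k; rewrite rowE -[k]enum_valK.
move: (enum_val k) => [[F g] T]; rewrite -[delta_mx _ _]/(@bvec C (state_ext G) (F, g, T)).
by rewrite -bvec_tens -mulmxA mulmx_sub.
Qed.

Lemma chains_deg i j : ch i j *m Deg i j = ch i j.
Proof.
apply/eqP; rewrite -subr_eq0 -{2}[ch i j]mulmx1 -mulmxBr -submx0.
apply: chains_mul_sub => F g Fi; rewrite -mulmxA mulmxBr mulmx1 tens_deg Fi eqxx scale1r.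
by rewrite mulmxBr mulmxA ext_pow_deg subrr sub0mx.
Qed.

Lemma deg_avg_comm i j : Deg i j *m E = E *m Deg i j.
Proof.
apply: eq_on_tens => F g; rewrite !mulmxA tens_deg tens_avg_state -!scalemxAl -mulmxA.
rewrite tens_avg_state -scalemxAr scalerA mulrC -scalerA; congr (_ *: _).
rewrite /tens_avg mulmx_sumr mulmx_suml scaler_sumr; apply: eq_bigr => h _.
by rewrite -mulmxA tens_deg -scalemxAr !mulmxA ext_deg.
Qed.

Lemma deg_idem i j : Deg i j *m Deg i j = Deg i j.
Proof.
apply: eq_on_bvec => -[[F g] T]; rewrite mulmxA !bvecK -scalemxAl bvecK scalerA.
by rewrite -natrM mulnb andbb.
Qed.

Lemma deg_avg_idem i j : Deg i j *m E *m (Deg i j *m E) = Deg i j *m E.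
Proof.
by rewrite {1}deg_avg_comm -mulmxA (mulmxA (Deg i j)) deg_idem mulmxA -deg_avg_comm
  -mulmxA avg_state_idem.
Qed.

Lemma deg_avg_sub_chains i j : (Deg i j *m E <= ch i j)%MS.
Proof.
apply: sub_on_tens => F g; rewrite mulmxA tens_deg -scalemxAl.
case: eqP => [Fi|]; last by rewrite scale0r sub0mx.
rewrite scalemx_sub // -mulmxA tens_avg_state -scalemxAr scalemx_sub //.
rewrite /tens_avg mulmx_sumr summx_sub // => h _; rewrite mulmxA.
apply: submx_trans (sub_chains (h * g)%g j Fi); apply: submxMr.
by apply: deg_ext_pow; rewrite mulmx_sub // sub_Wspace.
Qed.

(** The right-hand side is idempotent, so the character of this copy of C_(i,j) becomes an ordinary
    matrix trace. *)
Lemma chains_avg i j : (ch i j *m E :=: Deg i j *m E)%MS.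
Proof.
apply/eqmxP/andP; split.
  by rewrite -chains_deg -mulmxA submxMl.
by rewrite -{1}avg_state_idem mulmxA submxMr // deg_avg_sub_chains.
Qed.

Lemma chains_diff i j : (ch i.+1 j *m d <= ch i j)%MS.
Proof.
apply: chains_mul_sub => F g Fi; rewrite -mulmxA tens_diff mulmx_sumr summx_sub // => e eF.
rewrite -scalemxAr scalemx_sub // /diff_edge mulmx_sumr summx_sub // => c _.
have Fi' : #|F :\ e| = i by move: Fi; rewrite (cardsD1 e) eF => -[].
apply: submx_trans (sub_chains (repr c * g)%g j Fi'); rewrite !mulmxA; apply: submxMr.
rewrite -mulmxA -ext_mxM; apply: ext_pow_ext.
by rewrite mulmx_sub // proj_orthoE.
Qed.

Lemma chains0_diff j : ch 0 j *m d = 0.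
Proof.
apply/eqP; rewrite -submx0; apply: chains_mul_sub => F g /eqP.
by rewrite cards_eq0 => /eqP->; rewrite -mulmxA tens_diff big_set0 mulmx0 sub0mx.
Qed.

Lemma chains_overflow i j : (m < i)%N -> ch i j = 0.
Proof.
move=> mi; apply/eqP; rewrite -submx0 -[ch i j]mulmx1; apply: chains_mul_sub => F g Fi.
by have := max_card (mem F); rewrite Fi card_ord leqNgt mi.
Qed.

Lemma chains_diff_pred i j : (ch i j *m d <= ch i.-1 j)%MS.
Proof. by case: i => [|i]; [rewrite chains0_diff sub0mx | apply: chains_diff]. Qed.

(* Since E kills exactly the relations, this is d o d = 0 in the chain modules. *)
Lemma chains_diff_diff i j : ch i.+1 j *m d *m (d *m E) = 0.
Proof.
have /submxP[D eD] : (ch i.+1 j *m d *m (1%:M - E) <= rl i j)%MS.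
  by apply: submx_trans (chains_sub_avg i j); apply: submxMr; apply: chains_diff.
rewrite -[ch _ _ *m d]mulmx1 -{1}(subrK E 1%:M) mulmxDr eD mulmxDl.
rewrite -(mulmxA D) relations_diff_avg mulmx0 add0r -(mulmxA _ d E) -mulmxA.
suff -> : d *m E *m (d *m E) = 0 by rewrite mulmx0.
by apply: eq_on_tens => F g; rewrite tens_diff_diff_state mulmx0.
Qed.

(** E kills the relations and is the identity modulo them, so a boundary vanishes modulo relations
    exactly when E sends it to 0. *)
Lemma cyclesE i j : (cycles C G i j :=: ch i j :&: kermx (d *m E))%MS.
Proof.
have sub (u : 'rV_N) : (u <= ch i j)%MS ->
    (u *m (d *m cokermx (rl i.-1 j)) == 0) = (u *m (d *m E) == 0).
  move=> uc; rewrite (mulmxA u d (cokermx _)) -submxE (mulmxA u d E);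
    apply/idP/eqP => [/submxP[D ->]|udE].
    by rewrite -mulmxA relations_avg mulmx0.
  rewrite -[u *m d]mulmx1 -(subrK E 1%:M) mulmxDr udE addr0.
  apply: submx_trans (chains_sub_avg i.-1 j); apply: submxMr.
  by apply: submx_trans (chains_diff_pred i j); apply: submxMr.
apply/eqmxP/rV_eqP => u; rewrite !sub_capmx; have [uc|//] := boolP (u <= ch i j)%MS.
by rewrite /= !(sameP sub_kermxP eqP) sub.
Qed.

Lemma boundaries_sub_chains i j : (boundaries C G i j <= ch i j)%MS.
Proof. by rewrite addsmx_sub chains_diff relations_sub_chains. Qed.

Lemma boundaries_sub_cycles i j : (boundaries C G i j <= cycles C G i j)%MS.
Proof.
rewrite cyclesE sub_capmx boundaries_sub_chains /=; apply/sub_kermxP/eqP.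
by rewrite -submx0 addsmxMr addsmx_sub chains_diff_diff relations_diff_avg !sub0mx.
Qed.

Lemma boundaries_avg i j : (boundaries C G i j *m E :=: ch i.+1 j *m (d *m E))%MS.
Proof.
apply: eqmx_trans (addsmxMr _ _ _) _.
by rewrite relations_avg mulmxA; apply: addsmx0.
Qed.

Lemma boundaries_ker i j : (boundaries C G i j :&: kermx E :=: rl i j)%MS.
Proof.
apply/eqmxP/andP; split; last first.
  by rewrite sub_capmx addsmxSr; apply/sub_kermxP/relations_avg.
set U := (_ :&: _)%MS.
have U1 : U *m (1%:M - E) = U.
  by rewrite mulmxBr mulmx1 (sub_kermxP (capmxSr _ _)) subr0.
rewrite -U1; apply: submx_trans (chains_sub_avg i j); apply: submxMr.
exact: submx_trans (capmxSl _ _) (boundaries_sub_chains i j).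
Qed.

Lemma chains_ker i j : (ch i j :&: kermx E :=: rl i j)%MS.
Proof.
apply/eqmxP/andP; split; last first.
  by rewrite sub_capmx relations_sub_chains; apply/sub_kermxP/relations_avg.
set U := (_ :&: _)%MS.
have U1 : U *m (1%:M - E) = U.
  by rewrite mulmxBr mulmx1 (sub_kermxP (capmxSr _ _)) subr0.
by rewrite -U1; apply: submx_trans (chains_sub_avg i j); apply/submxMr/capmxSl.
Qed.

Section Traces.
Variable g : 'S_n.
Let A := R g.

Let stab (U : 'M[C]_N) : mxmodule R U -> (U *m A <= U)%MS.
Proof. by move=> modU; rewrite mxmodule_trans ?inE. Qed.

Let AE : A *m E = E *m A.
Proof. by rewrite /A avg_state_act. Qed.

Let AdE : A *m (d *m E) = d *m E *m A.
Proof. by rewrite /A mulmxA -diff_act -mulmxA avg_state_act mulmxA. Qed.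

(** The trace of g on the image of d_(i,j), an equivariant version of its rank; it enters two
    consecutive homology groups and telescopes. *)
Definition rank_trace i j := trs (ch i j *m (d *m E)) A.

Lemma trs_cycles i j : trs (ch i j) A = rank_trace i j + trs (cycles C G i j) A.
Proof.
rewrite (trs_ker_im (f := d *m E) (A' := A)) ?stab ?chains_module //; last first.
  by rewrite -(mulmxA _ A) AdE !mulmxA.
congr (_ + _); apply/esym/trs_eq; first exact: cyclesE.
by rewrite stab // cycles_module.
Qed.

Lemma trs_boundaries i j : trs (boundaries C G i j) A = rank_trace i.+1 j + trs (rl i j) A.
Proof.
rewrite (trs_ker_im (f := E) (A' := A)) ?stab ?boundaries_module //; last first.
  by rewrite -!mulmxA AE.
congr (_ + _); apply: trs_eq.
- exact: boundaries_avg.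
- by rewrite -mulmxA -AE mulmxA submxMr // stab // boundaries_module.
- exact: boundaries_ker.
by rewrite (eqmxMr _ (boundaries_ker i j)) boundaries_ker stab // relations_module.
Qed.

Lemma trs_chains i j : trs (ch i j) A = \tr (Deg i j *m E *m A) + trs (rl i j) A.
Proof.
rewrite (trs_ker_im (f := E) (A' := A)) ?stab ?chains_module //; last first.
  by rewrite -!mulmxA AE.
congr (_ + _); last first.
  apply: trs_eq; first exact: chains_ker.
  by rewrite (eqmxMr _ (chains_ker i j)) chains_ker stab // relations_module.
rewrite (trs_eq (chains_avg i j)); last first.
  by rewrite -mulmxA -AE mulmxA submxMr // stab // chains_module.
have comm : Deg i j *m A = A *m Deg i j.
  apply: eq_on_tens => F h; rewrite !mulmxA tens_deg tens_act tens_deg.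
  by rewrite -scalemxAl -mulmxA tens_act.
set Q := Deg i j *m E; have QA : Q *m A = A *m Q.
  by rewrite /Q -mulmxA -AE !mulmxA comm.
have QQ : Q *m Q = Q := deg_avg_idem i j.
clearbody Q.
(* The trace over the whole space splits along Q: the kernel contributes 0, and on the image Q acts
   as 1, which leaves A. *)
have <- : trs (1%:M : 'M_N) (Q *m A) = \tr (Q *m A).
  apply: (trs_basis (B := 1%:M : 'M_N)); rewrite ?mul1mx ?mulmx1 //.
  by rewrite row_free_unit unitmx1.
rewrite (trs_ker_im (V := 1%:M) (f := Q) (A' := A)) ?submx1 //; last first.
  by rewrite !mul1mx -mulmxA -QA mulmxA QQ.
rewrite mul1mx [X in _ + X]trs_ker ?addr0 //.
by rewrite mulmxA (sub_kermxP (capmxSr _ _)) mul0mx.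
Qed.

(** The trace on the relations occurs in both cycles and boundaries, and cancels. *)
Lemma mxtrace_homology i j : \tr (homology C G i j g) =
  \tr (Deg i j *m E *m A) - rank_trace i j - rank_trace i.+1 j.
Proof.
rewrite mxtrace_section ?inE ?boundaries_sub_cycles //.
have -> : trs (cycles C G i j) A = trs (ch i j) A - rank_trace i j.
  by rewrite trs_cycles addrC addKr.
by rewrite trs_chains trs_boundaries; ring.
Qed.

Lemma rank_trace0 j : rank_trace 0 j = 0.
Proof. by rewrite /rank_trace mulmxA chains0_diff mul0mx trs_ker ?mul0mx. Qed.

Lemma rank_trace_overflow j : rank_trace m.+1 j = 0.
Proof. by rewrite /rank_trace chains_overflow // mul0mx trs_ker ?mul0mx. Qed.

Lemma alternating_telescope (a : nat -> C) p :
  \sum_(i < p) (-1) ^+ i * (a i + a i.+1) = a 0 - (-1) ^+ p * a p.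
Proof.
elim: p => [|p IH]; first by rewrite big_ord0 mul1r subrr.
by rewrite big_ord_recr /= IH exprS; ring.
Qed.

Lemma tens_coef F (x : 'rV[C]_#|{set 'I_n}|) h k T :
  (x *m ten F h) 0 (enum_rank ((F, k, T) : state_ext G)) = (h == k)%:R * coef x T.
Proof.
rewrite [x in LHS]ext_sum_bvec mulmx_suml summxE (bigD1 T) //= big1 ?addr0 => [|S nST].
  rewrite -scalemxAl bvec_tens mxE bvecE mulrC; congr (_%:R * _); congr nat_of_bool.
  by apply/eqP/eqP => [[]|->].
rewrite -scalemxAl bvec_tens mxE bvecE; case: eqP => [[_ e]|]; last by rewrite mulr0.
by rewrite e eqxx in nST.
Qed.

Lemma mxtrace_deg_avg i j : \tr (Deg i j *m E *m A) =
  \sum_(F : {set 'I_m} | #|F| == i) #|young F|%:R^-1 *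
     \sum_(h in young F) \sum_k (h * (k * g) == k)%g%:R *
        \tr (deg_mx C n j *m exm (perm_mx h^-1%g *m P F)).
Proof.
rewrite mxtrace_bvec.
pose f (b : state_ext G) := (bvec C b *m (Deg i j *m E *m A)) 0 (enum_rank b).
transitivity (\sum_F \sum_k \sum_T f (F, k, T)).
  by rewrite pair_bigA pair_bigA; apply: eq_bigr => -[[F k] T].
rewrite [RHS]big_mkcond; apply: eq_bigr => F _.
have fE k T : f (F, k, T) = (#|F| == i)%:R * (#|young F|%:R^-1 *
    \sum_(h in young F) (h * (k * g) == k)%g%:R *
      coef (bvec C T *m (deg_mx C n j *m exm (perm_mx h^-1%g *m P F))) T).
  rewrite /f -bvec_tens -mulmxA !(mulmxA (ten F k)) tens_deg -!scalemxAl -scalemxAr mxE;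
    congr (_ * _).
  rewrite -!mulmxA (mulmxA (ten F k)) tens_avg_state -scalemxAl -!scalemxAr mxE; congr (_ * _).
  rewrite /tens_avg mulmx_suml !mulmx_sumr summxE; apply: eq_bigr => h _.
  by rewrite -!mulmxA tens_act -mulgA !mulmxA tens_coef.
under eq_bigr do under eq_bigr do rewrite fE.
case: eqP => [_|_]; last by rewrite big1 // => k _; rewrite big1 // => T _; rewrite mul0r.
pose c h T := coef (bvec C T *m (deg_mx C n j *m exm (perm_mx h^-1%g *m P F))) T.
transitivity (\sum_(h in young F) \sum_k \sum_T
    #|young F|%:R^-1 * ((h * (k * g) == k)%g%:R * c h T)).
  rewrite [RHS]exchange_big; apply: eq_bigr => k _ /=.
  rewrite [RHS]exchange_big; apply: eq_bigr => T _ /=.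
  by rewrite mul1r mulr_sumr.
rewrite mulr_sumr; apply: eq_bigr => h _; rewrite mulr_sumr; apply: eq_bigr => k _.
by rewrite mxtrace_coef !mulr_sumr.
Qed.

Lemma euler_character :
  \sum_(j < n.+1) \sum_(i < m.+1) (-1) ^+ (i + j) * \tr (homology C G i j g) =
  \sum_(F : {set 'I_m}) (-1) ^+ #|F| * (#|young F|%:R^-1 *
     \sum_(h in young F) \sum_k (h * (k * g) == k)%g%:R *
        \det (1%:M - perm_mx h^-1%g *m P F)).
Proof.
transitivity (\sum_(j < n.+1) \sum_(i < m.+1) (-1) ^+ (i + j) * \tr (Deg i j *m E *m A)).
  apply: eq_bigr => j _; apply/eqP; rewrite -subr_eq0 -sumrB.
  rewrite (eq_bigr (fun i : 'I_m.+1 => - (-1) ^+ j * ((-1)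
    ^+ i * (rank_trace i j + rank_trace i.+1 j)))).
    rewrite -mulr_sumr (alternating_telescope (fun i => rank_trace i j)).
    by rewrite rank_trace0 rank_trace_overflow mulr0 subrr mulr0.
  by move=> i _; rewrite mxtrace_homology exprD; ring.
pose D F h j := \tr (deg_mx C n j *m exm (perm_mx h^-1%g *m P F)).
pose X F j : C := #|young F|%:R^-1 *
     \sum_(h in young F) \sum_k (h * (k * g) == k)%g%:R * D F h j.
transitivity (\sum_(j < n.+1) \sum_(F : {set 'I_m}) (-1) ^+ #|F| * ((-1) ^+ j * X F j)).
  apply: eq_bigr => j _.
  have lt (F : {set 'I_m}) : (#|F| < m.+1)%N by rewrite ltnS (leq_trans (max_card _)) ?card_ord.
  rewrite [RHS](partition_big (fun F => Ordinal (lt F)) predT) //=; apply: eq_bigr => i _.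
  rewrite mxtrace_deg_avg mulr_sumr; apply: eq_big => F; first by rewrite -val_eqE.
  by move=> /eqP Fi; rewrite -Fi exprD mulrA.
rewrite exchange_big; apply: eq_bigr => F _ /=; rewrite -mulr_sumr; congr (_ * _).
rewrite /X; under [LHS]eq_bigr do rewrite mulrCA mulr_sumr.
rewrite -mulr_sumr exchange_big; congr (_ * _); apply: eq_bigr => h _ /=.
under eq_bigr do rewrite mulr_sumr.
rewrite exchange_big; apply: eq_bigr => k _ /=.
rewrite -supertrace_ext mulr_sumr; apply: eq_bigr => j _.
by rewrite mulrCA.
Qed.

End Traces.
End HomologyTrace.

(** * Counting colourings by inclusion-exclusion *)

Section FinalCount.
Variables (C : numClosedFieldType) (G : mgraph) (mu : mono).
Local Notation n := (nv G).
Local Notation m := (ne G).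
Local Notation P F := (class_proj C (same_comp (G := G) F)).
Local Notation col := {ffun 'I_n -> finsupp mu}.
Local Notation fx := (@fix_colour C n mu).
Implicit Types (F : {set 'I_m}) (g h k : 'S_n) (kappa : col).

Definition comp_const F kappa : bool :=
  [forall u, forall v, same_comp F u v ==> (kappa u == kappa v)].

Definition mono_edges kappa : {set 'I_m} :=
  [set e | kappa (ends (m := G) e).1 == kappa (ends e).2].

Lemma comp_constE F kappa : comp_const F kappa = (F \subset mono_edges kappa).
Proof.
apply/forallP/subsetP => [H e eF | sub u].
  rewrite inE; have /forallP/(_ (ends e).2)/implyP := H (ends e).1; apply.
  apply: connect1; apply/exists_inP; exists e => //.
  by rewrite -surjective_pairing eqxx.
apply/forallP=> v; apply/implyP=> uv.
have cl : closed (adj F) [pred w | kappa w == kappa u].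
  move=> x y /exists_inP[e /sub]; rewrite !inE => /eqP ke.
  by case/orP=> /eqP exy; move: ke; rewrite exy /= => ->.
by have := closed_connect cl uv; rewrite !inE eqxx eq_sym => <-.
Qed.

(** Expansion of the product over all edges of 1 - [e in A]. *)
Lemma sum_sign_subsets (A : {set 'I_m}) :
  \sum_(F : {set 'I_m}) (-1) ^+ #|F| * (F \subset A)%:R = (A == set0)%:R :> C.
Proof.
transitivity (\prod_(e : 'I_m) (- (e \in A)%:R + 1) : C).
  rewrite bigA_distr /=; apply: eq_bigr => F _.
  rewrite -big_mkcond /= prodrN; congr (_ * _).
  case: (boolP (F \subset A)) => [/subsetP FA|/subsetPn[e eF eA]].
    by rewrite big1 // => e /FA->.
  by rewrite (bigD1 e) //= (negPf eA) mul0r.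
have [->|/set0Pn[e eA]] := eqVneq A set0.
  by rewrite big1 // => e _; rewrite inE oppr0 add0r.
by rewrite (bigD1 e) //= eA addNr mul0r.
Qed.

(** If [kappa] is constant on the components, all of S_F fixes it and the determinants have mean 1.
    If not, every h that fixes [kappa] has determinant 0. *)
Lemma sum_young_stab F kappa :
  \sum_(h in young F) (h \in colour_stab kappa)%:R * \det (1%:M - perm_mx h^-1%g *m P F) =
    (comp_const F kappa)%:R * #|young F|%:R.
Proof.
transitivity (\sum_(h in young F) (comp_const F kappa)%:R * \det (1%:M - perm_mx h *m P F)).
  rewrite -(@sum_groupV _ _ (young_group F)); apply: eq_bigr => h Yh.
  rewrite invgK (@groupV _ (colour_stab_group kappa)).
  case: (boolP (comp_const F kappa)) => [/forallP cst|ncst].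
    congr (_%:R * _); congr nat_of_bool; apply/colour_stabP => v.
    have /forallP/(_ (h v))/implyP := cst v.
    by move/class_permsP: Yh => /(_ v) Yh /(_ Yh)/eqP.
  case: (boolP (h \in _)) => [/colour_stabP Hh|]; last by rewrite !mul0r.
  have /existsP[u /existsP[v]] : [exists u, exists v, ~~ (same_comp F u v ==> (kappa u ==
    kappa v))].
    by move: ncst; rewrite negb_forall => /existsP[u]; rewrite negb_forall => uv;
      apply/existsP; exists u.
  rewrite negb_imply => /andP[uv nk].
  rewrite (det_class_proj_eq0 C _ _ _ Yh Hh uv nk) ?mulr0 //.
  - exact: same_comp_refl.
  - exact: same_comp_sym.
  exact: same_comp_trans.
rewrite -mulr_sumr sum_det_class_proj //.
- exact: same_comp_refl.
- exact: same_comp_sym.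
exact: same_comp_trans.
Qed.

(** For each k exactly one g satisfies the equation, and its inverse is a conjugate of h. This is
    where induction from S_F is undone, as in Frobenius reciprocity. *)
Lemma sum_conj_fix h (c : C) :
  \sum_g fx g^-1%g * (\sum_k (h * (k * g) == k)%g%:R * c) = n`!%:R * (fx h * c).
Proof.
under eq_bigr do rewrite mulr_sumr.
rewrite exchange_big /= (eq_bigr (fun=> fx h * c)) => [|k _].
  by rewrite sumr_const card_Sn mulr_natl.
rewrite (bigD1 (k^-1 * h^-1 * k)%g) //= big1 ?addr0 => [|g ng].
  have -> : (h * (k * (k^-1 * h^-1 * k)))%g = k by rewrite !mulgA mulgK mulgV mul1g.
  have -> : (k^-1 * h^-1 * k)^-1%g = (h ^ k)%g by rewrite !invMg !invgK.
  by rewrite eqxx mul1r fix_colourJ.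
case: eqP => [e|_]; last by rewrite mul0r mulr0.
by case/eqP: ng; rewrite -{2}e !mulgA mulgKV mulVg mul1g.
Qed.

Lemma Frob_chromsym : (Frob C G 1 1 mu)%:~R = (chromsym G mu)%:~R :> C.
Proof.
pose X (F : {set 'I_m}) g := \sum_(h in young F) \sum_k (h * (k * g) == k)%g%:R *
        \det (1%:M - perm_mx h^-1%g *m P F).
transitivity (cdot fx (fun g => \sum_(F : {set 'I_m}) ((-1) ^+ #|F| / #|young F|%:R) * X F g)).
  transitivity (cdot fx (fun g => \sum_(j < n.+1) 1 * \sum_(i < m.+1) (-1) ^+ (i + j)
    * \tr (homology C G i j g))); last first.
    congr (_ * _); apply: eq_bigr => g _; congr (_ * _).
    under [LHS]eq_bigr do rewrite mul1r.
    by rewrite euler_character; apply: eq_bigr => F _; rewrite mulrA.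
  rewrite cdot_sumr /Frob exchange_big rmorph_sum; apply: eq_bigr => j _ /=.
  rewrite mul1r cdot_sumr rmorph_sum; apply: eq_bigr => i _ /=.
  by rewrite !expr1n !mulr1 intrM frob_char_cdot rmorph_sign cdotC.
rewrite cdot_sumr.
transitivity (\sum_(F : {set 'I_m}) (-1) ^+ #|F| * \sum_(kappa
  : col | has_content kappa) (comp_const F kappa)%:R : C).
  apply: eq_bigr => F _; rewrite -mulrA; congr (_ * _).
  rewrite /cdot /X; under eq_bigr do rewrite mulr_sumr.
  rewrite exchange_big /=; under eq_bigr do rewrite sum_conj_fix.
  rewrite -mulr_sumr [X in _ * X]mulrA mulVf ?mul1r; last by rewrite pnatr_eq0 -lt0n fact_gt0.
  under [X in _ * X]eq_bigr => h Yh do rewrite fix_colourE mulr_suml.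
  rewrite exchange_big /= mulr_sumr; apply: eq_bigr => kappa _.
  by rewrite sum_young_stab mulrCA mulVf ?mulr1 // card_young_neq0.
under eq_bigr do rewrite mulr_sumr.
rewrite exchange_big /= /chromsym -[RHS]/(#|_|%:R
  : C) -sum1_card natr_sum big_mkcond [RHS]big_mkcond /=.
apply: eq_bigr => kappa _; rewrite inE andbC.
case: (has_content kappa) => //=.
under eq_bigr do rewrite comp_constE.
rewrite sum_sign_subsets (_ : Defs.proper kappa = (mono_edges kappa == set0)).
  by case: eqP.
apply/forallP/eqP => [H|H e]; first by apply/setP=> e; rewrite !inE (negPf (H e)).
by have /setP/(_ e) := H; rewrite !inE => /negbT.
Qed.

End FinalCount.

Theorem theorem2p13 (C : numClosedFieldType) (G : mgraph) :
  Frob C G 1 1 =1 chromsym G.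
Proof.
(* The coefficients are integers, compared in C, where the characters take their values. *)
move=> mu; apply: (@intr_inj C).
exact: Frob_chromsym.
Qed.
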